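(* Let $X,Y$ be compact metric spaces, $S$ a real Banach space, $\mathcal{F}\subset S^*$ a linear subspace separating the points of $S$, $\mu\in\mathcal{M}(X,S)$ and $\nu\in\mathcal{M}(Y,S)$, with fixed representations $\mu=(\frac{d\mu}{d|\mu|},|\mu|)$, $\nu=(\frac{d\nu}{d|\nu|},|\nu|)$, where $\frac{d\mu}{d|\mu|}:X\to S$ is norm bounded and $w(\mathcal{F})$-continuous. Let $G$ be the set of all convex and $w(\mathcal{F})$-lower semicontinuous functions $g:S\to\mathbb{R}$. Consider the following statements: 1. There exists a kernel $Q\in\mathrm{ker}(Y,X)$ such that $Q|\nu|=|\mu|$ and $\int_X\frac{d\mu}{d|\mu|}(x)\,dQ_y(x)=\frac{d\nu}{d|\nu|}(y)$ for $|\nu|$-almost every $y$. 2. $\int_X g\big(\frac{d\mu}{d|\mu|}\big)d|\mu|\ge\int_Y g\big(\frac{d\nu}{d|\nu|}\big)d|\nu|$ for every $g\in G$. 3. $\Pi\big(\mu,\nu,\frac{d\mu}{d|\mu|}\big)\neq\emptyset$. 4. There exists a kernel $P\in\mathrm{ker}(X,Y)$ such that $P\mu=\nu$. (a) If there exists $s^*\in S^*$ such that $\langle s^*,\frac{d\mu}{d|\mu|}\rangle\equiv\langle s^*,\frac{d\nu}{d|\nu|}\rangle\equiv 1$, then statements 1, 2, 3, 4 are equivalent. (b) If instead one only assumes that there exists $f\in C(X,\mathcal{F})$ with $\langle f(x),\frac{d\mu}{d|\mu|}(x)\rangle=1$ for all $x\in X$, then $1\Rightarrow 2\Rightarrow 3\Leftrightarrow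 4$.
   Context: Metric spaces carry their Borel $\sigma$-algebras. $\mathcal{M}_+(\Omega)$ is the set of finite non-negative (Borel) measures on $\Omega$ and $\mathcal{P}(\Omega)$ the set of probability measures. $\mathcal{M}(\Omega,S)$ is the set of $S$-valued measures $\mu$ of the form $\mu(A)=\int_A\eta\,d|\mu|$ (Bochner integral) for some $|\mu|\in\mathcal{M}_+(\Omega)$ and some Bochner integrable $\eta:\Omega\to S$; one writes $\mu=(\eta,|\mu|)$ and $\eta=\frac{d\mu}{d|\mu|}$. For $f:\Omega\to S^*$, $\int_\Omega f\,d\mu:=\int_\Omega\langle f,\frac{d\mu}{d|\mu|}\rangle\,d|\mu|$; for $g:\Omega\to\mathbb{R}$, $\int_\Omega g\,d\mu:=\int_\Omega g\frac{d\mu}{d|\mu|}d|\mu|\in S$. $w(\mathcal{F})$ is the weak topology on $S$ generated by $\mathcal{F}$. $C(X,\mathcal{F})$ is the space of continuous functions into $\mathcal{F}$ with the norm of $S^*$. A kernel $P\in\mathrm{ker}(X,Y)$ is a family $\{P_x\}_{x\in X}$ of Borel probability measures on $Y$ such that $x\mapsto P_x(B)$ is Borel measurable for every Borel $B\subset Y$. For such $P$ and a scalar or $S$-valued measure $\mu$ on $X$, $P\mu$ is the measure on $Y$ given by $P\mu(B)=\int_X P_x(B)\,d\mu(x)$. The set $\mathrm{ker}(Y,X)$ and $Q|\nu|$ are defined analogously. $\Pi(\mu,\nu,\frac{d\mu}{d|\mu|})$ is the set of $\pi\in\mathcal{M}_+(X\times Y)$ such that for all $\psi\in C(X,\mathcal{F})$,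 $\varphi\in C(Y,\mathcal{F})$: $\int_{X\times Y}\langle\psi(x)+\varphi(y),\frac{d\mu}{d|\mu|}(x)\rangle\,d\pi(x,y)=\int_X\psi\,d\mu+\int_Y\varphi\,d\nu$. *)

(* Defs.v *)
From HB Require Import structures.
From mathcomp Require Import all_boot all_order all_algebra.
From mathcomp Require Import all_classical all_reals all_analysis.
Set Implicit Arguments.
Unset Strict Implicit.
Unset Printing Implicit Defensive.
Import Order.TTheory GRing.Theory Num.Theory.
Import numFieldNormedType.Exports.
Local Open Scope classical_set_scope.
Local Open Scope ring_scope.

(* Measurable types are pointed in the library, so spaces are nonempty. *)
#[short(type="pmetricType")]
HB.structure Definition PointedMetric (K : numDomainType) :=
  {M of Pointed M & Metric K M}.

(* [borel T] is convertible to [T], so functions on [T] are functions on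
   [borel T]. *)
Notation borel T := (g_sigma_algebraType (@open T%type)).

Section Bochner.
Context d (T : measurableType d) (R : realType) (S : normedModType R).
Implicit Types (m : {measure set T -> \bar R}) (f : T -> S).

Definition simple_fun (s : T -> S) :=
  finite_set (range s) /\ forall v, measurable (s @^-1` [set v]).

(* Finitely supported sum; meant for simple [s] and finite [m]. *)
Definition simple_integral m (s : T -> S) : S :=
  \sum_(v \in [set: S]) fine (m (s @^-1` [set v])) *: v.

Definition strongly_measurable m f :=
  exists2 s : nat -> T -> S, (forall n, simple_fun (s n)) &
    {ae m, forall x, s ^~ x @ \oo --> f x}.

(* For [f] strongly measurable, [`|f x - s n x|] is a.e. equal to a measurable
   function, and the (lower) integral of the library then agrees with the
   integral for the completed measure. *)
Definition bochner_approx m f (s : nat -> T -> S) :=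
  (forall n, simple_fun (s n)) /\
  (\int[m]_x (`|f x - s n x|)%:E)%E @[n --> \oo] --> 0%E.

Definition bochner_integrable m f :=
  strongly_measurable m f /\ exists s, bochner_approx m f s.

Definition is_bochner_integral m f (v : S) :=
  strongly_measurable m f /\
  exists2 s, bochner_approx m f s & simple_integral m (s n) @[n --> \oo] --> v.

Definition bochner_integral m f : S := xget 0 (is_bochner_integral m f).

End Bochner.

(* An S-valued measure together with a fixed representation (density, tv);
   [tv] need not be the total variation measure. *)
Record svmeasure d (T : measurableType d) (R : realType) (S : normedModType R)
  := SVMeasure {
  tv : {finite_measure set T -> \bar R};
  density : T -> S;
  density_integrable : bochner_integrable tv density }.

Section svmeasure.
Context d (T : measurableType d) (R : realType) (S : normedModType R).
Implicit Type mu : svmeasure T S.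

Definition sv_integral mu (g : T -> R) : S :=
  bochner_integral (tv mu) (fun x => g x *: density mu x).

Definition sv_eval mu (A : set T) : S := sv_integral mu \1_A.

Definition sv_pairing mu (f : T -> S -> R^o) : \bar R :=
  (\int[tv mu]_x (f x (density mu x))%:E)%E.

End svmeasure.

Section kernel_push.
Context d d' (T : measurableType d) (U : measurableType d') (R : realType).
Variable P : R.-pker T ~> U.

Definition kpush (m : {measure set T -> \bar R}) (B : set U) : \bar R :=
  (\int[m]_x P x B)%E.

Definition sv_kpush (S : normedModType R) (mu : svmeasure T S) (B : set U) : S :=
  sv_integral mu (fun x => fine (P x B)).

End kernel_push.

Section dual.
Context (R : realType) (S : normedModType R).
Implicit Types (l : S -> R^o) (F : set (S -> R^o)).

Definition topological_dual : set (S -> R^o) :=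
  [set l | linear l /\ continuous l].

Definition dual_norm l : R := sup [set `|l s| | s in [set s | `|s| <= 1]].

Definition dual_subspace F :=
  [/\ F `<=` topological_dual, F (fun=> 0) &
      forall (a : R) l k, F l -> F k -> F (fun s => a *: l s + k s)].

Definition separates_points F :=
  forall s t, s <> t -> exists2 l, F l & l s <> l t.

(* Initial topology of the evaluation map into R^F: the coarsest topology making
   all [l] in [F] continuous. *)
Definition weak_topology F : Type :=
  initial_topology (fun (s : S) => (fun l : F => \val l s) : {ptws F -> R^o}).

(* Continuity into [F] for the norm of the dual. *)
Definition continuous_into (X : topologicalType) F : set (X -> S -> R^o) :=
  [set psi : X -> S -> R^o | (forall x, F (psi x)) /\
     forall x, dual_norm (fun s => psi x' s - psi x s) @[x' --> x] --> 0].

Definition convex_wlsc F : set (S -> R) :=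
  [set g | convex_function [set: S] (g : S -> R^o) /\
     lower_semicontinuous (fun s : weak_topology F => (g s)%:E)].

End dual.

Section statements.
Context (R : realType) (X Y : pmetricType R) (S : normedModType R).
Variables (F : set (S -> R^o)).
Variables (mu : svmeasure (borel X) S) (nu : svmeasure (borel Y) S).

Definition plans : set {finite_measure set (borel (X * Y)) -> \bar R} :=
  [set pi : {finite_measure set (borel (X * Y)) -> \bar R} |
    forall (psi : X -> S -> R^o) (phi : Y -> S -> R^o),
    continuous_into F psi -> continuous_into F phi ->
    (\int[pi]_z (psi z.1 (density mu z.1) + phi z.2 (density mu z.1))%:E =
     sv_pairing mu psi + sv_pairing nu phi)%E].

Definition kernel_barycenter := exists Q : R.-pker (borel Y) ~> (borel X),
  (forall A, measurable A -> kpush Q (tv nu) A = tv mu A) /\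
  {ae tv nu, forall y, is_bochner_integral (Q y) (density mu) (density nu y)}.

(* The integrals may be +oo, hence are compared in the extended reals. *)
Definition convex_domination := forall g, convex_wlsc F g ->
  (\int[tv nu]_y (g (density nu y))%:E <= \int[tv mu]_x (g (density mu x))%:E)%E.

Definition kernel_transport := exists P : R.-pker (borel X) ~> (borel Y),
  forall B, measurable B -> sv_kpush P mu B = sv_eval nu B.

End statements.

(* Main.v *)
Require Import Defs.
From HB Require Import structures.
From mathcomp Require Import all_boot all_order all_algebra.
From mathcomp Require Import all_classical all_reals all_analysis.
From mathcomp Require Import measurable_realfun finmap ring lra.
Set Implicit Arguments.
Unset Strict Implicit.
Unset Printing Implicit Defensive.
Import Order.TTheory GRing.Theory Num.Theory.
Import numFieldNormedType.Exports.
Local Open Scope classical_set_scope.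
Local Open Scope ring_scope.

(** Idea. Write [h] and [k] for the densities of [mu] and [nu]. Statements 2, 3 and
    4 each imply the positivity condition [nonneg_pairing]: the pairing of [mu]
    with [psi] plus that of [nu] with [phi] is nonnegative whenever
    [psi x (h x) + phi y (h x) >= 0] for all [x, y]. From 2 one uses
    [g s = sup_y - phi y s], and from 4 one approximates [phi] by a function of [y]
    with finitely many values. Statement 1 implies 2 by Jensen's inequality.

    Conversely, parametrise [X * Y] by the Cantor space [K]. The condition says that
    the functional sending [psi x (h x) + phi y (h x)] to the sum of the pairings is
    positive, and the section with [f x (h x) = 1] puts the constants in its domain.
    A positive extension gives a content on the clopen sets of [K], hence a measure.
    Its image in [X * Y] is a plan; its disintegration over [X] is a kernel [P] with
    [P mu = nu].

    Under the hypothesis of (a), applying [l] to [P mu = nu] shows that the second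
    marginal is that of [nu], so the same measure disintegrates over [Y] into a kernel
    [Q]. If the simple functions [s_i] converge to [h] in L1, then
    [int |int s_i dQ_y - k y| dnu <= int |h - s_i| dmu], so the barycenter of [h] under
    [Q_y] is [k y] almost everywhere. *)

(** * Positive extensions and measures on the Cantor space *)

(** The Cantor space is chosen because its clopen sets form a countable algebra that generates the
    Borel sets, and compactness makes every content on them sigma-additive. A positive form thus
    becomes a measure by evaluation on clopen indicators, and a disintegration needs only countably
    many Radon-Nikodym densities, corrected on one null set.

    In the second variable a plan is tested only through the numbers [l (h x)] with [l] in [F]. The
    functional of (a) lies in the dual but perhaps not in [F], so it cannot serve as a test: the
    vector identity [P mu = nu] has to be proved before that functional is applied to it.

    The barycenter identity is not checked functional by functional, since the exceptional null set
    would depend on [l] and [F] may be uncountable. In the L1 estimate [F] only has to separate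
    single vectors, namely integrals over one Borel set [B]. The estimate is a contraction: [P] and
    [Q] are adjoint, so the integral over [B] of [int s dQ_y - k y] is that of
    [P x B *: (s x - h x)], and the weights [P x B] over a partition of [Y] add up to 1. *)

Section hahn_banach.
Context (R : realType) (E : lmodType R) (D : set E).
Hypotheses (DD : forall x y, D x -> D y -> D (x + y))
  (DZ : forall (c : R) x, D x -> D (c *: x)).

Definition sublinear_on (q : E -> R) :=
  (forall x y, D x -> D y -> q (x + y) <= q x + q y) /\
  (forall (c : R) x, 0 <= c -> D x -> q (c *: x) <= c * q x).

Let D_opp x : D x -> D (- x).
Proof. by move=> Dx; rewrite -scaleN1r; exact: DZ. Qed.

Let sub0 q x : sublinear_on q -> D x -> 0 <= q x + q (- x).
Proof.
move=> [qD qZ] Dx; have D0 : D 0 by rewrite -(scale0r x); exact: DZ.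
have := qD _ _ Dx (D_opp Dx); rewrite subrr; apply: le_trans.
by have := qD _ _ D0 D0; rewrite addr0 lerDl.
Qed.

Let le_mul_inf (B : set R) (a c : R) : B !=set0 -> has_lbound B -> 0 <= c ->
  (forall b, B b -> a <= c * b) -> a <= c * inf B.
Proof.
move=> [b0 Bb0] lB; rewrite le_eqVlt => /predU1P[<-|c0] aB.
  by have := aB _ Bb0; rewrite !mul0r.
rewrite -ler_pdivrMl//; apply: lb_le_inf; first by exists b0.
by move=> b /aB; rewrite ler_pdivrMl.
Qed.

(** The infimum is finite because [q x >= - q (- x) >= - p (- x)] for every member [q].
    Subadditivity uses that the chain is total: of two members, the smaller one bounds both
    terms. *)
Let chain_inf (p : E -> R) (A : set (E -> R)) : A !=set0 ->
  (forall q, A q -> sublinear_on q /\ forall x, D x -> q x <= p x) ->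
  (forall q r, A q -> A r -> (forall x, D x -> q x <= r x) \/
                             (forall x, D x -> r x <= q x)) ->
  sublinear_on (fun x => inf [set q x | q in A]) /\
  forall q x, A q -> D x -> inf [set q x | q in A] <= q x.
Proof.
move=> [q0 Aq0] Ap tA.
have lbA x : D x -> has_lbound [set q x | q in A].
  move=> Dx; exists (- p (- x)) => _ [q Aq <-].
  have [sq qp] := Ap _ Aq; rewrite lerNl.
  apply: le_trans (qp _ (D_opp Dx)); rewrite lerNl -subr_ge0 opprK.
  exact: sub0.
have infle q x : A q -> D x -> inf [set q x | q in A] <= q x.
  by move=> Aq Dx; apply: ge_inf; [exact: lbA|exists q].
have neA x : [set q x | q in A] !=set0 by exists (q0 x), q0.
split=> //; split=> [x y Dx Dy|c x c0 Dx].
- rewrite -lerBlDr; apply: lb_le_inf => // _ [q Aq <-].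
  rewrite lerBlDr -lerBlDl; apply: lb_le_inf => // _ [r Ar <-].
  rewrite lerBlDl; have Dxy := DD Dx Dy.
  have [qr|rq] := tA _ _ Aq Ar.
  + apply: (le_trans (infle q _ Aq Dxy)).
    by apply: le_trans ((Ap _ Aq).1.1 _ _ Dx Dy) _; rewrite lerD2l qr.
  + apply: (le_trans (infle r _ Ar Dxy)).
    by apply: le_trans ((Ap _ Ar).1.1 _ _ Dx Dy) _; rewrite lerD2r rq.
- apply: le_mul_inf => //; first exact: lbA.
  move=> _ [q Aq <-]; apply: (le_trans (infle q _ Aq (DZ c Dx))).
  exact: (Ap _ Aq).1.2.
Qed.

(* Lowers [q] so that it becomes additive in the direction [u]. *)
Let tilt (q : E -> R) u x := inf [set q (x + t *: u) - t * q u | t in [set t : R | 0 <= t]].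

(** Homogeneity is assumed only as an upper bound; applied to [t^-1] it yields the opposite one. *)
Let homog_ge q (t : R) u : sublinear_on q -> 0 <= t -> D u -> t * q u <= q (t *: u).
Proof.
move=> sq; rewrite le_eqVlt => /predU1P[<-|t0] Du.
  rewrite mul0r scale0r; have D0 : D 0 by rewrite -(scale0r u); exact: DZ.
  by have := sq.1 _ _ D0 D0; rewrite addr0 lerDl.
rewrite -ler_pdivlMl//; have /= := sq.2 t^-1 _ _ (DZ t Du).
by rewrite scalerA mulVf ?gt_eqF// scale1r; apply; rewrite invr_ge0 ltW.
Qed.

Let tilt_lb q u x : sublinear_on q -> D u -> D x ->
  has_lbound [set q (x + t *: u) - t * q u | t in [set t : R | 0 <= t]].
Proof.
move=> sq Du Dx; exists (- q (- x)) => _ [t t0 <-].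
have Dt := DZ t Du; have := homog_ge sq t0 Du.
have := sq.1 _ _ (DD Dx Dt) (D_opp Dx).
by rewrite addrAC subrr add0r; lra.
Qed.

Let tilt_le q u x (t : R) : sublinear_on q -> D u -> D x -> 0 <= t ->
  tilt q u x <= q (x + t *: u) - t * q u.
Proof. by move=> sq Du Dx t0; apply: ge_inf; [exact: tilt_lb|exists t]. Qed.

Let tilt_ne (q : E -> R) u x : [set q (x + t *: u) - t * q u | t in [set t : R | 0 <= t]] !=set0.
Proof. by exists (q (x + 0 *: u) - 0 * q u), 0 => /=. Qed.

(** Parameters [s] for [x] and [t] for [y] combine into [s + t] for [x + y], and [t] for [x] becomes
    [c * t] for [c *: x]. *)
Let tilt_sublinear q u : sublinear_on q -> D u -> sublinear_on (tilt q u).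
Proof.
move=> sq Du; split=> [x y Dx Dy|c x c0 Dx].
- rewrite -lerBlDr; apply: lb_le_inf => // _ [s /= s0 <-].
  rewrite lerBlDr -lerBlDl; apply: lb_le_inf => // _ [t /= t0 <-].
  have := tilt_le sq Du (DD Dx Dy) (addr_ge0 s0 t0).
  have := sq.1 _ _ (DD Dx (DZ s Du)) (DD Dy (DZ t Du)).
  by rewrite addrACA -scalerDl; lra.
- apply: le_mul_inf => //; first exact: tilt_lb.
  move=> _ [t /= t0 <-].
  have := tilt_le sq Du (DZ c Dx) (mulr_ge0 c0 t0).
  have := sq.2 _ _ c0 (DD Dx (DZ t Du)).
  by rewrite scalerDr scalerA; lra.
Qed.

(** A minimal sublinear functional below [p] is additive: tilting it in a direction [u] cannot lower
    it, and the parameter 1 in the tilt then gives [q x + q u <= q (x + u)]. Everything is relative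
    to the set [D], so that bounded functions need no type of their own. *)
Theorem hahn_banach_dominated (p : E -> R) : sublinear_on p ->
  exists L : E -> R, [/\ forall x y, D x -> D y -> L (x + y) = L x + L y,
    forall (c : R) x, D x -> L (c *: x) = c * L x &
    forall x, D x -> L x <= p x].
Proof.
move=> sp.
pose Q := {q : E -> R | sublinear_on q /\ forall x, D x -> q x <= p x}.
(* The order is reversed, so that a maximal element for Zorn's lemma is a minimal functional. *)
pose le (q r : Q) := `[< forall x, D x -> sval r x <= sval q x >].
pose p0 : Q := exist _ p (conj sp (fun x _ => lexx _)).
have [|||[q [sq qp]] maxq] := @ZL_preorder Q p0 le.
- by move=> q; apply/asboolP => x.
- move=> q r s /asboolP qr /asboolP rs; apply/asboolP => x Dx.
  by apply: le_trans (qr _ Dx); exact: rs.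
- move=> A tA; have [A0|/set0P[q0 Aq0]] := eqVneq A set0.
    by exists p0 => s; rewrite A0.
  have [|||si ile] := @chain_inf p [set sval q | q in A].
  + by exists (sval q0), q0.
  + by move=> _ [q Aq <-]; exact: (svalP q).
  + move=> _ _ [q Aq <-] [r Ar <-].
    by have [/asboolP|/asboolP] := tA _ _ Aq Ar; [right|left].
  + have ip x : D x -> inf [set q x | q in [set sval q | q in A]] <= p x.
      move=> Dx; apply: le_trans ((svalP q0).2 _ Dx); apply: ile => //.
      by exists q0.
    pose t : Q := exist _ _ (conj si ip).
    exists t => s As; apply/asboolP => x Dx /=.
    by apply: ile => //; exists s.
have add_ge x u : D x -> D u -> q x + q u <= q (x + u).
  move=> Dx Du.
  have tq y : D y -> tilt q u y <= q y.
    move=> Dy; have := tilt_le sq Du Dy (lexx 0).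
    by rewrite scale0r addr0 mul0r subr0.
  have tp y : D y -> tilt q u y <= p y.
    by move=> Dy; exact: le_trans (tq _ Dy) (qp _ Dy).
  have /maxq/asboolP/(_ x Dx)/= : le (exist _ q (conj sq qp))
      (exist _ (tilt q u) (conj (tilt_sublinear sq Du) tp)).
    by apply/asboolP.
  have := tilt_le sq Du Dx ler01.
  by rewrite scale1r mul1r; lra.
have qD x u : D x -> D u -> q (x + u) = q x + q u.
  by move=> Dx Du; apply/eqP; rewrite eq_le sq.1// add_ge.
have qN x : D x -> q (- x) = - q x.
  move=> Dx; have D0 : D 0 by rewrite -(scale0r x); exact: DZ.
  have := qD _ _ Dx (D_opp Dx); have := qD _ _ D0 D0.
  by rewrite subrr addr0; lra.
have qZ (c : R) x : 0 <= c -> D x -> q (c *: x) = c * q x.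
  move=> c0 Dx; apply/eqP; rewrite eq_le sq.2//=.
  have := sq.2 _ _ c0 (D_opp Dx); rewrite scalerN !qN//; last exact: DZ.
  by rewrite mulrN lerN2.
exists q; split=> // c x Dx; have [/qZ->//|c0] := leP 0 c.
by rewrite -[c]opprK scaleNr qN ?qZ ?mulNr//; [lra|exact: DZ].
Qed.

End hahn_banach.

Section positive_extension.
Context (R : realType) (T : Type).
Implicit Types (f g : T -> R^o) (G : set ((T -> R^o) * R)).

Definition norm_bounded f := exists M : R, forall x, `|f x| <= M.

Let bD f g : norm_bounded f -> norm_bounded g -> norm_bounded (f + g).
Proof.
move=> [M fM] [N gN]; exists (M + N) => x.
by rewrite (le_trans (ler_normD _ _))// lerD.
Qed.

Let bZ (c : R) f : norm_bounded f -> norm_bounded (c *: f).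
Proof.
move=> [M fM]; exists (`|c| * M) => x.
by rewrite /= normrM ler_wpM2l.
Qed.

(* [G] is the graph of a positive linear form on a subspace. *)
Lemma positive_extension G :
  (forall f a g b, G (f, a) -> G (g, b) -> G (f + g, a + b)) ->
  (forall (c : R) f a, G (f, a) -> G (c *: f, c * a)) ->
  (forall f a, G (f, a) -> (forall x, 0 <= f x) -> 0 <= a) ->
  (exists a, G (cst 1, a)) ->
  exists L : (T -> R^o) -> R,
    [/\ forall f g, norm_bounded f -> norm_bounded g -> L (f + g) = L f + L g,
        forall (c : R) f, norm_bounded f -> L (c *: f) = c * L f,
        forall f, norm_bounded f -> (forall x, 0 <= f x) -> 0 <= L f &
        forall f a, norm_bounded f -> G (f, a) -> L f = a].
Proof.
move=> GD GZ Gpos [e Ge].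
have cE (M : R) x : (M *: (cst 1 : T -> R^o)) x = M by exact: mulr1.
(* The upper envelope: [p w] is the infimum of the values of the form on the majorants of [w] in its
   domain. The constants in the domain make it finite on bounded functions. *)
pose B w := [set a | exists2 f, G (f, a) & forall x, w x <= f x].
pose p w := inf (B w).
have Gle f a g b : G (f, a) -> G (g, b) -> (forall x, f x <= g x) -> a <= b.
  move=> Gf Gg fg; rewrite -subr_ge0 addrC.
  have := GD _ _ _ _ (GZ (-1) _ _ Gf) Gg; rewrite mulN1r => /Gpos; apply => x.
  by rewrite /= scaleN1r addrC subr_ge0.
have Bne w : norm_bounded w -> B w !=set0.
  move=> [M wM]; exists (M * e), (M *: cst 1); first exact: GZ.
  by move=> x; rewrite cE (le_trans (ler_norm _)).
have Blb w : norm_bounded w -> has_lbound (B w).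
  move=> [M wM]; exists (- M * e) => a [f Gf wf].
  apply: Gle Gf _; first exact: (GZ (- M) _ _ Ge).
  move=> x; rewrite cE (le_trans _ (wf x))//.
  by rewrite lerNl (le_trans (ler_norm _))// normrN.
have pG w a f : norm_bounded w -> G (f, a) -> (forall x, w x <= f x) -> p w <= a.
  by move=> bw Gf wf; apply: ge_inf; [exact: Blb|exists f].
have [|L [LD LZ Lp]] := @hahn_banach_dominated R (T -> R^o) norm_bounded bD bZ p.
  split=> [f g bf bg|c f c0 bf].
    rewrite -lerBlDr; apply: lb_le_inf; first exact: Bne.
    move=> a [f' Gf' ff']; rewrite lerBlDr -lerBlDl.
    apply: lb_le_inf; first exact: Bne.
    move=> b [g' Gg' gg']; rewrite lerBlDl.
    by apply: (pG _ _ _ _ (GD _ _ _ _ Gf' Gg')); [exact: bD|move=> x; exact: lerD].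
  move: (c0); rewrite le_eqVlt => /predU1P[<-|c1].
    have -> : 0 * p f = 0 * e by rewrite !mul0r.
    by apply: (pG _ _ _ _ (GZ 0 _ _ Ge)); [exact: bZ|
      move=> x; rewrite /= !scale0r].
  rewrite -ler_pdivrMl//; apply: lb_le_inf; first exact: Bne.
  move=> a [f' Gf' ff']; rewrite ler_pdivrMl//.
  by apply: (pG _ _ _ _ (GZ c _ _ Gf')); [exact: bZ|move=> x; rewrite /= ler_wpM2l].
have LN f : norm_bounded f -> L (- f) = - L f.
  by move=> bf; rewrite -scaleN1r LZ// mulN1r.
have bN f : norm_bounded f -> norm_bounded (- f).
  by move=> bf; rewrite -scaleN1r; exact: bZ.
(* For [f >= 0] the function 0 is a majorant of [- f], whence [L (- f) <= 0]. On the graph, [f] and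
   [- f] are their own majorants, which gives both inequalities. *)
exists L; split=> // [f bf f0|f a bf Gf].
  rewrite -oppr_le0 -LN//; apply: le_trans (Lp _ (bN _ bf)) _.
  rewrite -(mul0r e); apply: (pG _ _ _ _ (GZ 0 _ _ Ge)); first exact: bN.
  by move=> x; rewrite /= scale0r oppr_le0.
apply/eqP; rewrite eq_le (le_trans (Lp _ bf)) ?(pG _ _ _ bf Gf)//=.
rewrite -lerN2 -LN// (le_trans (Lp _ (bN _ bf)))//.
apply: (pG _ _ (- f) (bN _ bf)) => //.
by have := GZ (-1) _ _ Gf; rewrite scaleN1r mulN1r.
Qed.

End positive_extension.

Section finite_copy.
Context d (T : measurableType d) (R : realType) (m : {measure set T -> \bar R}).
Hypothesis mT : (m [set: T] < +oo)%E.

Definition finite_copy : set T -> \bar R := m.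

HB.instance Definition _ := Measure.on finite_copy.
HB.instance Definition _ := Measure_isFinite.Build d T R finite_copy
  (lty_fin_num_fun mT).

(** The equality is one of structures and not only of values: integrals such as [simple_integral]
    take the bundled measure, and statements about them can be rewritten along it. *)
Lemma finite_measure_copy :
  exists m' : {finite_measure set T -> \bar R}, (m' : {measure set T -> \bar R}) = m.
Proof.
have eta (mm : {measure set T -> \bar R}) : Measure.Pack {|
    Measure.measure_function_isContent_mixin :=
      Measure.measure_function_isContent_mixin (Measure.class mm);
    Measure.measure_function_Content_isMeasure_mixin :=
      Measure.measure_function_Content_isMeasure_mixin (Measure.class mm) |} = mm.
  by case: mm => f [? ?].
by exists finite_copy; rewrite -[RHS]eta.
Qed.

Lemma finite_measure_of :
  exists m' : {finite_measure set T -> \bar R}, forall A, m' A = m A.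
Proof. by exists finite_copy. Qed.

End finite_copy.

(* A copy of [T] whose measurable sets are the clopen sets. *)
Definition clopen_algebra (T : Type) : Type := T.

Section clopen_algebra.
Context (T : ptopologicalType).

Let clopenC_closed : setC_closed (@clopen T).
Proof. by move=> A; exact: clopenC. Qed.

HB.instance Definition _ := Pointed.on (clopen_algebra T).
HB.instance Definition _ := isAlgebraOfSets.Build default_measure_display
  (clopen_algebra T) clopen0 clopenU clopenC_closed.

End clopen_algebra.

Section clopen_content.
Context (R : realType) (T : ptopologicalType) (c : set T -> R).
Hypotheses (cT : compact [set: T]) (c0 : forall A, clopen A -> 0 <= c A)
  (cU : forall A B, clopen A -> clopen B -> A `&` B = set0 ->
    c (A `|` B) = c A + c B).
Local Open Scope ereal_scope.

(** The value 0 off the clopen sets keeps the function nonnegative on every set. *)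
Definition clopen_content (A : set (clopen_algebra T)) : \bar R :=
  if `[< clopen (A : set T) >] then (c A)%:E else 0.

Let contentE (A : set T) : clopen A -> clopen_content A = (c A)%:E.
Proof. by move=> cA; rewrite /clopen_content; case: asboolP. Qed.

Let content_ge0 A : 0 <= clopen_content A.
Proof. by rewrite /clopen_content; case: asboolP => // cA; rewrite lee_fin c0. Qed.

Let content_semi_additive : measure_function.semi_additive clopen_content.
Proof.
apply/additive2P.
  rewrite contentE; last exact: clopen0.
  have := cU clopen0 clopen0 (set0I _).
  by rewrite setU0 => /eqP; rewrite -subr_eq0 opprD addrA subrr sub0r oppr_eq0 => /eqP ->.
move=> A B cA cB AB; rewrite !contentE//; last exact: clopenU.
by rewrite cU.
Qed.

HB.instance Definition _ :=
  isContent.Build _ _ _ clopen_content content_ge0 content_semi_additive.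

Let content_sigma_subadditive : measurable_subset_sigma_subadditive clopen_content.
Proof.
move=> A F mF mA AF.
have : cover_compact A.
  by rewrite -compact_cover; exact: subclosed_compact mA.2 cT _.
move=> /(_ nat setT F) [].
- by move=> i _; exact: (mF i).1.
- by [].
move=> D _ AD.
pose N := (\max_(i <- D) i.+1)%N.
have DN i : i \in D -> (i < N)%N.
  by move=> iD; rewrite /N (big_rem i)//= leq_maxl.
apply: (@le_trans _ _ (\sum_(k < N) clopen_content (F k))).
  apply: content_subadditive => // x /AD[i /= iD Fix].
  by rewrite -bigcup_mkord; exists i => //; exact: DN.
rewrite -(big_mkord xpredT (clopen_content \o F)).
exact: nneseries_lim_ge.
Qed.

HB.instance Definition _ := Content_SigmaSubAdditive_isMeasure.Build _ _ _
  clopen_content content_sigma_subadditive.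

Hypothesis borelE : <<s @open T >> = <<s @clopen T >>.

(* Compactness makes any content on the clopen sets sigma-additive. *)
Lemma clopen_measure_extension :
  exists M : {finite_measure set (borel T) -> \bar R},
    forall A, clopen A -> M A = (c A)%:E.
Proof.
pose M0 := measure_extension clopen_content.
have M0E A : clopen A -> M0 A = (c A)%:E.
  by move=> cA; rewrite /M0 /measure_extension measurable_mu_extE//= contentE.
have M0s : semi_sigma_additive (M0 : set (borel T) -> \bar R).
  move=> F mF tF mUF; apply: (measure_semi_sigma_additive (s := M0)) => //.
  - by move=> i; have := mF i; rewrite /measurable/= borelE.
  - by move: mUF; rewrite /measurable/= borelE.
pose H := isMeasure.Build _ (borel T) R (M0 : set (borel T) -> \bar R)
  (measure0 M0) (measure_ge0 M0) M0s.
pose M1 : {measure set (borel T) -> \bar R} :=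
  HB.pack_for {measure set (borel T) -> \bar R} (M0 : set (borel T) -> \bar R) H.
have [|M ME] := @finite_measure_of _ _ _ M1.
  by rewrite [M1 _]M0E ?ltry//; exact: clopenT.
by exists M => A cA; rewrite ME; exact: M0E.
Qed.

End clopen_content.

(** Such a space has only countably many clopen sets and they form a base, so an open set is the
    countable union of the clopen sets that it contains. *)
Lemma borel_clopenE (R : realType) (T : pseudoPMetricType R) : compact [set: T] ->
  hausdorff_space T -> zero_dimensional T -> <<s @open T >> = <<s @clopen T >>.
Proof.
move=> cT hT zT; apply/seteqP; split; last first.
  apply: smallest_sub; first exact: smallest_sigma_algebra.
  by move=> A [oA _]; exact: sub_sigma_algebra.
apply: smallest_sub; first exact: smallest_sigma_algebra.
move=> A oA.
have [f] : $|{surjfun [set: nat] >-> @clopen T}| by exact: clopen_surj.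
have -> : A = \bigcup_n (if `[< f n `<=` A >] then f n else set0).
  apply/seteqP; split=> [x Ax|x [n _]]; last by case: asboolP => // fA /fA.
  have : nbhs x A by exact: open_nbhs_nbhs.
  move=> /(zero_dimensional_cvg hT zT cT)[B [Bx cB]] BA.
  have [n _ fn] : (f @` [set: nat]) B by exact: surj.
  by exists n => //; rewrite fn; case: asboolP.
apply: sigma_algebra_bigcup => n; apply: sub_sigma_algebra.
by case: asboolP => _; [exact: funS|exact: clopen0].
Qed.


HB.instance Definition _ (R : realType) := PseudoMetric.copy cantor_space (prod_topology (fun _ : nat => (bool : pseudoMetricType R))).

Lemma cantor_borelE (R : realType) : <<s @open cantor_space >> = <<s @clopen cantor_space >>.
Proof.
exact: (@borel_clopenE R cantor_space cantor_space_compact cantor_space_hausdorff cantor_zero_dimensional).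
Qed.

Lemma lsc_borel_measurable (R : realType) (T : ptopologicalType) (f : T -> R) :
  (forall a, open [set x | a < f x]) ->
  measurable_fun [set: borel T] (f : borel T -> R).
Proof.
move=> lf; apply: (measurability _ (RGenOInfty.measurableE R)).
move=> _ [_ [a ->]] <-; rewrite setTI; apply: sub_sigma_algebra.
rewrite (_ : _ @^-1` _ = [set x | a < f x])//.
by apply/seteqP; split=> x /=; rewrite in_itv/= andbT.
Qed.

Lemma continuous_borel_measurable (R : realType) (T : ptopologicalType) (f : T -> R) :
  continuous f -> measurable_fun [set: borel T] (f : borel T -> R).
Proof.
move=> /continuousP cf; apply: lsc_borel_measurable => a.
rewrite (_ : [set x | _] = f @^-1` [set y | a < y]); last by [].
exact/cf/open_gt.
Qed.

Lemma continuous_borel_measurable2 (T U : ptopologicalType) (f : T -> U) :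
  continuous f -> measurable_fun [set: borel T] (f : borel T -> borel U).
Proof.
move=> /continuousP cf; apply: (@measurability _ _ (borel T) (borel U) setT f (@open U) erefl).
by move=> _ [A oA <-]; rewrite setTI; apply: sub_sigma_algebra; exact: cf.
Qed.

Lemma compact_norm_bounded (R : realType) (T : topologicalType) (f : T -> R^o) :
  compact [set: T] -> continuous f -> norm_bounded f.
Proof.
move=> cT cf; have : compact (f @` [set: T]).
  by apply: continuous_compact => //; exact: continuous_subspaceT.
move=> /compact_bounded[M [_ fM]]; exists (M + 1) => x.
by apply: fM; [rewrite ltrDl|exists x].
Qed.

Section bounded_integrable.
Context d (T : measurableType d) (R : realType) (m : {finite_measure set T -> \bar R}).
Implicit Types f g : T -> R.

Lemma norm_bounded_integrable f : measurable_fun setT f ->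
  norm_bounded (f : T -> R^o) -> m.-integrable setT (EFin \o f).
Proof.
move=> mf [M fM]; apply: measurable_bounded_integrable => //.
  rewrite -ge0_fin_numE//; exact: (fin_num_measure m _ measurableT).
exists M; split; first exact: num_real.
by move=> x Mx y _; apply: le_trans (ltW Mx); exact: fM.
Qed.

End bounded_integrable.

Section cantor_riesz.
Context (R : realType) (G : set ((cantor_space -> R^o) * R)).
Notation K := cantor_space.

(* [G] is the graph of a positive linear form on a space of continuous functions. *)
Lemma cantor_riesz :
  (forall f a, G (f, a) -> continuous f) ->
  (forall f a g b, G (f, a) -> G (g, b) -> G (f + g, a + b)) ->
  (forall (c : R) f a, G (f, a) -> G (c *: f, c * a)) ->
  (forall f a, G (f, a) -> (forall x, 0 <= f x) -> 0 <= a) ->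
  (exists a, G (cst 1, a)) ->
  exists M : {finite_measure set (borel K) -> \bar R},
    forall f a, G (f, a) -> \int[M]_x f x = a.
Proof.
move=> Gc GD GZ Gpos G1.
have [L [LD LZ Lpos LG]] := positive_extension GD GZ Gpos G1.
have bi (A : set K) : norm_bounded (\1_A : K -> R^o).
  by exists 1 => x; rewrite ger0_norm ?indicE ?lern1 ?ler0n ?leq_b1.
have bD (f g : K -> R^o) : norm_bounded f -> norm_bounded g -> norm_bounded (f + g).
  move=> [M fM] [N gN]; exists (M + N) => x.
  by rewrite (le_trans (ler_normD _ _))// lerD.
have bZ (c : R) (f : K -> R^o) : norm_bounded f -> norm_bounded (c *: f).
  by move=> [M fM]; exists (`|c| * M) => x; rewrite /= normrM ler_wpM2l.
have bN (f : K -> R^o) : norm_bounded f -> norm_bounded (- f).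
  by move=> bf; rewrite -scaleN1r; exact: bZ.
have LN (f : K -> R^o) : norm_bounded f -> L (- f) = - L f.
  by move=> bf; rewrite -scaleN1r LZ// mulN1r.
have L_le (f g : K -> R^o) : norm_bounded f -> norm_bounded g ->
    (forall x, f x <= g x) -> L f <= L g.
  move=> bf bg fg; rewrite -subr_ge0 -LN// -LD//; last exact: bN.
  by apply: Lpos => [|x]; [apply: bD => //; exact: bN|rewrite /= subr_ge0].
have [||M ME] := @clopen_measure_extension R K (fun A => L (\1_A)) cantor_space_compact _ _ (cantor_borelE R).
- by move=> A _; apply: Lpos => // x; rewrite indicE ler0n.
- move=> A B _ _ AB; rewrite -LD//; congr L; apply/funext => x.
  rewrite -[RHS]/(\1_A x + \1_B x : R) !indicE in_setU.
  have [xA|xA] := boolP (x \in A); have [xB|xB] := boolP (x \in B);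
    rewrite ?addr0 ?add0r//.
  have : x \in A `&` B by rewrite in_setI xA xB.
  by move=> /set_mem; rewrite AB.
exists M => f a Gf.
have cf := Gc _ _ Gf; have bf := compact_norm_bounded cantor_space_compact cf.
have mf : measurable_fun [set: borel K] (f : borel K -> R).
  exact: continuous_borel_measurable.
rewrite -(LG _ _ bf Gf).
pose I (g : K -> R) := \int[M]_x g x.
pose bm (g : K -> R^o) := norm_bounded g /\ measurable_fun [set: borel K] (g : borel K -> R).
have bmi g : bm g -> M.-integrable setT (EFin \o g).
  by move=> [bg mg]; exact: norm_bounded_integrable.
have mC A : clopen A -> measurable (A : set (borel K)).
  by move=> [oA _]; exact: sub_sigma_algebra.
have bm1 A : clopen A -> bm \1_A.
  by move=> cA; split=> //; exact: (@measurable_indic _ (borel K) R setT A (mC _ cA)).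
have I1 A : clopen A -> I \1_A = L \1_A.
  move=> cA; rewrite /I /Rintegral/= integral_indic//; last exact: mC.
  by rewrite setIT -[RHS]/(fine (L \1_A)%:E); congr fine; exact: ME.
have bmD g h : bm g -> bm h -> bm (g + h).
  by move=> [bg mg] [bh mh]; split; [exact: bD|exact: measurable_funD].
have bmZ c g : bm g -> bm (c *: g).
  by move=> [bg mg]; split; [exact: bZ|exact: measurable_funM].
have ID g h : bm g -> bm h -> I (g + h) = I g + I h.
  by move=> bg bh; rewrite -RintegralD//; exact: bmi.
have IZ c g : bm g -> I (c *: g) = c * I g.
  by move=> bg; rewrite -RintegralZl//; exact: bmi.
have I_le g h : bm g -> bm h -> (forall x, g x <= h x) -> I g <= I h.
  by move=> bg bh gh; apply: le_Rintegral => //; exact: bmi.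
(* The clause over all clopen [C] is an induction invariant: adding a new piece cuts the current
   function down to the complement of that piece. *)
pose St (g : K -> R^o) := bm g /\ forall C, clopen C ->
  bm (g * \1_C) /\ I (g * \1_C) = L (g * \1_C).
(* Finitely many clopen sets, on each of which [f] stays within [e] of a constant, cover the space.
   They need not be disjoint: each new set overwrites the current step function by its own
   constant. *)
have St_approx (e : R) : 0 < e -> exists2 g, St g & forall x, `|f x - g x| <= e.
  move=> e0.
  have U_ x : exists2 U : set K, clopen U /\ U x & forall y, U y -> `|f y - f x| <= e.
    have : nbhs x [set y | `|f y - f x| <= e].
      have /cvgrPdist_le/(_ e e0) := cf x.
      by apply: filterS => y; rewrite distrC.
    move=> /(zero_dimensional_cvg cantor_space_hausdorff cantor_zero_dimensional
      cantor_space_compact)[B [Bx cB]] BA.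
    by exists B.
  pose U x := sval (cid2 (U_ x)).
  have UE x : [/\ clopen (U x), U x x & forall y, U x y -> `|f y - f x| <= e].
    by rewrite /U; case: cid2 => /= V [? ?] ?.
  have : cover_compact [set: K] by rewrite -compact_cover; exact: cantor_space_compact.
  move=> /(_ K setT U)[x _|x _|D _ KD].
  - by have [[]] := UE x.
  - by exists x => //; have [] := UE x.
  suff [g Stg gf] : exists2 g, St g &
      forall x, (exists2 z, z \in enum_fset D & U z x) -> `|f x - g x| <= e.
    by exists g => // x; apply: gf; have [z zD Uzx] := KD x Logic.I; exists z.
  elim: (enum_fset D) => [|z s [g [bg Stg] gf]].
    (* The zero function is written as a multiple of an indicator so that the scaling rules for [I]
       and [L] settle the base case. *)
    exists (0 *: \1_set0); last by move=> x [].
    have E C : 0 *: \1_set0 * \1_C = 0 *: \1_set0 :> (K -> R^o).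
      by apply/funext => x; rewrite /= scale0r mul0r.
    have b0 := bm1 _ (@clopen0 K); have b0' := bmZ 0 _ b0.
    split=> // C cC; rewrite E; split=> //.
    by rewrite IZ// LZ ?mul0r//; exact: b0.1.
  have [cU _ Uf] := UE z.
  have E C : (g * \1_(~` U z) + f z *: \1_(U z)) * \1_C =
      g * \1_(~` U z `&` C) + f z *: \1_(U z `&` C) :> (K -> R^o).
    apply/funext => x; rewrite /= mulrDl -mulrA; congr (_ + _).
      by rewrite /= indicI.
    rewrite -[LHS]/(f z * \1_(U z) x * \1_C x) -[RHS]/(f z * \1_(U z `&` C) x).
    by rewrite indicI /= mulrA.
  have bg' C : clopen C -> bm (g * \1_C) by move=> /Stg[].
  have Cc (A : set K) : clopen A -> clopen (~` A) by exact: clopenC.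
  exists (g * \1_(~` U z) + f z *: \1_(U z)).
    split.
      by apply: bmD; [exact/bg'/Cc|exact/bmZ/bm1].
    move=> C cC; rewrite E.
    have cUC := clopenI cU cC; have cUC' := clopenI (Cc _ cU) cC.
    have [b1 S1] := Stg _ cUC'; have b2 := bm1 _ cUC; have b3 := bmZ (f z) _ b2.
    split; first exact: bmD.
    by rewrite ID// S1 IZ// I1// LD ?LZ//; [exact: b1.1|exact: b3.1].
  move=> x [y]; rewrite inE => ys Uyx /=.
  rewrite -[X in _ - X]/(g x * \1_(~` U z) x + f z * \1_(U z) x).
  have [Uzx|nUzx] := pselect (U z x).
    rewrite !indicE (mem_set Uzx) memNset/=; last by move=> /(_ Uzx).
    by rewrite mulr0 add0r mulr1; exact: Uf.
  rewrite !indicE (memNset nUzx) mem_set//= mulr1 mulr0 addr0.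
  apply: gf; exists y => //; move: ys => /predU1P[yz|//].
  by move: Uyx; rewrite yz.
have bmf : bm f by [].
have b1 : bm \1_setT by apply: bm1; exact: clopenT.
pose e1 := L \1_setT.
have e10 : 0 <= e1 by apply: Lpos => // x; rewrite indicE ler0n.
(* [f] lies between [g - e] and [g + e], so [I f] and [L f] both lie within [e1 * e] of the common
   value of [I] and [L] at [g]. *)
have close (e : R) : 0 < e -> `|I f - L f| <= 2 * e1 * e.
  move=> e0; have [g [bg Sg] fg] := St_approx _ e0.
  have [bg1] := Sg _ clopenT; rewrite (_ : g * \1_setT = g); last first.
    by apply/funext => x; rewrite /= indicT mulr1.
  move=> ILg.
  have up : forall x, f x <= (g + e *: \1_setT) x.
    move=> x; rewrite -[leRHS]/(g x + e * \1_setT x) indicT mulr1.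
    by have := fg x; rewrite ler_norml; lra.
  have lo : forall x, (g + - e *: \1_setT) x <= f x.
    move=> x; rewrite -[leLHS]/(g x + - e * \1_setT x) indicT mulr1.
    by have := fg x; rewrite ler_norml; lra.
  have be := bmZ e _ b1; have bne := bmZ (- e) _ b1.
  have := I_le _ _ bmf (bmD _ _ bg be) up; have := I_le _ _ (bmD _ _ bg bne) bmf lo.
  have := L_le _ _ bf (bD _ _ bg.1 be.1) up; have := L_le _ _ (bD _ _ bg.1 bne.1) bf lo.
  rewrite (LD _ _ bg.1 be.1) (LD _ _ bg.1 bne.1) (ID _ _ bg be) (ID _ _ bg bne).
  rewrite !(LZ _ _ b1.1) !(IZ _ _ b1) (I1 _ (@clopenT K)) ILg -/e1 ler_norml.
  by lra.
apply/eqP; rewrite -subr_eq0 -normr_eq0 eq_le normr_ge0 andbT.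
apply/ler_addgt0Pl => e e0; rewrite addr0.
(* The summand 1 covers the case [e1 = 0]. *)
have c0 : 0 < 2 * e1 + 1 by lra.
apply: le_trans (close (e / (2 * e1 + 1)) (divr_gt0 e0 c0)) _.
by rewrite mulrCA ger_pMr// ler_pdivrMr//; lra.
Qed.

End cantor_riesz.

(** * Disintegration *)

Import Radon_Nikodym_SigmaFinite.

Section slice.
Context dX dK (X : measurableType dX) (K : measurableType dK) (R : realType).
Context (m : {finite_measure set X -> \bar R}) (M : {finite_measure set K -> \bar R}).
Context (a : K -> X) (ma : measurable_fun setT a).
Hypothesis aM : forall A, measurable A -> M (a @^-1` A) = m A.
Local Open Scope ereal_scope.

Let mpre A : measurable A -> measurable (a @^-1` A).
Proof. by move=> mA; rewrite -[_ @^-1` _]setTI; exact: ma. Qed.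

Let slice (C : set K) (A : set X) : \bar R := M (a @^-1` A `&` C).

Let slice_measure C : measurable C ->
  exists nu : {finite_measure set X -> \bar R}, forall A, nu A = slice C A.
Proof.
move=> mC.
have s0 : slice C set0 = 0 by rewrite /slice preimage_set0 set0I measure0.
have sge0 A : 0 <= slice C A by exact: measure_ge0.
have sadd : semi_sigma_additive (slice C).
  move=> F mF tF _; rewrite /slice preimage_bigcup setI_bigcupl.
  apply: measure_semi_sigma_additive.
  - by move=> i; apply: measurableI => //; exact: mpre.
  - apply/trivIsetP => i j _ _ ij.
    rewrite setIACA -preimage_setI; move/trivIsetP : tF => /(_ _ _ _ _ ij) ->//.
    by rewrite preimage_set0 set0I.
  - by apply: bigcupT_measurable => i; apply: measurableI => //; exact: mpre.
pose H := isMeasure.Build _ X R (slice C) s0 sge0 sadd.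
pose nu : {measure set X -> \bar R} :=
  HB.pack_for {measure set X -> \bar R} (slice C) H.
have [|nu' nuE] := @finite_measure_of _ _ _ nu; last by exists nu'.
have h : slice C setT \is a fin_num.
  by apply: (fin_num_measure M); apply: measurableI => //; exact: mpre.
by move: h; rewrite ge0_fin_numE.
Qed.

(** A Radon-Nikodym density of the slice with respect to [m]; domination holds because the slice at
    [A] is at most the [M]-mass of the preimage of [A], which is [m A]. *)
Lemma slice_density C : measurable C ->
  exists rho : X -> R, [/\ measurable_fun setT rho, (forall x, 0 <= rho x)%R &
    forall A, measurable A -> \int[m]_(x in A) (rho x)%:E = M (a @^-1` A `&` C)].
Proof.
move=> mC.
have [nu nuE] := slice_measure mC.
have num : nu `<< m.
  apply/null_content_dominatesP => A mA mA0; rewrite nuE /slice.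
  have : M (a @^-1` A `&` C) <= m A.
    have mA' := mpre mA; rewrite -aM//.
    exact: measureIl.
  by rewrite mA0 measure_le0 => /eqP.
pose f := f nu m; exists (fine \o f); split.
- apply: (measurableT_comp (@fine_measurable R setT measurableT)) => //.
  exact: (measurable_int _ (f_integrable num)).
- by move=> x; rewrite fine_ge0//; exact: f_ge0.
- move=> A mA; rewrite -[RHS]/(slice C A) -nuE.
  rewrite (f_integral num)//; apply: eq_integral => x _.
  by rewrite /= fineK//; exact: f_fin_num.
Qed.

End slice.
(** Dynkin's lemma for the clopen sets, which are stable under intersection and generate the Borel
    sets. *)
Lemma borel_cantor_induction (R : realType) (P : set (set (borel cantor_space))) :
  (forall C, clopen (C : set cantor_space) -> P C) ->
  (forall C, measurable (C : set (borel cantor_space)) -> P C -> P (~` C)) ->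
  (forall F : (set (borel cantor_space))^nat, (forall n, measurable (F n)) ->
    trivIset setT F -> (forall n, P (F n)) -> P (\bigcup_n F n)) ->
  forall C, measurable (C : set (borel cantor_space)) -> P C.
Proof.
move=> Pc PC PU C mC.
have E : @measurable _ (borel cantor_space) = <<s @clopen cantor_space >> by exact: (cantor_borelE R).
apply: (@dynkin_induction _ (borel cantor_space) (@clopen cantor_space) P E) => //.
- exact: clopenI.
- exact/Pc/clopenT.
- by rewrite -E.
Qed.

Section prob_kernel_of.
Context d d' (X : measurableType d) (Y : measurableType d') (R : realType).
Variable k : X -> {measure set Y -> \bar R}.
Hypothesis mk : forall U, measurable U -> measurable_fun setT (k ^~ U).
Hypothesis k1 : forall x, k x setT = 1%E.

Definition kernel_copy : X -> {measure set Y -> \bar R} := k.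
HB.instance Definition _ := isKernel.Build _ _ X Y R kernel_copy mk.
HB.instance Definition _ := Kernel_isProbability.Build _ _ X Y R kernel_copy k1.

Lemma prob_kernel_of : exists P : R.-pker X ~> Y, forall x U, P x U = k x U.
Proof. by exists kernel_copy. Qed.

End prob_kernel_of.

Section kernel_extension.
Context dX (X : measurableType dX) (R : realType).
Notation K := cantor_space.
Local Open Scope ereal_scope.

(** For fixed [x] the content extends to a measure by compactness. Measurability in [x] then passes
    from clopen to Borel sets by Dynkin induction, where complements use the total mass 1. *)
Lemma clopen_kernel (c : X -> set K -> R) :
  (forall x C, clopen C -> 0 <= c x C)%R ->
  (forall x C D, clopen C -> clopen D -> C `&` D = set0 ->
    c x (C `|` D) = c x C + c x D)%R ->
  (forall x, c x setT = 1)%R ->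
  (forall C, clopen C -> measurable_fun setT (c ^~ C)) ->
  exists P : R.-pker X ~> borel K, forall x C, clopen C -> P x C = (c x C)%:E.
Proof.
move=> c0 cD c1 mc.
have H x := clopen_measure_extension (@cantor_space_compact) (c0 x) (cD x) (cantor_borelE R).
pose k x : {measure set (borel K) -> \bar R} := sval (cid (H x)).
have kE x C : clopen C -> k x C = (c x C)%:E by rewrite /k; case: cid => /= M; exact.
have k1 x : k x setT = 1 by rewrite kE ?c1//; exact: clopenT.
have mk C : measurable C -> measurable_fun setT (k ^~ C).
  move: C; apply: (borel_cantor_induction R).
  - move=> D cD'; rewrite (_ : k ^~ D = fun x => (c x D)%:E).
      exact/measurable_EFinP/mc.
    by apply/funext => x; rewrite kE.
  - move=> D mD mkD; rewrite (_ : k ^~ (~` D) = fun x => 1 - k x D).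
      by apply: emeasurable_funB.
    apply/funext => x; rewrite -setTD measureD//= ?setTI ?k1//.
    by rewrite ltry.
  - move=> F mF tF mkF; rewrite (_ : k ^~ _ = fun x => \sum_(n <oo) k x (F n)).
      by apply: ge0_emeasurable_sum.
    by apply/funext => x; rewrite measure_semi_bigcup//; exact: bigcupT_measurable.
have [P PE] := prob_kernel_of mk k1.
by exists P => x C cC; rewrite PE kE.
Qed.

End kernel_extension.

Section disintegration.
Context dX (X : measurableType dX) (R : realType).
Notation K := cantor_space.
Context (m : {finite_measure set X -> \bar R}) (M : {finite_measure set (borel K) -> \bar R}).
Context (a : borel K -> X) (ma : measurable_fun setT a).
Hypothesis aM : forall A, measurable A -> M (a @^-1` A) = m A.
Local Open Scope ereal_scope.

Let mpre A : measurable A -> measurable (a @^-1` A).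
Proof. by move=> mA; rewrite -[_ @^-1` _]setTI; exact: ma. Qed.

Let clopen_meas (C : set K) : clopen C -> measurable (C : set (borel K)).
Proof. by move=> [oC _]; exact: sub_sigma_algebra. Qed.

(** The densities [r C] are additive in [C] only almost everywhere. As there are countably many
    clopen sets, one null set [N] contains all failures, and off [N] they form a content of mass 1.
    The identity then extends from clopen to Borel [C] by Dynkin induction. *)
Theorem cantor_disintegration : exists P : R.-pker X ~> borel K,
  forall A C, measurable A -> measurable C ->
    \int[m]_(x in A) P x C = M (a @^-1` A `&` C).
Proof.
have D_ C : exists rho : X -> R, clopen C -> [/\ measurable_fun setT rho, (forall x, 0 <= rho x)%R &
    forall A, measurable A -> \int[m]_(x in A) (rho x)%:E = M (a @^-1` A `&` C)].
  have [cC|nC] := pselect (clopen C); last by exists (cst 0%R).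
  by have [rho h] := slice_density ma aM (clopen_meas cC); exists rho.
pose r C := sval (cid (D_ C)).
have mr C : clopen C -> measurable_fun setT (r C).
  by move=> cC; rewrite /r; case: cid => /= rho /(_ cC)[].
have r0 C x : clopen C -> (0 <= r C x)%R.
  by move=> cC; rewrite /r; case: cid => /= rho /(_ cC)[].
have rE C A : clopen C -> measurable A -> \int[m]_(x in A) (r C x)%:E = M (a @^-1` A `&` C).
  by move=> cC; rewrite /r; case: cid => /= rho /(_ cC)[_ _]; exact.
have ri C : clopen C -> m.-integrable setT (EFin \o r C).
  move=> cC; apply/integrableP; split; first exact/measurable_EFinP/mr.
  under eq_integral do rewrite gee0_abs ?lee_fin ?r0//.
  rewrite rE// -ge0_fin_numE//; apply: (fin_num_measure M).
  by apply: measurableI; [exact: mpre|exact: clopen_meas].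
have rD C D : clopen C -> clopen D -> C `&` D = set0 ->
    {ae m, forall x, r (C `|` D) x = r C x + r D x}%R.
  move=> cC cD CD; have cU := clopenU cC cD.
  have : ae_eq m setT (EFin \o r (C `|` D)) (EFin \o (r C \+ r D)%R).
    apply: integral_ae_eq => //; first exact: ri.
      by apply/measurable_EFinP; apply: measurable_funD; exact: mr.
    move=> E _ mE; rewrite rE// integralD_EFin//; [|exact: integrableS (ri _ _)..].
    rewrite !rE// setIUr measureU//.
    - by apply: measurableI; [exact: mpre|exact: clopen_meas].
    - by apply: measurableI; [exact: mpre|exact: clopen_meas].
    - by rewrite setIACA CD setI0.
  by apply: filterS => x /(_ Logic.I) [].
have r1 : {ae m, forall x, r setT x = 1%R}.
  have : ae_eq m setT (EFin \o r setT) (EFin \o cst 1%R).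
    apply: integral_ae_eq => //; first exact/ri/clopenT.
      exact/measurable_EFinP/measurable_cst.
    move=> E _ mE; rewrite rE//; last exact: clopenT.
    rewrite setIT aM// -[RHS]/(\int[m]_(x in E) cst 1%R%:E x).
    by rewrite integral_cst// mul1e.
  by apply: filterS => x /(_ Logic.I) [].
have [f] := @clopen_surj R K (@cantor_space_compact).
have fc n : clopen (f n) by have := @funS _ _ _ _ f n Logic.I.
have [N [mN N0 subN]] : {ae m, forall x, r setT x = 1%R /\ forall i j, f i `&` f j = set0 ->
   r (f i `|` f j) x = (r (f i) x + r (f j) x)%R}.
  apply: filterI => //; apply: ae_foralln => i; apply: ae_foralln => j.
  have [fij|nfij] := pselect (f i `&` f j = set0).
    by apply: filterS (rD _ _ (fc i) (fc j) fij) => x.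
  by apply: filterE => x.
have good x : ~ N x -> r setT x = 1%R /\ forall C D, clopen C -> clopen D ->
    C `&` D = set0 -> r (C `|` D) x = (r C x + r D x)%R.
  move=> Nx; have [rx1 rxD] : r setT x = 1%R /\ forall i j, f i `&` f j = set0 ->
      r (f i `|` f j) x = (r (f i) x + r (f j) x)%R.
    by apply: contrapT => h; apply: Nx; exact: subN.
  split=> // C D cC cD.
  have [i _ <-] : (f @` [set: nat]) C by exact: surj.
  have [j _ <-] : (f @` [set: nat]) D by exact: surj.
  exact: rxD.
(* On the exceptional null set the kernel is a Dirac mass. *)
pose c x C : R := (\1_N x * \1_C (point : K) + \1_(~` N) x * r C x)%R.
have cN x C : N x -> c x C = \1_C (point : K).
  move=> Nx; rewrite /c !indicE in_setC (mem_set Nx).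
  by rewrite mul1r mul0r addr0.
have cNc x C : ~ N x -> c x C = r C x.
  by move=> Nx; rewrite /c !indicE in_setC (memNset Nx) mul1r mul0r add0r.
have [||||P PE] := @clopen_kernel _ X R c.
- move=> x C cC; have [Nx|Nx] := pselect (N x); last by rewrite cNc// r0.
  by rewrite cN// indicE ler0n.
- move=> x C D cC cD CD; have [Nx|Nx] := pselect (N x); last first.
    by rewrite !cNc//; exact: (good x Nx).2.
  rewrite !cN// !indicE in_setU.
  have [xA|xA] := boolP (point \in C); have [xB|xB] := boolP (point \in D);
    rewrite ?addr0 ?add0r//.
  have : (point : K) \in C `&` D by rewrite in_setI xA xB.
  by move=> /set_mem; rewrite CD.
- move=> x; have [Nx|Nx] := pselect (N x); last by rewrite cNc// (good x Nx).1.
  by rewrite cN// indicT.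
- move=> C cC; apply: measurable_funD; apply: measurable_funM => //.
  + by apply: measurable_indic; exact: measurableC.
  + exact: mr.
exists P => A C mA; move: C; apply: (borel_cantor_induction R).
- move=> C cC; rewrite -rE//; apply: ge0_ae_eq_integral => //.
  + by apply: measurable_funTS; exact: measurable_kernel (clopen_meas cC).
  + by apply: measurable_funTS; apply/measurable_EFinP; exact: mr.
  + by move=> x _; rewrite lee_fin r0.
  + exists N; split=> // x /=; apply: contra_notP => Nx Ax.
    by rewrite PE// cNc.
- move=> C mC IH.
  have mCc : measurable (~` C) by exact: measurableC.
  have : \int[m]_(x in A) P x C + \int[m]_(x in A) P x (~` C) =
      M (a @^-1` A `&` C) + M (a @^-1` A `&` ~` C).
    rewrite -ge0_integralD//; last 2 first.
    + by apply: measurable_funTS; exact: measurable_kernel.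
    + by apply: measurable_funTS; exact: measurable_kernel.
    rewrite -measureU//; last 3 first.
    + by apply: measurableI => //; exact: mpre.
    + by apply: measurableI => //; exact: mpre.
    + by rewrite setIACA setICr setI0.
    transitivity (M (a @^-1` A)); last first.
      by congr (M _); rewrite -setIUr setUCr setIT.
    rewrite aM//.
    have PC x : P x C + P x (~` C) = 1.
      rewrite -measureU//; last by rewrite setICr.
      by rewrite -(@prob_kernel _ _ _ _ _ P x); congr (P x _); exact: setUCr.
    by under eq_integral => x _ do rewrite PC; rewrite integral_cst// mul1e.
  have fM : M (a @^-1` A `&` C) \is a fin_num.
    by apply: (fin_num_measure M); apply: measurableI => //; exact: mpre.
  rewrite IH => /(congr1 (fun z => z - M (a @^-1` A `&` C))).
  by rewrite ![M (_ `&` C) + _]addeC !addeK.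
- move=> F mF tF IH.
  have PU x : P x (\bigcup_n F n) = \sum_(0 <= n <oo) P x (F n).
    by rewrite measure_semi_bigcup//; exact: bigcupT_measurable.
  under eq_integral => x _ do rewrite PU.
  rewrite integral_nneseries//.
    rewrite setI_bigcupr measure_semi_bigcup//.
    + by apply: eq_eseriesr => n _; exact: IH.
    + by move=> i; apply: measurableI => //; exact: mpre.
    + exact: trivIset_setIl.
    + by apply: bigcupT_measurable => i; apply: measurableI => //; exact: mpre.
  by move=> n; apply: measurable_funTS; exact: measurable_kernel.
Qed.

End disintegration.

(** * Identification of weighted measures by continuous functions *)

Section weighted_integral.
Context dT dY (T : measurableType dT) (Y : measurableType dY) (R : realType).
Context (m : {measure set T -> \bar R}).
Context (b : T -> Y) (mb : measurable_fun setT b) (w : T -> R)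
  (iw : m.-integrable setT (EFin \o w)).

Lemma weighted_integrable (g : Y -> R) (C : R) : measurable_fun setT g ->
  (forall y, `|g y| <= C) -> m.-integrable setT (EFin \o (fun x => g (b x) * w x)).
Proof.
move=> mg gC.
have mw : measurable_fun setT w by apply/measurable_EFinP; exact: measurable_int iw.
apply: (@le_integrable _ _ _ _ _ measurableT _ (EFin \o (fun x => C * w x))).
- by apply/measurable_EFinP; apply: measurable_funM => //; exact: measurableT_comp.
- move=> x _; rewrite lee_fin !normrM ler_wpM2r//.
  by apply: le_trans (gC _) _; exact: ler_norm.
- rewrite (_ : EFin \o _ = fun x => C%:E * (EFin \o w) x)%E; first exact: integrableZl.
  by apply/funext => x; rewrite /= EFinM.
Qed.

Lemma weighted_Rintegral_cvg (g_ : nat -> Y -> R) (g : Y -> R) (C : R) :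
  (forall n, measurable_fun setT (g_ n)) -> (forall n y, `|g_ n y| <= C) ->
  (forall y, g_ ^~ y @ \oo --> g y) ->
  \int[m]_x (g_ n (b x) * w x) @[n --> \oo] --> \int[m]_x (g (b x) * w x).
Proof.
move=> mg gC gg.
have mw : measurable_fun setT w by apply/measurable_EFinP; exact: measurable_int iw.
have mgl : measurable_fun setT g.
  by apply: (measurable_fun_cvg mg) => y _; exact: gg.
have gl y : `|g y| <= C.
  have /cvg_norm gy := gg y.
  by rewrite -(cvg_lim _ gy)//; apply: limr_le; [exact: cvgP gy|exact: nearW].
have h n := @weighted_integrable _ _ (mg n) (gC n).
have hg := weighted_integrable mgl gl.
have : (\int[m]_x (g_ n (b x) * w x)%:E)%E @[n --> \oo] --> (\int[m]_x (g (b x) * w x)%:E)%E.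
  apply: (@dominated_cvg _ _ _ m setT measurableT
      (fun n x => (g_ n (b x) * w x)%:E) (fun x => (g (b x) * w x)%:E)
      (fun x => (`|C * w x|)%:E)) => //.
  - by move=> n; exact: (measurable_int _ (h n)).
  - move=> x _; apply/cvg_EFin; first exact: nearW.
    by apply: cvgMl; exact: gg.
  - apply: integrable_norm.
    rewrite (_ : EFin \o _ = fun x => C%:E * (EFin \o w) x)%E; first exact: integrableZl.
    by apply/funext => x; rewrite /= EFinM.
  - move=> n x _; rewrite lee_fin !normrM ler_wpM2r//.
    by apply: le_trans (gC _ _) _; exact: ler_norm.
have fg : (\int[m]_x (g (b x) * w x)%:E)%E \is a fin_num by exact: integrable_fin_num hg.
by rewrite -(fineK fg) => /fine_cvg.
Qed.

End weighted_integral.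

Section metric_open.
Context (R : realType) (Y : metricType R).

(** The distance to the complement of [U]. The case of an empty complement is separate, since the
    infimum would then run over the empty set. *)
Lemma open_separating_function (U : set Y) : open U ->
  exists f : Y -> R, [/\ continuous f, forall y, 0 <= f y & forall y, U y <-> 0 < f y].
Proof.
move=> oU; have [UT|/set0P[z0 Uz0]] := eqVneq (~` U) set0.
  exists (cst 1); split=> // [|y]; first exact: cst_continuous.
  by split=> // _; apply: contrapT => Uy; have : (~` U) y by []; rewrite UT.
pose D y := [set mdist y z | z in ~` U].
pose f y : R := inf (D y).
have Dlb y : has_lbound (D y) by exists 0 => _ [z _ <-]; exact: mdist_ge0.
have Dne y : D y !=set0 by exists (mdist y z0), z0.
have f0 y : 0 <= f y by apply: lb_le_inf => // _ [z _ <-]; exact: mdist_ge0.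
have flip x y : f x <= mdist x y + f y.
  rewrite -lerBlDl; apply: lb_le_inf => // _ [z Uz <-]; rewrite lerBlDl.
  by apply: (le_trans (ge_inf (Dlb x) _)); [by exists z|exact: metric_triangle].
exists f; split=> // [y|y].
- apply/cvgrPdist_lt => e e0; apply: filterS (nbhsx_ballx y e e0) => x.
  rewrite ballEmdist/= => yx; apply: le_lt_trans yx.
  have := flip x y; have := flip y x; rewrite [mdist x y]metric_sym.
  by rewrite ler_norml; lra.
- split=> [Uy|fy]; last first.
    apply: contrapT => nUy; move: fy; apply/negP; rewrite -leNgt.
    by rewrite -(mdistxx y); apply: ge_inf => //; exists y.
  have /nbhs_ballP[e /= e0 yeU] : nbhs y U by exact: open_nbhs_nbhs.
  apply: (lt_le_trans e0); apply: lb_le_inf => // _ [z nUz <-].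
  rewrite leNgt; apply/negP => yz; apply: nUz; apply: yeU.
  by rewrite ballEmdist.
Qed.

End metric_open.

Section borel_unique.
Context d1 d2 (T1 : measurableType d1) (T2 : measurableType d2) (R : realType)
  (Y : pmetricType R).
Context (m1 : {measure set T1 -> \bar R}) (m2 : {measure set T2 -> \bar R}).
Context (b1 : T1 -> borel Y) (b2 : T2 -> borel Y) (w1 : T1 -> R) (w2 : T2 -> R).
Hypotheses (mb1 : measurable_fun setT b1) (mb2 : measurable_fun setT b2).
Hypotheses (iw1 : m1.-integrable setT (EFin \o w1))
  (iw2 : m2.-integrable setT (EFin \o w2)).

Let agree (g : Y -> R) :=
  \int[m1]_x (g (b1 x) * w1 x) = \int[m2]_x (g (b2 x) * w2 x).

Let agree_cvg (g_ : nat -> Y -> R) (g : Y -> R) :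
  (forall n, measurable_fun setT (g_ n : borel Y -> R)) -> (forall n y, `|g_ n y| <= 1) ->
  (forall y, g_ ^~ y @ \oo --> g y) -> (forall n, agree (g_ n)) -> agree g.
Proof.
move=> mg gC gg ag.
have h1 := weighted_Rintegral_cvg mb1 iw1 mg gC gg.
have h2 := weighted_Rintegral_cvg mb2 iw2 mg gC gg.
have E : (fun n => \int[m1]_x (g_ n (b1 x) * w1 x)) = (fun n => \int[m2]_x (g_ n (b2 x) * w2 x)).
  by apply/funext => n; exact: ag.
by rewrite E in h1; exact: cvg_unique h1 h2.
Qed.

Let indic_norm (A : set Y) y : `|\1_A y : R| <= 1.
Proof. by rewrite ger0_norm ?indicE ?lern1 ?ler0n ?leq_b1. Qed.

Let indic_meas (A : set (borel Y)) : measurable A -> measurable_fun setT (\1_A : borel Y -> R).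
Proof. by move=> mA; exact: measurable_indic. Qed.

(** Dynkin induction from the open sets, whose indicators are limits of the continuous functions
    [min 1 (n * f)]. The weights may change sign, so the two sides are not measures and countable
    unions are handled by dominated convergence. The weight 1 will give the first marginal of the
    coupling, the weight [l (h x)] the second one tested against [l]. *)
Lemma borel_Rintegral_unique :
  (forall c : Y -> R, continuous c -> (forall y, 0 <= c y <= 1) ->
    \int[m1]_x (c (b1 x) * w1 x) = \int[m2]_x (c (b2 x) * w2 x)) ->
  forall B : set (borel Y), measurable B ->
    \int[m1]_x (\1_B (b1 x) * w1 x) = \int[m2]_x (\1_B (b2 x) * w2 x).
Proof.
move=> hc.
have agreeT : agree (cst 1).
  by apply: hc => [|y]; [exact: cst_continuous|rewrite ler01 lexx].
have agreeO U : open U -> agree \1_U.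
  move=> oU; have [f [cf f0 fU]] := open_separating_function oU.
  pose g_ n y : R := Num.min 1 (n%:R * f y).
  have g01 n y : 0 <= g_ n y <= 1.
    by rewrite /g_ le_min ler01 mulr_ge0 ?f0//= ge_min lexx.
  have cg n : continuous (g_ n).
    move=> y; apply: (@continuous_min _ _ (cst 1) (fun y => n%:R * f y)).
      exact: cst_continuous.
    by apply: cvgMr; exact: cf.
  apply: (agree_cvg (g_ := g_)).
  - by move=> n; exact: continuous_borel_measurable.
  - by move=> n y; have /andP[g0 g1] := g01 n y; rewrite ger0_norm.
  - move=> y; have [Uy|nUy] := pselect (U y).
      rewrite indicE mem_set//; apply: cvg_near_cst.
      have fy : 0 < f y by exact/fU.
      near=> n; apply/min_idPl; rewrite -ler_pdivrMr// mul1r.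
      by near: n; exact: nbhs_infty_ger.
    rewrite indicE memNset//; apply: cvg_near_cst; apply: nearW => n.
    have -> : g_ n y = Num.min 1 (n%:R * 0).
      congr (Num.min 1 (_ * _)); apply/eqP; rewrite eq_le f0 andbT leNgt.
      by apply/negP => /fU.
    by rewrite mulr0; apply/min_idPr.
  - by move=> n; exact: hc.
have int1 (g : Y -> R) := @weighted_integrable _ _ _ _ R m1 b1 mb1 w1 iw1 g 1.
have int2 (g : Y -> R) := @weighted_integrable _ _ _ _ R m2 b2 mb2 w2 iw2 g 1.
have agreeC A : measurable (A : set (borel Y)) -> agree \1_A -> agree \1_(~` A).
  move=> mA aA; have EA y : \1_(~` A) y = 1 - \1_A y :> R.
    by rewrite !indicE in_setC; case: (y \in A); rewrite ?subrr ?subr0.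
  have mT : measurable_fun setT (cst 1 : borel Y -> R) by [].
  have nT (y : Y) : `|cst 1 y : R| <= 1 by rewrite normr1.
  rewrite /agree; under eq_Rintegral do rewrite EA mulrBl.
  under [RHS]eq_Rintegral do rewrite EA mulrBl.
  rewrite !RintegralB//; [|exact: (int2 _ mT nT)|exact: int2 (indic_meas mA) (indic_norm A)
   |exact: (int1 _ mT nT)|exact: int1 (indic_meas mA) (indic_norm A)].
  by congr (_ - _).
have EU y (A B : set Y) : A `&` B = set0 -> \1_(A `|` B) y = \1_A y + \1_B y :> R.
  move=> AB; rewrite !indicE in_setU.
  have [yA|yA] := boolP (y \in A); have [yB|yB] := boolP (y \in B);
    rewrite ?addr0 ?add0r//.
  have : y \in A `&` B by rewrite in_setI yA yB.
  by move=> /set_mem; rewrite AB.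
have agreeU A B : measurable (A : set (borel Y)) -> measurable (B : set (borel Y)) ->
    A `&` B = set0 -> agree \1_A -> agree \1_B -> agree \1_(A `|` B).
  move=> mA mB AB aA aB.
  rewrite /agree; under eq_Rintegral do rewrite EU// mulrDl.
  under [RHS]eq_Rintegral do rewrite EU// mulrDl.
  rewrite !RintegralD//; [|exact: int2 (indic_meas mA) (indic_norm A)
   |exact: int2 (indic_meas mB) (indic_norm B)
   |exact: int1 (indic_meas mA) (indic_norm A)|exact: int1 (indic_meas mB) (indic_norm B)].
  by congr (_ + _).
move=> B mB; apply: (@dynkin_induction _ (borel Y) (@open Y) (fun B => agree \1_B) erefl) => //.
- by move=> A1 A2; exact: openI.
- by apply: agreeO; exact: openT.
- move=> F mF tF aF.
  pose G n := \big[setU/set0]_(i < n) F i.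
  have mG n : measurable (G n : set (borel Y)) by exact: bigsetU_measurable.
  have aG n : agree \1_(G n).
    elim: n => [|n IH]; first by rewrite /G big_ord0; apply: agreeO; exact: open0.
    rewrite /G big_ord_recr/=; apply: agreeU => //; first exact: mG.
    rewrite -bigcup_mkord -subset0 => y [[i /= iN Fi] Fn].
    by move: (iN); rewrite (tF i n Logic.I Logic.I) ?ltnn//; exists y.
  apply: (agree_cvg (g_ := fun n => \1_(G n))) => //.
  - move=> y; apply: cvg_near_cst; have [[i _ Fi]|nF] := pselect ((\bigcup_k F k) y).
      exists i.+1 => // n /= iN; rewrite !indicE !mem_set//; first by exists i.
      by rewrite /G -bigcup_mkord; exists i.
    apply: nearW => n; rewrite !indicE !memNset// /G -bigcup_mkord => -[i _ Fi].
    by apply: nF; exists i.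
Unshelve. all: by end_near. Qed.

End borel_unique.

(** * Bochner integrals *)

Section arbitrary_integral.
Context d (T : measurableType d) (R : realType) (m : {measure set T -> \bar R}).
Implicit Types f g : T -> \bar R.
Local Open Scope ereal_scope.
Import HBNNSimple.

(** A simple function below [f], set to 0 on the null set, lies below [g] everywhere and keeps its
    integral. *)
Let ge0_le f g : (forall x, 0 <= f x) -> (forall x, 0 <= g x) ->
  {ae m, forall x, f x <= g x} -> \int[m]_x f x <= \int[m]_x g x.
Proof.
move=> f0 g0 [N [mN N0 subN]]; rewrite !ge0_integralTE//.
apply: ge_ereal_sup => _ [h /= hf <-].
have mNc : measurable (~` N) by exact: measurableC.
apply: (@le_trans _ _ (sintegral m (proj_nnsfun h mNc))); last first.
  apply: ereal_sup_ubound; exists (proj_nnsfun h mNc) => // x /=.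
  rewrite mindicE; have [xN|xN] := boolP (x \in ~` N); last by rewrite mulr0.
  rewrite mulr1; apply: le_trans (hf x) _; apply: contrapT => fg.
  by move/set_mem : xN; apply; exact: subN.
rewrite -!integralT_nnsfun; apply: ae_ge0_le_integral => //.
- by move=> x _; rewrite lee_fin.
- exact/measurable_EFinP.
- by move=> x _; rewrite lee_fin.
- exact/measurable_EFinP.
- exists N; split=> // x /=; apply: contra_notP => xN _.
  by rewrite mindicE mem_set// mulr1.
Qed.

(* The library's integral is a lower integral, so no measurability is needed. *)
Lemma ae_le_lower_integral f g : {ae m, forall x, f x <= g x} ->
  \int[m]_x f x <= \int[m]_x g x.
Proof.
move=> fg; rewrite integralE [leRHS]integralE; apply: leeB; apply: ge0_le => //.
- by apply: filterS fg => x fgx; rewrite !funeposE ge_max !le_max lexx orbT fgx.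
- by apply: filterS fg => x fgx; rewrite !funenegE ge_max !le_max lexx orbT leeN2 fgx.
Qed.

Lemma ae_eq_lower_integral f g : {ae m, forall x, f x = g x} ->
  \int[m]_x f x = \int[m]_x g x.
Proof.
move=> fg; apply/eqP; rewrite eq_le; apply/andP; split;
  by apply: ae_le_lower_integral; apply: filterS fg => x ->.
Qed.

End arbitrary_integral.

Section finite_range.
Context d (T : measurableType d).
Implicit Types (W V : choiceType).

(** For values in a normed space this is [simple_fun]. Allowing any choice type lets pairs of simple
    functions and boolean tests be treated as single functions, so that common refinements come for
    free. *)
Definition fin_meas W (u : T -> W) :=
  finite_set (range u) /\ forall v, measurable (u @^-1` [set v]).

Lemma fin_meas_preimage W (u : T -> W) A : fin_meas u -> measurable (u @^-1` A).
Proof.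
move=> [fu mu].
have -> : u @^-1` A = \bigcup_(w in range u `&` A) u @^-1` [set w].
  by apply/seteqP; split=> [x Aux|x [w [_ Aw] /= ->]//]; exists (u x).
by apply: fin_bigcup_measurable => //; exact: finite_setIl.
Qed.

Lemma fin_meas_comp W V (phi : W -> V) (u : T -> W) : fin_meas u -> fin_meas (phi \o u).
Proof.
move=> fu; split; last by move=> v; exact: (fin_meas_preimage (phi @^-1` [set v]) fu).
have -> : range (phi \o u) = phi @` range u by rewrite image_comp.
by apply: finite_image; have [] := fu.
Qed.

Lemma fin_meas_pair W V (u : T -> W) (v : T -> V) : fin_meas u -> fin_meas v ->
  fin_meas (fun x => (u x, v x)).
Proof.
move=> [fu mu] [fv mv]; split.
  apply: (@sub_finite_set _ _ (range u `*` range v)); last exact: finite_setX.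
  by move=> _ [x _ <-]; split; exists x.
move=> [a b].
rewrite (_ : _ @^-1` _ = u @^-1` [set a] `&` v @^-1` [set b]); first exact: measurableI.
by apply/seteqP; split=> x /=; [case|move=> [-> ->]].
Qed.

Lemma fin_meas_cst W (w : W) : fin_meas (cst w : T -> W).
Proof.
split; first by apply: (sub_finite_set _ (finite_set1 w)) => _ [x _ <-].
by move=> v; have [->|vw] := eqVneq v w; [rewrite preimage_cst mem_set|
  rewrite preimage_cst memNset//= => wv; move: vw; rewrite wv eqxx].
Qed.

End finite_range.

Section simple_integral_theory.
Context d (T : measurableType d) (R : realType) (m : {finite_measure set T -> \bar R}).

Let fm A : measurable A -> (m A = (fine (m A))%:E)%E.
Proof. by move=> mA; rewrite fineK//; exact: (fin_num_measure m). Qed.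

(** The fibres of [phi \o u] are finite unions of fibres of [u], so the sum may be taken over the
    finer partition. With [u] a pair of simple functions, all integrals involved become sums over
    the same index set. *)
Lemma simple_integral_comp (W : choiceType) (S : normedModType R) (phi : W -> S) (u : T -> W) :
  fin_meas u -> simple_integral m (phi \o u) =
    \sum_(w <- fset_set (range u)) fine (m (u @^-1` [set w])) *: phi w.
Proof.
move=> fu; pose r := fset_set (range u); have [fu1 fu2] := fu.
pose r' := [fset phi w | w in r]%fset.
have rP x : u x \in r by rewrite in_fset_set//; apply: mem_set; exists x.
rewrite /simple_integral (@fsbigE _ _ _ _ _ r'); last 3 first.
- exact: fset_uniq.
- by [].
- move=> v _ vr'; rewrite (_ : _ @^-1` _ = set0) ?measure0 ?scale0r//.
  apply/seteqP; split=> // x /= uxv; move: vr' => /negP; apply.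
  by apply/imfsetP; exists (u x).
have mv v : fine (m ((phi \o u) @^-1` [set v])) =
    \sum_(w <- r | phi w == v) fine (m (u @^-1` [set w])).
  have -> : (phi \o u) @^-1` [set v] =
      \big[setU/set0]_(w <- r | phi w == v) u @^-1` [set w].
    apply/seteqP; split=> x; rewrite -bigcup_seq_cond /=.
      by move=> uxv; exists (u x) => //=; rewrite rP uxv eqxx.
    by move=> [w /= /andP[_ /eqP <-] ->].
  apply: EFin_inj; rewrite -fm; last first.
    by apply: bigsetU_measurable => w _; exact: fu.2.
  rewrite -sumEFin big_mkcond/= [RHS]big_mkcond/=.
  rewrite (@measure_fbigsetU _ _ _ m _ r (fun w => if phi w == v then u @^-1` [set w] else set0)).
  - by apply: eq_bigr => w _; case: ifPn => // _; rewrite -fm//; exact: fu.2.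
  - by move=> w _; case: ifPn => // _; exact: fu.2.
  - by apply/trivIsetP => w1 w2 _ _ w12; do 2 case: ifPn => _; rewrite ?setI0 ?set0I//;
      apply/seteqP; split=> // x /= [uw1 uw2]; move: w12; rewrite -uw1 -uw2 eqxx.
rewrite [RHS](partition_big_imfset _ phi) /=.
rewrite (eq_bigl xpredT); last by move=> v; apply: mem_set.
apply: eq_bigr => v _; rewrite mv scaler_suml.
by apply: eq_bigr => w /eqP ->.
Qed.

Lemma Rintegral_fin_meas (W : choiceType) (phi : W -> R) (u : T -> W) :
  fin_meas u -> \int[m]_x phi (u x) =
    \sum_(w <- fset_set (range u)) fine (m (u @^-1` [set w])) * phi w.
Proof.
move=> fu; have [fu1 fu2] := fu; pose r := fset_set (range u).
have rP x : u x \in r by rewrite in_fset_set//; apply: mem_set; exists x.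
have E x : phi (u x) = \sum_(w <- r) phi w * \1_(u @^-1` [set w]) x.
  rewrite (big_fsetD1 (u x))//= indicE mem_set// mulr1 big_seq big1 ?addr0// => w.
  rewrite !inE => /andP[wu _]; rewrite indicE memNset ?mulr0//= => uxw.
  by move: wu; rewrite uxw eqxx.
under eq_Rintegral do rewrite E.
rewrite /Rintegral.
under eq_integral do rewrite -sumEFin.
rewrite integral_sum//; last first.
  move=> w; apply: norm_bounded_integrable.
    by apply: measurable_funM => //; exact: measurable_indic.
  exists `|phi w| => x; rewrite normrM ler_piMr// ger0_norm ?indicE ?lern1 ?ler0n//.
  exact: leq_b1.
rewrite -sum_fine; last first.
  move=> w _; apply: integrable_fin_num => //; apply: norm_bounded_integrable.
    by apply: measurable_funM => //; exact: measurable_indic.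
  exists `|phi w| => x; rewrite normrM ler_piMr// ger0_norm ?indicE ?lern1 ?ler0n//.
  exact: leq_b1.
apply: eq_bigr => w _; rewrite -[LHS]/(\int[m]_x (phi w * \1_(u @^-1` [set w]) x)).
rewrite RintegralZl//; last first.
  apply: norm_bounded_integrable; first exact: measurable_indic.
  by exists 1 => x; rewrite ger0_norm ?indicE ?lern1 ?ler0n ?leq_b1.
by rewrite mulrC /Rintegral integral_indic// setIT.
Qed.

End simple_integral_theory.

Section simple_integral_linear.
Context d (T : measurableType d) (R : realType) (m : {finite_measure set T -> \bar R})
  (S : normedModType R).
Implicit Types s t : T -> S.

Lemma simple_integral_linear (l : S -> R^o) s : linear l -> simple_fun s ->
  l (simple_integral m s) = \int[m]_x l (s x).
Proof.
move=> ll fs; pose L : {linear S -> R^o} := HB.pack l (GRing.isLinear.Build _ _ _ _ l ll).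
rewrite (Rintegral_fin_meas _ l fs) -[s in LHS]/(idfun \o s) (simple_integral_comp _ _ fs).
rewrite -[LHS]/(L _) linear_sum; apply: eq_bigr => w _.
by rewrite linearZ.
Qed.

Lemma simple_integralB s t : simple_fun s -> simple_fun t ->
  simple_integral m (fun x => s x - t x) = simple_integral m s - simple_integral m t.
Proof.
move=> fs ft; have fp := fin_meas_pair fs ft.
rewrite (simple_integral_comp m (fun p : S * S => p.1 - p.2) fp).
rewrite (simple_integral_comp m (fst : S * S -> S) fp) (simple_integral_comp m (snd : S * S -> S) fp).
by rewrite -sumrB; apply: eq_bigr => w _; rewrite scalerBr.
Qed.

Lemma ler_norm_simple_integral s : simple_fun s ->
  `|simple_integral m s| <= \int[m]_x `|s x|.
Proof.
move=> fs; rewrite (Rintegral_fin_meas m (fun v : S => `|v|) fs).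
rewrite -[s in leLHS]/(idfun \o s) (simple_integral_comp _ _ fs).
apply: le_trans (ler_norm_sum _ _ _) _; apply: ler_sum => w _.
by rewrite normrZ ger0_norm// fine_ge0.
Qed.

End simple_integral_linear.

Section simple_limit.
Context d (T : measurableType d) (R : realType).

(** The version of [strongly_measurable] without exceptional set: composing such a function with a
    continuous map gives a measurable function even when the measure is not complete. *)
Definition simple_limit (S : normedModType R) (f : T -> S) :=
  exists2 s : nat -> T -> S, (forall n, simple_fun (s n)) &
    forall x, s ^~ x @ \oo --> f x.

Lemma fin_meas_bool (b : T -> bool) : measurable_fun setT b -> fin_meas b.
Proof.
move=> mb; split; first exact: finite_finset.
by move=> v; rewrite -[_ @^-1` _]setTI; exact: mb.
Qed.

Lemma fin_meas_if (W : choiceType) (b : T -> bool) (u v : T -> W) :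
  measurable_fun setT b -> fin_meas u -> fin_meas v ->
  fin_meas (fun x => if b x then u x else v x).
Proof.
move=> /fin_meas_bool mb fu fv.
exact: (fin_meas_comp (fun p : bool * (W * W) => if p.1 then p.2.1 else p.2.2)
  (fin_meas_pair mb (fin_meas_pair fu fv))).
Qed.

Lemma simple_fun_measurable (S : normedModType R) (phi : S -> R) (s : T -> S) :
  simple_fun s -> measurable_fun setT (phi \o s).
Proof. by move=> fs _ B mB; rewrite setTI; exact: (fin_meas_preimage (phi @^-1` B) fs). Qed.

Lemma simple_limit_measurable (S : normedModType R) (phi : S -> R) (f : T -> S) :
  continuous (phi : S -> R^o) -> simple_limit f -> measurable_fun setT (phi \o f).
Proof.
move=> cphi [s fs sf].
apply: (measurable_fun_cvg (h := fun n => phi \o s n)) => [n|x _].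
  exact: simple_fun_measurable.
apply: (@cvg_comp _ _ _ (s ^~ x) (phi : S -> R^o)); [exact: sf|exact: cphi].
Qed.

Lemma simple_limit_norm (S : normedModType R) (f : T -> S) :
  simple_limit f -> measurable_fun setT (fun x => `|f x|).
Proof. exact: (simple_limit_measurable (@norm_continuous _ S)). Qed.

Lemma simple_limit_comp2 (S1 S2 S3 : normedModType R) (op : S1 -> S2 -> S3)
    (f : T -> S1) (g : T -> S2) :
  (forall (u : nat -> S1) (v : nat -> S2) a b, u @ \oo --> a -> v @ \oo --> b ->
    (fun n => op (u n) (v n)) @ \oo --> op a b) ->
  simple_limit f -> simple_limit g -> simple_limit (fun x => op (f x) (g x)).
Proof.
move=> cop [s fs sf] [t ft tg]; exists (fun n x => op (s n x) (t n x)).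
  by move=> n; exact: (fin_meas_comp (fun p : S1 * S2 => op p.1 p.2) (fin_meas_pair (fs n) (ft n))).
by move=> x; exact: (cop (s ^~ x) (t ^~ x)).
Qed.

Lemma simple_limitD (S : normedModType R) (f g : T -> S) :
  simple_limit f -> simple_limit g -> simple_limit (fun x => f x + g x).
Proof. by apply: simple_limit_comp2 => u v a b; exact: cvgD. Qed.

Lemma simple_limitB (S : normedModType R) (f g : T -> S) :
  simple_limit f -> simple_limit g -> simple_limit (fun x => f x - g x).
Proof. by apply: (simple_limit_comp2 (op := fun a b : S => a - b)) => u v a b; exact: cvgB. Qed.

Lemma simple_limitZ (S : normedModType R) (f : T -> R^o) (g : T -> S) :
  simple_limit f -> simple_limit g -> simple_limit (fun x => f x *: g x).
Proof. by apply: simple_limit_comp2 => u v a b; exact: cvgZ. Qed.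

Lemma simple_fun_limit (S : normedModType R) (s : T -> S) : simple_fun s -> simple_limit s.
Proof. by move=> fs; exists (fun=> s) => // x; exact: cvg_cst. Qed.

Import HBSimple.

Lemma measurable_simple_limit (f : T -> R) :
  measurable_fun setT f -> simple_limit (f : T -> R^o).
Proof.
move=> mf; have mf' : measurable_fun setT (EFin \o f) by exact/measurable_EFinP.
have [g gf] := approximation_sfun measurableT mf'.
exists (fun n x => HBSimple.SimpleFun.sort (g n) x : R^o).
  move=> n; split; first exact: (@fimfunP _ _ (g n)).
  by move=> v; exact: measurable_sfunP.
move=> x; have := gf x Logic.I; rewrite -[(EFin \o f) x]/(f x)%:E => /fine_cvg.
exact.
Qed.

(** On a measurable null set containing the points of divergence, the function and its
    approximations are replaced by 0. *)
Lemma strongly_measurableP (S : normedModType R) (m : {measure set T -> \bar R}) (f : T -> S) :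
  strongly_measurable m f <-> exists2 g, simple_limit g & {ae m, forall x, f x = g x}.
Proof.
split=> [[s fs [N [mN N0 subN]]]|[g [s fs sg] fg]]; last first.
  by exists s => //; apply: filterS fg => x ->.
exists (fun x => if x \in N then 0 else f x); last first.
  exists N; split=> // x /=; apply: contra_notP => nNx.
  by rewrite memNset.
have mbN : measurable_fun setT (fun x => x \in N).
  apply: (measurable_fun_bool true).
  rewrite setTI (_ : _ @^-1` _ = N)//.
  by apply/seteqP; split=> x /=; [exact: set_mem|exact: mem_set].
exists (fun n x => if x \in N then 0 else s n x).
  by move=> n; apply: fin_meas_if => //; [exact: fin_meas_cst|exact: fs].
move=> x; case: ifPn => xN; first exact: cvg_cst.
apply: contrapT => h; move: xN => /negP; apply; apply: mem_set.
exact: subN.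
Qed.

End simple_limit.

Lemma topological_dual_bound (R : realType) (S : normedModType R) (l : S -> R^o) : topological_dual l ->
  exists2 C, 0 < C & forall s, `|l s| <= C * `|s|.
Proof.
move=> [ll cl].
pose L : {linear S -> R^o} := HB.pack l (GRing.isLinear.Build _ _ _ _ l ll).
have /linear_boundedP : bounded_near L (nbhs (0 : S)) by exact/linear_bounded_continuous.
by move=> /pinfty_ex_gt0[C C0 h]; exists C.
Qed.

Section bochner_theory.
Context d (T : measurableType d) (R : realType) (m : {finite_measure set T -> \bar R})
  (S : normedModType R).
Implicit Types f g : T -> S.
Local Open Scope ereal_scope.

(** The L1 norm. It is a lower integral when the norm of [f] is not measurable, which is why
    subadditivity below is stated for [simple_limit] functions. *)
Definition norm_int f : \bar R := \int[m]_x (`|f x|)%:E.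

Lemma norm_int_ge0 f : 0 <= norm_int f.
Proof. by apply: integral_ge0 => x _; rewrite lee_fin. Qed.

Lemma eq_norm_int f g : {ae m, forall x, f x = g x} -> norm_int f = norm_int g.
Proof. by move=> fg; apply: ae_eq_lower_integral; apply: filterS fg => x ->. Qed.

Let norm_meas f : simple_limit f -> measurable_fun setT (fun x => (`|f x|)%:E).
Proof. by move=> sf; apply/measurable_EFinP; exact: simple_limit_norm. Qed.

Lemma norm_intD f g : simple_limit f -> simple_limit g ->
  norm_int (fun x => f x + g x)%R <= norm_int f + norm_int g.
Proof.
move=> sf sg; rewrite /norm_int -ge0_integralD//; last 2 first.
- exact: norm_meas.
- exact: norm_meas.
apply: ge0_le_integral => //.
- exact/norm_meas/simple_limitD.
- by apply: emeasurable_funD; exact: norm_meas.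
- by move=> x _; rewrite -EFinD lee_fin ler_normD.
Qed.

Lemma norm_int_sub f g h : simple_limit f -> simple_limit g -> simple_limit h ->
  norm_int (fun x => f x - h x)%R <=
    norm_int (fun x => f x - g x)%R + norm_int (fun x => g x - h x)%R.
Proof.
move=> sf sg sh; apply: le_trans (norm_intD _ _); [|exact: simple_limitB..].
rewrite le_eqVlt; apply/orP; left; apply/eqP; apply: eq_integral => x _.
by congr (`|_|%:E)%R; rewrite addrA subrK.
Qed.

Lemma norm_int_subC f g :
  norm_int (fun x => f x - g x)%R = norm_int (fun x => g x - f x)%R.
Proof. by apply: eq_integral => x _; rewrite distrC. Qed.

Lemma simple_fun_norm_integrable (s : T -> S) : simple_fun s ->
  m.-integrable setT (EFin \o (fun x => `|s x|%R)).
Proof.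
move=> fs; have ms := simple_fun_measurable (fun v : S => `|v|%R) fs.
apply: norm_bounded_integrable => //.
pose r := fset_set (range s); exists (\sum_(w <- r) `|w|)%R => x.
rewrite normr_id (big_fsetD1 (s x))/=; first by rewrite lerDl sumr_ge0.
by rewrite in_fset_set//; [apply: mem_set; exists x|exact: fs.1].
Qed.

Lemma norm_int_simple (s : T -> S) : simple_fun s ->
  norm_int s = (\int[m]_x `|s x|)%R%:E.
Proof.
move=> fs; rewrite /norm_int /Rintegral fineK//.
by apply: integrable_fin_num => //; exact: simple_fun_norm_integrable.
Qed.

Lemma simple_integral_norm_int (s : T -> S) : simple_fun s ->
  (`|simple_integral m s|)%:E <= norm_int s.
Proof.
by move=> fs; rewrite norm_int_simple// lee_fin; exact: ler_norm_simple_integral.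
Qed.

Lemma simple_integral_dist f (s t : T -> S) : simple_limit f -> simple_fun s -> simple_fun t ->
  (`|simple_integral m s - simple_integral m t|)%:E <=
    norm_int (fun x => f x - s x)%R + norm_int (fun x => f x - t x)%R.
Proof.
move=> sf fs ft; rewrite -simple_integralB//.
apply: (le_trans (simple_integral_norm_int _)).
  exact: (fin_meas_comp (fun p : S * S => p.1 - p.2)%R (fin_meas_pair fs ft)).
rewrite [X in _ <= X + _]norm_int_subC.
by apply: norm_int_sub => //; exact: simple_fun_limit.
Qed.

Lemma bochner_approx_ae f g s : {ae m, forall x, f x = g x} ->
  bochner_approx m f s -> bochner_approx m g s.
Proof.
move=> fg [fs fs0]; split=> //; apply: cvg_trans fs0; apply: near_eq_cvg.
by apply: nearW => n; apply: ae_eq_lower_integral; apply: filterS fg => x ->.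
Qed.

Lemma strongly_measurable_ae f g : {ae m, forall x, f x = g x} ->
  strongly_measurable m f -> strongly_measurable m g.
Proof.
move=> fg /strongly_measurableP[h sh fh]; apply/strongly_measurableP; exists h => //.
by apply: filterS2 fg fh => x <-.
Qed.

Lemma simple_limit_strongly_measurable f : simple_limit f -> strongly_measurable m f.
Proof.
by move=> sf; apply/strongly_measurableP; exists f => //; exact: filterE.
Qed.

(** The approximation [s n] is replaced by 0 where its norm exceeds [1 + |f|]. Pointwise convergence
    survives, since eventually [s n x] is within 1 of [f x], and dominated convergence applies with
    the bound [1 + 2 |f|]. *)
Lemma simple_limit_approx f : simple_limit f -> norm_int f < +oo ->
  exists s, bochner_approx m f s.
Proof.
move=> sf fi; have [s fs sfx] := sf.
have mf := simple_limit_norm sf.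
pose b n x := (`|s n x| <= 1 + `|f x|)%R.
have mb n : measurable_fun setT (b n).
  apply: measurable_fun_ler; first exact: (simple_fun_measurable (fun v : S => `|v|%R) (fs n)).
  exact: measurable_funD.
pose t n x := if b n x then s n x else 0%R.
have ft n : simple_fun (t n) by apply: fin_meas_if; [exact: mb|exact: fs|exact: fin_meas_cst].
have st n : simple_limit (fun x => f x - t n x)%R.
  by apply: simple_limitB => //; exact: simple_fun_limit.
exists t; split=> //.
rewrite -(@integral0 _ _ _ m setT).
apply: (@dominated_cvg _ _ _ m setT measurableT (fun n x => (`|f x - t n x|)%:E) (cst 0)
   (fun x => (1 + `|f x| + `|f x|)%:E)) => //.
- by move=> n; exact: norm_meas.
- move=> x _; apply/cvg_EFin; first exact: nearW.
  rewrite -[X in _ --> X](@normr0 _ S); apply: cvg_norm.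
  rewrite -[X in _ --> X](subrr (f x)); apply: cvgB; first exact: cvg_cst.
  apply: cvg_trans (sfx x); apply: near_eq_cvg.
  have /cvgrPdist_lt/(_ 1%R ltr01) := sfx x.
  apply: filterS => n; rewrite /t /b => h; case: ifPn => // /negP; case.
  rewrite -lerBlDr; apply: le_trans (lerB_dist _ _) _.
  by rewrite distrC ltW.
- have i1 : m.-integrable setT (EFin \o cst 1%R) by exact: finite_measure_integrable_cst.
  have i2 : m.-integrable setT (EFin \o (fun x => `|f x|)%R).
    apply/integrableP; split; first exact/measurable_EFinP.
    by under eq_integral do rewrite /= normr_id.
  rewrite (_ : (fun _ => _) = ((EFin \o cst 1%R) \+ (EFin \o (fun x => `|f x|)%R)) \+
     (EFin \o (fun x => `|f x|)%R)); last by apply/funext => x; rewrite /= !EFinD.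
  by apply: integrableD => //; exact: integrableD.
- move=> n x _; rewrite lee_fin normr_id; apply: le_trans (ler_normB _ _) _.
  rewrite [leRHS]addrC lerD2l /t /b; case: ifP => // _.
  by rewrite normr0 addr_ge0.
Qed.

(** Bochner's criterion. From left to right, some approximation [s n] is at finite L1 distance from
    [f], and a simple function has finite norm. *)
Lemma bochner_integrableP f : bochner_integrable m f <->
  strongly_measurable m f /\ norm_int f < +oo.
Proof.
split=> [[mf [s [fs sf]]]|[mf fi]]; split=> //.
  have [g sg fg] := (strongly_measurableP m f).1 mf.
  rewrite (eq_norm_int fg).
  have : norm_int (fun x => f x - s n x)%R @[n --> \oo] --> 0 by [].
  move=> /fine_cvgP[/filter_ex[n fn] _].
  have sn := simple_fun_limit (fs n).
  apply: (@le_lt_trans _ _ (norm_int (fun x => g x - s n x)%R + norm_int (s n))).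
    apply: le_trans (norm_intD _ _) => //; last exact: simple_limitB.
    by rewrite le_eqVlt; apply/orP; left; apply/eqP/eq_norm_int/filterE => x; rewrite subrK.
  rewrite (norm_int_simple (fs n)) lte_add_pinfty ?ltry//.
  rewrite -(@eq_norm_int (fun x => f x - s n x)%R); first by rewrite ltey_eq fn.
  by apply: filterS fg => x ->.
have [g sg fg] := (strongly_measurableP m f).1 mf.
have [|s gs] := simple_limit_approx sg; first by rewrite -(eq_norm_int fg).
by exists s; apply: bochner_approx_ae gs; apply: filterS fg => x ->.
Qed.

(** The limit of [simple_integral_dist] along an approximating sequence. It yields independence of
    that sequence, uniqueness of the integral and, for [s = 0], the norm bound. *)
Lemma is_bochner_integral_dist f v (s : T -> S) : is_bochner_integral m f v ->
  simple_fun s -> (`|v - simple_integral m s|)%:E <= norm_int (fun x => f x - s x)%R.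
Proof.
move=> [/strongly_measurableP[g sg fg] [t [ft tf] tv]] fs.
have h n : (`|simple_integral m (t n) - simple_integral m s|)%:E <=
    norm_int (fun x => f x - t n x)%R + norm_int (fun x => f x - s x)%R.
  apply: le_trans (simple_integral_dist sg (ft n) fs) _.
  by rewrite le_eqVlt; apply/orP; left; apply/eqP; congr (_ + _); apply: eq_norm_int;
    apply: filterS fg => x ->.
have [->|fsy] := eqVneq (norm_int (fun x => f x - s x)%R) +oo; first by rewrite leey.
rewrite -[leRHS]add0e; apply: (lee_cvg_to (a := \oo)
  (f := fun n => (`|simple_integral m (t n) - simple_integral m s|)%:E)
  (g := fun n => norm_int (fun x => f x - t n x)%R + norm_int (fun x => f x - s x)%R)).
- apply/cvg_EFin; first exact: nearW.
  by apply: cvg_norm; apply: cvgB => //; exact: cvg_cst.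
- apply: cvgeD; [|exact: tf|exact: cvg_cst].
  by rewrite fin_num_adde_defr.
- exact: nearW.
Qed.

Lemma bochner_approx_cvg f v s : is_bochner_integral m f v -> bochner_approx m f s ->
  simple_integral m (s n) @[n --> \oo] --> v.
Proof.
move=> fv [fs sf]; apply/cvgrPdist_lt => e e0.
have : norm_int (fun x => f x - s n x)%R @[n --> \oo] --> 0 by [].
move=> /fine_cvgP[fin /cvgrPdist_lt/(_ _ e0)]; apply: filterS2 fin => n fin.
rewrite sub0r normrN ger0_norm ?fine_ge0 ?norm_int_ge0//; apply: le_lt_trans.
by rewrite -lee_fin fineK//; exact: is_bochner_integral_dist.
Qed.

Lemma is_bochner_integral_unique f v w :
  is_bochner_integral m f v -> is_bochner_integral m f w -> v = w.
Proof.
move=> fv [mf [s fs sw]]; apply: (@cvg_unique _ _ (simple_integral m (s n) @[n --> \oo])) => //.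
exact: bochner_approx_cvg fs.
Qed.

Lemma bochner_integralE f v : is_bochner_integral m f v -> bochner_integral m f = v.
Proof.
move=> fv; apply: (is_bochner_integral_unique _ fv).
exact: (xgetPex (P := is_bochner_integral m f) 0%R (ex_intro _ v fv)).
Qed.

Lemma is_bochner_integral_norm f v : is_bochner_integral m f v ->
  (`|v|)%:E <= norm_int f.
Proof.
move=> fv; have f0 : simple_fun (fun _ : T => 0%R : S) by exact: fin_meas_cst.
have := is_bochner_integral_dist fv f0.
have -> : simple_integral m (fun _ : T => 0%R : S) = 0%R.
  rewrite (simple_integral_comp m (fun _ : S => 0%R : S) f0).
  by rewrite big1// => w _; rewrite scaler0.
rewrite subr0; move/le_trans; apply.
by rewrite le_eqVlt; apply/orP; left; apply/eqP/eq_norm_int/filterE => x; rewrite subr0.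
Qed.

Lemma is_bochner_integral_integrable f v : is_bochner_integral m f v -> bochner_integrable m f.
Proof. by move=> [mf [s fs _]]; split=> //; exists s. Qed.

Lemma simple_limit_dual_integrable (l : S -> R^o) f : topological_dual l ->
  simple_limit f -> norm_int f < +oo -> m.-integrable setT (EFin \o (l \o f)).
Proof.
move=> dl sf fin; have [C C0 lC] := topological_dual_bound dl; have [_ cl] := dl.
apply: (@le_integrable _ _ _ m _ measurableT _ (EFin \o (fun x => C * `|f x|)%R)).
- by apply/measurable_EFinP; exact: (simple_limit_measurable (phi := l) cl sf).
- by move=> x _; rewrite lee_fin; apply: le_trans (lC _) _; rewrite ler_norm.
- rewrite (_ : EFin \o _ = fun x => C%:E * (EFin \o (fun x => `|f x|)%R) x); last first.
    by apply/funext => x; rewrite /= EFinM.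
  apply: integrableZl => //; apply/integrableP; split.
    exact/measurable_EFinP/simple_limit_norm.
  by under eq_integral do rewrite /= normr_id.
Qed.

(** With [C] a bound for [l], the integral of [l (f x)] and the value of [l] at the integral of
    [s n] differ by at most [C] times the L1 distance from [f] to [s n]. *)
Lemma is_bochner_integral_linear (l : S -> R^o) f v : topological_dual l ->
  is_bochner_integral m f v -> \int[m]_x (l (f x))%:E = (l v)%:E.
Proof.
move=> [ll cl] fv; have [mf [s [fs sf] sv]] := fv.
have [g sg fg] := (strongly_measurableP m f).1 mf.
rewrite (ae_eq_lower_integral (g := fun x => (l (g x))%:E)); last first.
  by apply: filterS fg => x ->.
pose L : {linear S -> R^o} := HB.pack l (GRing.isLinear.Build _ _ _ _ l ll).
have [C C0 lC] := topological_dual_bound (conj ll cl).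
have ml : measurable_fun setT (fun x => l (g x)).
  exact: (simple_limit_measurable (phi := l) cl sg).
have fint : norm_int g < +oo.
  rewrite -(eq_norm_int fg).
  by have [] := (bochner_integrableP f).1 (is_bochner_integral_integrable fv).
have il : m.-integrable setT (EFin \o (fun x => l (g x))).
  exact: (simple_limit_dual_integrable (conj ll cl) sg fint).
have h n : (`|\int[m]_x l (g x) - l (simple_integral m (s n))|)%R%:E <=
    C%:E * norm_int (fun x => f x - s n x)%R.
  have sgn := simple_limitB sg (simple_fun_limit (fs n)).
  have iln : m.-integrable setT (EFin \o (fun x => l (s n x))).
    apply: (simple_limit_dual_integrable (conj ll cl) (simple_fun_limit (fs n))).
    by rewrite norm_int_simple// ltry.
  rewrite simple_integral_linear// -RintegralB//.
  rewrite EFin_normr_Rintegral//; last first.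
    rewrite (_ : EFin \o _ = (EFin \o (fun x => l (g x))) \- (EFin \o (fun x => l (s n x)))).
      exact: integrableB.
    by apply/funext => x.
  rewrite (@eq_norm_int (fun x => f x - s n x)%R (fun x => g x - s n x)%R); last first.
    by apply: filterS fg => x ->.
  apply: le_trans (le_abse_integral _ _ _) _ => //.
    by apply/measurable_EFinP; apply: measurable_funB => //; exact: (simple_fun_measurable l (fs n)).
  rewrite /norm_int -ge0_integralZl//; last 2 first.
  - exact: norm_meas.
  - by rewrite lee_fin ltW.
  apply: ge0_le_integral => //.
  - apply/measurable_EFinP; apply: measurableT_comp => //.
    by apply: measurable_funB => //; exact: (simple_fun_measurable l (fs n)).
  - by apply: emeasurable_funM => //; exact: norm_meas.
  - move=> x _; rewrite /= lee_fin; have := lC (g x - s n x)%R.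
    by rewrite -[l _]/(L _) linearB.
rewrite -[LHS]fineK; last by apply: integrable_fin_num => //; exact: il.
congr (_%:E); apply: (@cvg_unique _ _ (l (simple_integral m (s n)) @[n --> \oo])) => //.
  apply/cvgrPdist_lt => e e0.
  have : norm_int (fun x => f x - s n x)%R @[n --> \oo] --> 0 by [].
  move=> /fine_cvgP[fin /cvgrPdist_lt/(_ (e / C)%R (divr_gt0 e0 C0))].
  apply: filterS2 fin => n fin.
  rewrite sub0r normrN ger0_norm ?fine_ge0 ?norm_int_ge0// ltr_pdivlMr// mulrC.
  apply: le_lt_trans.
  by rewrite -lee_fin EFinM fineK//; exact: h.
exact: (@cvg_comp _ _ _ _ l _ _ _ sv (cl v)).
Qed.

Lemma bochner_integrableZ (c : T -> R) (C : R) f : measurable_fun setT c ->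
  (forall x, `|c x| <= C)%R -> bochner_integrable m f ->
  bochner_integrable m (fun x => c x *: f x)%R.
Proof.
move=> mc cC /bochner_integrableP[mf fi].
have [g sg fg] := (strongly_measurableP m f).1 mf.
have scg := simple_limitZ (measurable_simple_limit mc) sg.
have cfg : {ae m, forall x, c x *: g x = c x *: f x}%R by apply: filterS fg => x ->.
apply/bochner_integrableP; split.
  by apply: (strongly_measurable_ae cfg); exact: simple_limit_strongly_measurable.
rewrite -(eq_norm_int cfg).
have C0 : (0 <= C)%R by apply: le_trans (cC point); exact: normr_ge0.
apply: (@le_lt_trans _ _ (C%:E * norm_int g)).
  rewrite /norm_int -ge0_integralZl//; last exact: norm_meas.
  apply: ge0_le_integral => //.
  - exact: norm_meas.
  - by apply: emeasurable_funM => //; exact: norm_meas.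
  - by move=> x _; rewrite -EFinM lee_fin normrZ ler_wpM2r.
rewrite -(eq_norm_int fg); move: fi; rewrite -ge0_fin_numE ?norm_int_ge0// => fi.
by rewrite -(fineK fi) -EFinM ltry.
Qed.

End bochner_theory.

(** The integrals of the approximating simple functions form a Cauchy sequence by
    [simple_integral_dist]; completeness of [S] provides the limit. *)
Lemma bochner_integral_exists d (T : measurableType d) (R : realType)
    (m : {finite_measure set T -> \bar R}) (S : completeNormedModType R) (f : T -> S) :
  bochner_integrable m f -> exists v, is_bochner_integral m f v.
Proof.
move=> [mf [s [fs sf]]].
have [g sg fg] := (strongly_measurableP m f).1 mf.
suff /cvg_ex[v sv] : cvg (simple_integral m (s n) @[n --> \oo]).
  by exists v; split=> //; exists s.
apply: cauchy_cvg; apply/cauchy_exP => e e0.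
have : norm_int m (fun x => f x - s n x) @[n --> \oo] --> 0%E by [].
have e20 : 0 < e / 2 by rewrite divr_gt0.
move=> /fine_cvgP[fin /cvgrPdist_lt/(_ _ e20)] h.
have {fin}h : \forall n \near \oo, (norm_int m (fun x => g x - s n x)%R < (e / 2)%:E)%E.
  apply: filterS2 fin h => n fin.
  rewrite sub0r normrN ger0_norm ?fine_ge0 ?norm_int_ge0// -lte_fin fineK//.
  rewrite (@eq_norm_int _ _ _ _ _ (fun x => f x - s n x) (fun x => g x - s n x))//.
  by apply: filterS fg => x ->.
have [N hN] := filter_ex h.
exists (simple_integral m (s N)); apply: filterS h => n hn.
rewrite -ball_normE /= -lte_fin.
apply: le_lt_trans (simple_integral_dist m sg (fs N) (fs n)) _.
by rewrite [e]splitr EFinD lteD.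
Qed.

(** * Continuous maps into the dual *)

Section dual_norm.
Context (R : realType) (S : normedModType R).
Implicit Types l k : S -> R^o.

Lemma dual_normP l s : topological_dual l -> `|l s| <= dual_norm l * `|s|.
Proof.
move=> dl; have [C C0 lC] := topological_dual_bound dl.
have [ll _] := dl.
pose L : {linear S -> R^o} := HB.pack l (GRing.isLinear.Build _ _ _ _ l ll).
have [->|s0] := eqVneq s 0; first by rewrite -[l 0]/(L 0) linear0 !normr0 mulr0.
have ns0 : 0 < `|s| by rewrite normr_gt0.
rewrite -ler_pdivrMr//; apply: ub_le_sup.
  exists C => _ [t /= t1 <-]; apply: le_trans (lC t) _.
  by rewrite ler_piMr// ltW.
exists (`|s|^-1 *: s).
  by rewrite /= normrZ normfV normr_id mulVf// gt_eqF.
by rewrite -[l _]/(L _) linearZ normrZ normfV normr_id mulrC.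
Qed.

Lemma dual_norm_le l (C : R) : 0 <= C -> (forall s, `|l s| <= C * `|s|) -> dual_norm l <= C.
Proof.
move=> C0 lC; apply: ge_sup; first by exists `|l 0|; exists 0 => //=; rewrite normr0.
move=> _ [t /= t1 <-]; apply: le_trans (lC t) _.
by rewrite ler_piMr.
Qed.

Lemma dual_norm_ge0 l : topological_dual l -> 0 <= dual_norm l.
Proof.
move=> dl; have [C C0 lC] := topological_dual_bound dl.
apply: le_trans (normr_ge0 (l 0)) _; apply: ub_le_sup.
  exists C => _ [t /= t1 <-]; apply: le_trans (lC t) _.
  by rewrite ler_piMr// ltW.
by exists 0 => //=; rewrite normr0.
Qed.

End dual_norm.

Section continuous_into.
Context (R : realType) (S : normedModType R) (F : set (S -> R^o)).
Context (Fsub : dual_subspace F).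

Lemma dual_subspaceB l k : F l -> F k -> F (fun s => l s - k s).
Proof.
move=> Fl Fk; have [_ _ Flin] := Fsub.
have := Flin (-1) _ _ Fk Fl; congr F; apply/funext => s.
by rewrite scaleN1r addrC.
Qed.

Lemma dual_subspaceZ (a : R) l : F l -> F (fun s => a * l s).
Proof.
move=> Fl; have [_ F0 Flin] := Fsub.
have := Flin a _ _ Fl F0; congr F; apply/funext => s.
by rewrite addr0.
Qed.

Lemma dual_subspaceD l k : F l -> F k -> F (fun s => l s + k s).
Proof.
move=> Fl Fk; have [_ _ Flin] := Fsub.
have := Flin 1 _ _ Fl Fk; congr F; apply/funext => s.
by rewrite scale1r.
Qed.

Lemma dual_subspace_dual l : F l -> topological_dual l.
Proof. by have [h _ _] := Fsub; exact: h. Qed.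

(** This form replaces the supremum in [dual_norm] by an estimate on each vector, with a
    neighbourhood that does not depend on the vector. *)
Lemma continuous_intoP (X : topologicalType) (psi : X -> S -> R^o) :
  continuous_into F psi <-> (forall x, F (psi x)) /\ forall x (e : R), 0 < e ->
    \forall x' \near x, forall s, `|psi x' s - psi x s| <= e * `|s|.
Proof.
split=> -[Fpsi cpsi]; split=> // x.
  move=> e e0; have /cvgrPdist_le/(_ e e0) := cpsi x; apply: filterS => x'.
  have dB := dual_subspace_dual (dual_subspaceB (Fpsi x') (Fpsi x)).
  rewrite sub0r normrN ger0_norm ?dual_norm_ge0// => h s.
  apply: le_trans (dual_normP s dB) _.
  by rewrite ler_wpM2r.
apply/cvgrPdist_le => e e0; apply: filterS (cpsi x e e0) => x' h.
have dB := dual_subspace_dual (dual_subspaceB (Fpsi x') (Fpsi x)).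
rewrite sub0r normrN ger0_norm ?dual_norm_ge0//.
by apply: dual_norm_le => //; exact: ltW.
Qed.

Section closure.
Context (X : topologicalType).
Implicit Types psi phi : X -> S -> R^o.

Lemma continuous_into_cst l : F l -> continuous_into F (fun _ : X => l).
Proof.
move=> Fl; apply/continuous_intoP; split=> // x e e0; apply: nearW => x' s.
by rewrite subrr normr0 mulr_ge0// ltW.
Qed.

Lemma continuous_intoD psi phi : continuous_into F psi -> continuous_into F phi ->
  continuous_into F (fun x s => psi x s + phi x s).
Proof.
move=> /continuous_intoP[Fpsi cpsi] /continuous_intoP[Fphi cphi].
apply/continuous_intoP; split=> [x|x e e0]; first exact: dual_subspaceD.
have e20 : 0 < e / 2 by rewrite divr_gt0.
apply: filterS2 (cpsi x _ e20) (cphi x _ e20) => x' h1 h2 s.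
rewrite opprD addrACA; apply: le_trans (ler_normD _ _) _.
by rewrite [e]splitr mulrDl lerD.
Qed.

Lemma continuous_intoM (c : X -> R^o) psi : continuous c -> continuous_into F psi ->
  continuous_into F (fun x s => c x * psi x s).
Proof.
move=> cc /continuous_intoP[Fpsi cpsi].
apply/continuous_intoP; split=> [x|x e e0]; first exact: dual_subspaceZ.
have dx := dual_subspace_dual (Fpsi x).
have N0 := dual_norm_ge0 dx.
(* Near [x] one has [|c x'| <= 1 + |c x|], so [e1] controls the variation of [psi], while [e2]
   controls that of [c] against the dual norm of [psi x]. The added 1 keeps both denominators
   positive. *)
pose e1 := e / 2 / (1 + `|c x|); pose e2 := e / 2 / (1 + dual_norm (psi x)).
have e10 : 0 < e1 by rewrite !divr_gt0// ltr_pwDl.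
have e20 : 0 < e2 by rewrite !divr_gt0// ltr_pwDl.
have /cvgrPdist_le/(_ _ e20) h := cc x.
have /cvgrPdist_le/(_ _ ltr01) h1 := cc x.
apply: filterS3 (cpsi x _ e10) h h1 => x' p q r s.
rewrite (_ : _ - _ = c x' * (psi x' s - psi x s) + (c x' - c x) * psi x s); last by ring.
apply: le_trans (ler_normD _ _) _; rewrite !normrM [e]splitr mulrDl lerD//.
  apply: (@le_trans _ _ ((1 + `|c x|) * (e1 * `|s|))).
    apply: ler_pM => //; rewrite -lerBlDr; apply: le_trans (lerB_dist _ _) _.
    by rewrite distrC.
  by rewrite mulrA ler_wpM2r// /e1 mulrC divfK// gt_eqF// ltr_pwDl.
apply: (@le_trans _ _ (e2 * (dual_norm (psi x) * `|s|))).
  by apply: ler_pM => //; [rewrite distrC|exact: dual_normP].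
rewrite mulrA ler_wpM2r// /e2 mulrAC ler_pdivrMr ?ltr_pwDl// ler_wpM2l//; last by rewrite lerDr.
by rewrite divr_ge0// ltW.
Qed.

Lemma continuous_into_dual_norm psi : continuous_into F psi ->
  continuous (fun x => dual_norm (psi x) : R^o).
Proof.
move=> /continuous_intoP[Fpsi cpsi] x; apply/cvgrPdist_le => e e0.
apply: filterS (cpsi x _ e0) => x' h.
have dx := dual_subspace_dual (Fpsi x); have dx' := dual_subspace_dual (Fpsi x').
rewrite ler_distl lerBlDr; apply/andP; split.
  apply: dual_norm_le => [|s]; first by rewrite addr_ge0 ?dual_norm_ge0 ?ltW.
  rewrite mulrDl -lerBlDr; apply: le_trans _ (dual_normP s dx).
  rewrite lerBlDr -lerBlDl; apply: le_trans _ (h s).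
  exact: lerB_dist.
apply: dual_norm_le => [|s]; first by rewrite addr_ge0 ?dual_norm_ge0 ?ltW.
rewrite mulrDl -lerBlDr; apply: le_trans _ (dual_normP s dx').
rewrite lerBlDr -lerBlDl; apply: le_trans _ (h s); rewrite distrC.
exact: lerB_dist.
Qed.

Lemma continuous_into_bound psi : compact [set: X] -> continuous_into F psi ->
  exists2 C, 0 <= C & forall x s, `|psi x s| <= C * `|s|.
Proof.
move=> cX cpsi; have [C hC] := compact_norm_bounded cX (continuous_into_dual_norm cpsi).
have Fpsi := cpsi.1.
exists `|C| => // x s; apply: le_trans (dual_normP s (dual_subspace_dual (Fpsi x))) _.
rewrite ler_wpM2r//; apply: le_trans (ler_norm _) _; apply: le_trans (hC x) _.
exact: ler_norm.
Qed.

End closure.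

(** The increment splits into the fixed functional [psi (b z)] at [u z - u z'], small by weak
    continuity of [u], and the variation of [psi] at [u z'], small because [psi] is norm continuous
    and [u] is bounded. *)
Lemma continuous_into_eval (X Z : topologicalType) (psi : X -> S -> R^o) (b : Z -> X)
    (u : Z -> S) (C : R) : continuous_into F psi -> continuous b ->
  (forall z, `|u z| <= C) -> (forall l, F l -> continuous (l \o u : Z -> R^o)) ->
  continuous (fun z => psi (b z) (u z) : R^o).
Proof.
move=> /continuous_intoP[Fpsi cpsi] cb uC cu z; apply/cvgrPdist_le => e e0.
have e20 : 0 < e / 2 by rewrite divr_gt0.
have C0 : 0 <= C by apply: le_trans (uC z).
have e10 : 0 < e / 2 / (1 + C) by rewrite divr_gt0// ltr_pwDl.
have /cvgrPdist_le/(_ _ e20) h := cu _ (Fpsi (b z)) z.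
have h' := cb z _ (cpsi (b z) _ e10).
apply: filterS2 h h' => z' /= h /(_ (u z')) h'.
rewrite (_ : psi (b z) (u z) - _ = (psi (b z) (u z) - psi (b z) (u z')) -
  (psi (b z') (u z') - psi (b z) (u z'))); last by ring.
apply: le_trans (ler_normB _ _) _; rewrite [e]splitr lerD//.
apply: le_trans h' _; rewrite mulrAC ler_pdivrMr ?ltr_pwDl// ler_wpM2l ?(ltW e20)//.
by rewrite (le_trans (uC _))// lerDr.
Qed.

Lemma weak_continuous_dual (X : topologicalType) (h : X -> S) :
  continuous (h : X -> weak_topology F) -> forall l, F l -> continuous (l \o h : X -> R^o).
Proof.
move=> ch l Fl x.
pose ev := (fun s : S => (fun l : F => \val l s) : {ptws F -> R^o}).
have c1 : continuous (ev : initial_topology ev -> {ptws F -> R^o}) by exact: initial_continuous.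
pose lF : F := exist _ l (mem_set Fl).
have c2 := @proj_continuous F (fun=> R^o) lF.
have : continuous (@proj F (fun=> R^o) lF \o (ev \o h)).
  move=> z; apply: continuous_comp; last exact: c2.
  exact: (@continuous_comp X (initial_topology ev) _ h ev z (ch z) (c1 (h z))).
exact.
Qed.

(** The integrand [phi y (k y)] is only almost everywhere equal to a measurable function, hence [w],
    built from an everywhere limit [k'] of simple functions. For a simple function in place of [k'],
    each fibre carries the continuous function [phi y v] with [v] fixed. *)
Lemma continuous_into_integrable (Y : pmetricType R) (n : {finite_measure set (borel Y) -> \bar R})
    (k : Y -> S) (phi : Y -> S -> R^o) : compact [set: Y] -> bochner_integrable n k ->
  continuous_into F phi -> exists2 w : Y -> R, n.-integrable setT (EFin \o w) &
    {ae n, forall y, phi y (k y) = w y}.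
Proof.
move=> cY /bochner_integrableP[mk kfin] cphi.
have [k' sk' kk'] := (strongly_measurableP n k).1 mk.
exists (fun y => phi y (k' y)); last by apply: filterS kk' => y ->.
have [C C0 phiC] := continuous_into_bound cY cphi.
have dphi y := dual_subspace_dual (cphi.1 y).
have mphi : measurable_fun setT (fun y : borel Y => phi y (k' y) : R).
  have [s fs sk] := sk'.
  apply: (@measurable_fun_cvg _ (borel Y) R setT (fun n y => phi y (s n y) : R)) => [i|y _]; last first.
    have [_ cl] := dphi y.
    exact: (@cvg_comp _ _ _ (s ^~ y) (phi y) _ _ _ (sk y) (cl (k' y))).
  have cv v : measurable_fun setT (fun y : borel Y => phi y v : R).
    apply: continuous_borel_measurable.
    apply: (@continuous_into_eval Y Y phi id (fun=> v) `|v|) => //.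
      by move=> y' A hA; exact: hA.
    by move=> l Fl y'; exact: cvg_cst.
  move=> _ B mB; rewrite setTI.
  have [finr ms] := fs i.
  rewrite (_ : _ @^-1` _ = \bigcup_(v in range (s i))
     (s i @^-1` [set v] `&` (setT `&` (fun y => phi y v) @^-1` B))).
    by apply: fin_bigcup_measurable => // v _; apply: measurableI => //; exact: cv.
  apply/seteqP; split=> [y By|y [v _ [/= <- [_]]]]//.
  by exists (s i y).
apply: (@le_integrable _ _ _ n _ measurableT _ (EFin \o (fun y => C * `|k' y|))).
- exact/measurable_EFinP.
- by move=> y _; rewrite lee_fin; apply: le_trans (phiC _ _) _; rewrite ler_norm.
- rewrite (_ : EFin \o _ = fun x => (C%:E * (EFin \o (fun x => `|k' x|)%R) x)%E); last first.
    by apply/funext => x; rewrite /= EFinM.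
  apply: integrableZl => //; apply/integrableP; split.
    exact/measurable_EFinP/simple_limit_norm.
  rewrite (eq_norm_int kk') in kfin.
  by under eq_integral do rewrite /= normr_id.
Qed.

End continuous_into.

(** * Jensen's inequality *)

Section const_kernel.
Context d (T : measurableType d) (R : realType) (n : {finite_measure set T -> \bar R}).

(** A finite measure seen as a kernel from a one-point space, so that integrating against [n] and
    then against a kernel is a composition of kernels. *)
Definition const_kernel : unit -> {measure set T -> \bar R} := fun=> n.

Let measurable_const_kernel U : measurable U -> measurable_fun setT (const_kernel ^~ U).
Proof. by move=> _; exact: measurable_cst. Qed.

HB.instance Definition _ := isKernel.Build _ _ unit T R const_kernel measurable_const_kernel.

Let const_kernel_uub : measure_fam_uub const_kernel.
Proof.
exists (fine (n setT) + 1) => u; rewrite /const_kernel -[X in (X < _)%E]fineK ?fin_num_measure//.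
by rewrite lte_fin ltrDl.
Qed.

HB.instance Definition _ := Kernel_isFinite.Build _ _ unit T R const_kernel const_kernel_uub.

End const_kernel.

Section kernel_integral.
Context d d' (T : measurableType d) (U : measurableType d') (R : realType).
Context (Q : R.-pker T ~> U).
Local Open Scope ereal_scope.

Lemma measurable_kernel_integral (f : U -> \bar R) : (forall x, 0 <= f x) ->
  measurable_fun setT f -> measurable_fun setT (fun y => \int[Q y]_x f x).
Proof.
by move=> f0 mf; apply: measurable_fun_integral_kernel => // V mV; exact: measurable_kernel.
Qed.

Lemma kpush_integral (n : {finite_measure set T -> \bar R}) (m : {measure set U -> \bar R})
    (f : U -> \bar R) : (forall A, measurable A -> kpush Q n A = m A) ->
  (forall x, 0 <= f x) -> measurable_fun setT f ->
  \int[n]_y \int[Q y]_x f x = \int[m]_x f x.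
Proof.
move=> Qn f0 mf.
have [|//|P PE] := @prob_kernel_of _ _ (unit * T)%type U R (fun p => Q p.2).
- by move=> V mV; apply: (measurableT_comp (measurable_kernel Q V mV)); exact: measurable_snd.
- by move=> p; exact: prob_kernel.
have := @integral_kcomp _ _ _ _ _ _ R (const_kernel n) P tt f f0 mf.
rewrite (eq_measure_integral m); last first.
  move=> A mA _; rewrite -Qn// /kcomp /kpush.
  by apply: eq_integral => y _; rewrite PE.
move=> ->; apply: eq_integral => y _.
by apply: eq_measure_integral => A mA _; rewrite PE.
Qed.

End kernel_integral.

Section integral_shift.
Context d (T : measurableType d) (R : realType) (n : {finite_measure set T -> \bar R}).
Local Open Scope ereal_scope.

(** The integral of [f] may be [+oo], but its negative part is at most [C] and so has a finite
    integral. Adding it turns both sides into integrals of nonnegative functions, through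
    [f + C + f^- = f^+ + C]. *)
Lemma integral_shift (f : T -> \bar R) (C : R) : (0 <= C)%R -> measurable_fun setT f ->
  (forall x, (- C)%:E <= f x) ->
  \int[n]_x (f x + C%:E) = \int[n]_x f x + C%:E * n setT.
Proof.
move=> C0 mf fC.
have mp : measurable_fun setT f^\+ by exact: measurable_funepos.
have mn : measurable_fun setT f^\- by exact: measurable_funeneg.
have fin : \int[n]_x f^\- x \is a fin_num.
  rewrite ge0_fin_numE; last by apply: integral_ge0 => x _; rewrite funeneg_ge0.
  apply: (@le_lt_trans _ _ (\int[n]_x (cst C%:E x))).
    apply: ge0_le_integral => // x _.
    by rewrite /= funenegE ge_max lee_fin C0 andbT leeNl.
  by rewrite integral_cst// ltey_eq fin_numM// fin_num_measure.
have E x : f x + C%:E + f^\- x = f^\+ x + C%:E.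
  rewrite funeposE funenegE; have := fC x; case: (f x) => [r| |]//= h.
    rewrite -!EFin_max -!EFinD; congr (_%:E); have [r0|/ltW r0] := leP r 0%R.
      by rewrite max_l ?oppr_ge0//; lra.
    by rewrite max_r ?oppr_le0//; lra.
  by rewrite max_r ?leNye// max_l ?leey// adde0.
have eqI : \int[n]_x (f x + C%:E) + \int[n]_x f^\- x = \int[n]_x f^\+ x + C%:E * n setT.
  rewrite -integral_cst// -!ge0_integralD//.
  - by apply: eq_integral => x _; rewrite E.
  - by move=> x _; rewrite -[C]opprK EFinN sube_ge0.
  - exact: emeasurable_funD.
by rewrite [in RHS]integralE addeAC -eqI addeK.
Qed.

End integral_shift.

Section jensen.
Context (R : realType) (S : normedModType R).
Context (g : S -> R) (cg : convex_function [set: S] (g : S -> R^o)).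

Lemma convex_functionP (t : R) x y : 0 <= t -> t <= 1 ->
  g (t *: x + (1 - t) *: y) <= t * g x + (1 - t) * g y.
Proof.
move=> t0 t1; have := cg (Itv01 t0 t1) (mem_set (Logic.I : [set: S] x)) (mem_set (Logic.I : [set: S] y)).
exact.
Qed.

(** Unnormalised weights allow induction on the list, whose tail has arbitrary total weight. A tail
    of weight 0 is treated apart, as it cannot be normalised. *)
Lemma finite_jensen_scaled (I : eqType) (r : seq I) (p : I -> R) (z : I -> S) :
  (forall i, 0 <= p i) -> 0 < \sum_(i <- r) p i ->
  (\sum_(i <- r) p i) * g ((\sum_(i <- r) p i)^-1 *: \sum_(i <- r) p i *: z i) <=
    \sum_(i <- r) p i * g (z i).
Proof.
move=> p0; elim: r => [|i r IH]; first by rewrite big_nil ltxx.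
rewrite !big_cons; set t := \sum_(j <- r) p j.
have [t0|t0] := eqVneq t 0.
  have pj j : j \in r -> p j = 0.
    by move/eqP : t0; rewrite /t psumr_eq0// => /allP/= h /h/eqP.
  rewrite t0 addr0 [X in _ *: (_ + X)]big1_seq; last first.
    by move=> j /= jr; rewrite pj// scale0r.
  rewrite [X in _ -> _ <= _ + X]big1_seq; last by move=> j /= jr; rewrite pj// mul0r.
  by rewrite !addr0 => pi; rewrite scalerA mulVf ?scale1r// gt_eqF.
have tp : 0 < t by rewrite lt_neqAle eq_sym t0 sumr_ge0.
have := IH tp; rewrite -/t; set Z := \sum_(j <- r) _ => h pt.
pose l := p i / (p i + t).
have l0 : 0 <= l by rewrite divr_ge0// ltW.
have l1 : l <= 1 by rewrite ler_pdivrMr// mul1r lerDl ltW.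
have lE : 1 - l = t / (p i + t) by rewrite /l; field; rewrite gt_eqF.
rewrite (_ : _ *: (_ + Z) = l *: z i + (1 - l) *: (t^-1 *: Z)); last first.
  rewrite scalerDr !scalerA lE; congr (_ *: _ + _ *: _); first by rewrite /l mulrC.
  by field; rewrite t0 gt_eqF.
have := convex_functionP (z i) (t^-1 *: Z) l0 l1.
rewrite -(ler_pM2l pt) => /le_trans; apply.
rewrite (_ : (p i + t) * _ = p i * g (z i) + t * g (t^-1 *: Z)); first by rewrite lerD2l.
by rewrite lE /l; field; rewrite gt_eqF.
Qed.

Lemma finite_jensen (I : eqType) (r : seq I) (p : I -> R) (z : I -> S) :
  (forall i, 0 <= p i) -> \sum_(i <- r) p i = 1 ->
  g (\sum_(i <- r) p i *: z i) <= \sum_(i <- r) p i * g (z i).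
Proof.
move=> p0 p1; have := @finite_jensen_scaled I r p z p0.
by rewrite p1 invr1 scale1r mul1r; exact.
Qed.

End jensen.

Section average_selection.
Context d (T : measurableType d) (R : realType) (P : {finite_measure set T -> \bar R}).

Lemma average_selection (u : T -> R) (A : set T) (D : T -> Prop) (e : R) : 0 < e ->
  P.-integrable setT (EFin \o u) -> measurable A -> {ae P, forall x, D x} ->
  exists x, ((0 < P A)%E -> A x /\ D x) /\
    fine (P A) * u x <= \int[P]_(x in A) u x + e * fine (P A).
Proof.
move=> e0 iu mA aeD.
have iuA : P.-integrable A (EFin \o u) by exact: integrableS iu.
have fA : P A \is a fin_num by exact: fin_num_measure.
have [PA0|PA0] := eqVneq (P A) 0%E.
  exists point; rewrite PA0 ltxx; split=> //.
  rewrite /Rintegral null_set_integral//; last exact: (measurable_int _ iuA).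
  by rewrite /= mul0r mulr0 addr0.
have PAp : (0 < P A)%E by rewrite lt_neqAle eq_sym PA0 measure_ge0.
have fAp : 0 < fine (P A) by rewrite fine_gt0// PAp ltey_eq fA.
apply: contrapT => /forallNP h.
pose a := (\int[P]_(x in A) u x) / fine (P A) + e.
have : ((a%:E * P A) <= (\int[P]_(x in A) u x)%:E)%E.
  rewrite -integral_cst// /Rintegral fineK; last exact: integrable_fin_num.
  rewrite !(integral_mkcond A); apply: ae_le_lower_integral.
  apply: filterS aeD => x Dx; rewrite /patch; case: ifPn => // /set_mem Ax.
  rewrite lee_fin /a; have := h x => /not_andP[/not_implyP[]|]; first by rewrite not_andE => _ [].
  move=> /negP; rewrite -ltNge => /ltW.
  by rewrite -ler_pdivrMl// mulrDr ![(fine (P A))^-1 * _]mulrC mulfK// gt_eqF.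
rewrite -(fineK fA) -EFinM lee_fin /a mulrDl divfK ?gt_eqF//.
by rewrite gerDl leNgt mulr_gt0.
Qed.

End average_selection.

Section jensen_bochner.
Context d (T : measurableType d) (R : realType) (P : {finite_measure set T -> \bar R})
  (S : normedModType R).

Lemma simple_fun_sum_preimage (s : T -> S) : simple_fun s ->
  \sum_(c <- fset_set (range s)) fine (P (s @^-1` [set c])) = fine (P setT).
Proof.
move=> fs; have := Rintegral_fin_meas P (fun _ : S => 1) fs.
rewrite Rintegral_cst// mul1r => ->.
by apply: eq_bigr => c _; rewrite mulr1.
Qed.

Lemma simple_fun_Rintegral_sum (s : T -> S) (u : T -> R) : simple_fun s ->
  P.-integrable setT (EFin \o u) ->
  \sum_(c <- fset_set (range s)) \int[P]_(x in s @^-1` [set c]) u x = \int[P]_x u x.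
Proof.
move=> fs iu; pose A c := s @^-1` [set c].
have mA c : measurable (A c) by exact: fs.2.
have fin c : (\int[P]_(x in A c) (u x)%:E)%E \is a fin_num.
  by apply: integrable_fin_num => //; exact: integrableS iu.
have cover : \big[setU/set0]_(c <- fset_set (range s)) A c = setT.
  rewrite -bigcup_seq; apply/seteqP; split=> // x _; exists (s x) => //=.
  by rewrite in_fset_set//; [apply: mem_set; exists x|exact: fs.1].
have := @integral_bigsetU_EFin _ T R P S A u (fset_set (range s)) mA (fset_uniq _).
rewrite /= cover => h; apply: EFin_inj.
rewrite -sumEFin /Rintegral fineK; last exact: integrable_fin_num.
rewrite h; last exact: (measurable_int _ iu).
  by apply: eq_bigr => c _; exact/fineK/fin.
by move=> c c' _ _ [x [/= <- <-]].
Qed.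

(* In each fibre of a simple approximation [s] of [f], pick a point where
   [g (f x) + lam * |f x - s x|] is at most its average. For large [lam] the resulting
   barycenter is close to [v], and finite Jensen bounds [g] there. *)
Lemma jensen (f : T -> S) (v : S) (g : S -> R) (C : R) : P setT = 1%E ->
  is_bochner_integral P f v -> convex_function [set: S] (g : S -> R^o) ->
  (forall a, open [set s | a < g s]) -> measurable_fun setT (g \o f) -> 0 <= C ->
  (forall x, - C <= g (f x)) -> ((g v)%:E <= \int[P]_x (g (f x))%:E)%E.
Proof.
move=> P1 fv cg og mgf C0 gC; rewrite leNgt; apply/negP => lt_g.
pose w x := g (f x).
have mw : measurable_fun setT (EFin \o w) by exact/measurable_EFinP.
have sh := integral_shift P C0 mw; have {}sh := sh (fun x => gC x).
rewrite P1 mule1 in sh.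
have Cw x : 0 <= w x + C by have := gC x; rewrite /w; lra.
have iwC : P.-integrable setT (EFin \o (fun x => w x + C)).
  apply/integrableP; split; first by apply/measurable_EFinP/measurable_funD.
  under eq_integral do rewrite /= ger0_norm// EFinD.
  by rewrite sh lte_add_pinfty ?ltry//; apply: lt_trans lt_g _; rewrite ltry.
have iw : P.-integrable setT (EFin \o w).
  rewrite (_ : EFin \o w = (EFin \o (fun x => w x + C)%R) \- (EFin \o cst C))%E.
    by apply: integrableB => //; exact: finite_measure_integrable_cst.
  by apply/funext => x; rewrite /= -EFinB addrK.
pose I0 := \int[P]_x w x.
have I0E : (\int[P]_x (w x)%:E)%E = I0%:E by rewrite /I0 /Rintegral fineK// integrable_fin_num.
have I0g : I0 < g v by rewrite -lte_fin -I0E.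
have I0C : - C <= I0.
  have : \int[P]_x (cst (- C) x) <= I0.
    apply: le_Rintegral => //; first exact: finite_measure_integrable_cst.
    by move=> x _; exact: gC.
  have -> : \int[P]_x (cst (- C) x) = - C * fine (P setT) by exact: Rintegral_cst.
  by rewrite P1 mulr1.
pose e := (g v - I0) / 2; have e0 : 0 < e by rewrite divr_gt0// subr_gt0.
have [dl dl0 hdl] : exists2 dl : R, 0 < dl & forall v', `|v - v'| < dl -> I0 + e < g v'.
  have : nbhs v [set s | I0 + e < g s].
    by apply: open_nbhs_nbhs; split; [exact: og|rewrite /= /e; lra].
  move=> /nbhs_ballP[dl dl0 h]; exists dl => // v' vv'; apply: h.
  by rewrite -ball_normE.
(* With this penalty a bound [lam * Dt <= I0 + e + C] forces the mean distance [Dt] below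
   [dl / 4]. *)
pose lam := 4 * (I0 + e + C) / dl.
have IeC : 0 < I0 + e + C by lra.
have lam0 : 0 < lam by rewrite divr_gt0// mulr_gt0.
(* The bound [dl / 4] is for the distance from [v] to the integral of [s]; the bound [e / (4 * lam)]
   keeps the penalty [lam * ep] below [e / 4]. *)
pose ep := Num.min (dl / 4) (e / (4 * lam)).
have ep0 : 0 < ep.
  have l40 : 0 < 4 * lam by rewrite mulr_gt0.
  by rewrite /ep lt_min; apply/andP; split; apply: divr_gt0.
have [/strongly_measurableP[f' sf' ff'] [sq [fsq sqf] _]] := fv.
have [s [fs sep]] : exists s : T -> S, simple_fun s /\ (norm_int P (fun x => f x - s x)%R < ep%:E)%E.
  have : norm_int P (fun x => f x - sq n x) @[n --> \oo] --> 0%E by [].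
  move=> /fine_cvgP[fin /cvgrPdist_lt/(_ _ ep0) h]; have [n [fn hn]] := filter_ex (filterI fin h).
  exists (sq n); split=> //; rewrite -(fineK fn) lte_fin.
  by move: hn; rewrite sub0r normrN ger0_norm// fine_ge0// norm_int_ge0.
have fs1 : norm_int P (fun x => f x - s x) = norm_int P (fun x => f' x - s x).
  by apply: eq_norm_int; apply: filterS ff' => x ->.
have vs : `|v - simple_integral P s| < ep.
  by rewrite -lte_fin; apply: le_lt_trans sep; exact: is_bochner_integral_dist.
have sfs := simple_limitB sf' (simple_fun_limit fs).
have ins : P.-integrable setT (EFin \o (fun x => `|f' x - s x|)).
  apply/integrableP; split; first exact/measurable_EFinP/simple_limit_norm.
  under eq_integral do rewrite /= normr_id.
  by apply: le_lt_trans (ltry ep); apply: ltW; rewrite -[X in (X < _)%E]fs1.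
pose u x := w x + lam * `|f' x - s x|.
have inl : P.-integrable setT (EFin \o (fun x => lam * `|f' x - s x|)).
  rewrite (_ : EFin \o _ = fun x => (lam%:E * (EFin \o (fun x => `|f' x - s x|)%R) x)%E); last first.
    by apply/funext => x; rewrite /= EFinM.
  exact: integrableZl.
have iu : P.-integrable setT (EFin \o u).
  rewrite (_ : EFin \o u = (EFin \o w) \+ (EFin \o (fun x => lam * `|f' x - s x|)%R))%E.
    exact: integrableD.
  by apply/funext => x; rewrite /= -EFinD.
have Iu : \int[P]_x u x <= I0 + lam * ep.
  rewrite /u RintegralD// RintegralZl// lerD2l ler_pM2l// -lee_fin /Rintegral fineK.
    by apply: ltW; rewrite -[X in (X < _)%E]fs1.
  exact: integrable_fin_num.
pose A c := s @^-1` [set c]; pose p c := fine (P (A c)).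
have mA c : measurable (A c) by exact: fs.2.
have e40 : 0 < e / 4 by rewrite divr_gt0.
have [xi hxi] := choice (fun c => average_selection e40 iu (mA c) ff').
have p0 c : 0 <= p c by rewrite fine_ge0.
pose r := fset_set (range s).
have p1 : \sum_(c <- r) p c = 1 by rewrite simple_fun_sum_preimage// P1.
have pE c (a b : R) : ((0 < P (A c))%E -> a = b) -> p c * a = p c * b.
  rewrite /p; have [->|Pc] := eqVneq (P (A c)) 0%E; first by rewrite !mul0r.
  by move=> -> //; rewrite lt_neqAle eq_sym Pc measure_ge0.
have hs : \sum_(c <- r) p c * (w (xi c) + lam * `|f' (xi c) - c|) <= I0 + lam * ep + e / 4.
  have -> : e / 4 = \sum_(c <- r) e / 4 * p c by rewrite -mulr_sumr p1 mulr1.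
  apply: le_trans (_ : _ <= \sum_(c <- r) (\int[P]_(x in A c) u x + e / 4 * p c)) _.
    apply: ler_sum => c _; have [h1 h2] := hxi c; apply: le_trans h2.
    by rewrite le_eqVlt; apply/orP; left; apply/eqP/pE => /h1[Ac _]; rewrite /u Ac.
  by rewrite big_split lerD2r (simple_fun_Rintegral_sum fs iu).
pose W := \sum_(c <- r) p c * w (xi c).
pose Dt := \sum_(c <- r) p c * `|f' (xi c) - c|.
have hs' : W + lam * Dt <= I0 + lam * ep + e / 4.
  apply: le_trans hs; rewrite /W /Dt mulr_sumr -big_split; apply: ler_sum => c _ /=.
  by rewrite mulrDr mulrCA.
have Dt0 : 0 <= Dt by apply: sumr_ge0 => c _; rewrite mulr_ge0.
have WC : - C <= W.
  rewrite -[- C]mul1r -p1 mulr_suml; apply: ler_sum => c _.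
  by rewrite ler_wpM2l// gC.
have lep : lam * ep <= e / 4.
  have : ep <= e / (4 * lam) by rewrite /ep ge_min lexx orbT.
  have E : lam * (e / (4 * lam)) = e / 4 by field; rewrite gt_eqF.
  by rewrite -E ler_pM2l.
pose v' := \sum_(c <- r) p c *: f' (xi c).
have gv' : g v' <= W.
  apply: le_trans (@finite_jensen _ _ _ cg _ r p (f' \o xi) p0 p1) _.
  rewrite le_eqVlt; apply/orP; left; apply/eqP; apply: eq_bigr => c _.
  by apply: pE => /(hxi c).1[_]; rewrite /w => ->.
have Dtdl : Dt <= dl / 4.
  have : lam * Dt <= I0 + e + C by lra.
  rewrite -ler_pdivlMl// => /le_trans; apply; rewrite le_eqVlt; apply/orP; left; apply/eqP.
  by rewrite /lam; field; rewrite !gt_eqF.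
have vv' : `|v - v'| < dl.
  have -> : v - v' = (v - simple_integral P s) + \sum_(c <- r) p c *: (c - f' (xi c)).
    rewrite -[s in RHS]/(idfun \o s) (simple_integral_comp P idfun fs).
    rewrite -addrA; congr (_ + _); rewrite /v' -/r addrC.
    have -> : \sum_(c <- r) p c *: (c - f' (xi c)) =
        \sum_(c <- r) p c *: c - \sum_(c <- r) p c *: f' (xi c).
      by rewrite -sumrB; apply: eq_bigr => c _; rewrite scalerBr.
    by rewrite addrAC subrr add0r.
  apply: le_lt_trans (ler_normD _ _) _.
  have : `|\sum_(c <- r) p c *: (c - f' (xi c))| <= Dt.
    apply: le_trans (ler_norm_sum _ _ _) _; apply: ler_sum => c _.
    by rewrite normrZ ger0_norm// distrC.
  have : ep <= dl / 4 by rewrite /ep ge_min lexx.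
  by lra.
(* The contradiction: [g v' <= W <= I0 + e / 2], whereas the closeness of [v'] to [v] gives
   [g v' > I0 + e]. *)
have := hdl v' vv'; have : 0 <= lam * Dt by rewrite mulr_ge0// ltW.
by lra.
Qed.

End jensen_bochner.

Section probability_versions.
Context d (T : measurableType d) (R : realType) (P : {measure set T -> \bar R}).
Context (P1 : P setT = 1%E).

Lemma integral_shift_probability (f : T -> \bar R) (C : R) : 0 <= C ->
  measurable_fun setT f -> (forall x, (- C)%:E <= f x)%E ->
  (\int[P]_x (f x + C%:E) = \int[P]_x f x + C%:E)%E.
Proof.
have [|P' P'E] := @finite_measure_copy _ _ _ P; first by rewrite P1 ltry.
move: P1; rewrite -P'E => P'1 C0 mf fC; have := integral_shift P' C0 mf fC.
have -> : P' setT = 1%E by exact: P'1.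
by rewrite mule1.
Qed.

Lemma jensen_probability (S : normedModType R) (f : T -> S) (v : S) (g : S -> R) (C : R) :
  is_bochner_integral P f v -> convex_function [set: S] (g : S -> R^o) ->
  (forall a, open [set s | a < g s]) -> measurable_fun setT (g \o f) -> 0 <= C ->
  (forall x, - C <= g (f x)) -> ((g v)%:E <= \int[P]_x (g (f x))%:E)%E.
Proof.
have [|P' P'E] := @finite_measure_copy _ _ _ P; first by rewrite P1 ltry.
by move: P1; rewrite -P'E => P'1; exact: jensen.
Qed.

End probability_versions.

Section weak_lsc.
Context (R : realType) (S : normedModType R) (F : set (S -> R^o)).
Context (Fsub : dual_subspace F).

Lemma weak_continuous_id : continuous (id : S -> weak_topology F).
Proof.
pose ev := (fun s : S => (fun l : F => \val l s) : {ptws F -> R^o}).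
apply: (@continuous_comp_initial S S {ptws F -> R^o} ev id) => s.
apply/cvg_sup => l.
apply: (@continuous_comp_initial (F -> R^o) S R^o (fun f => f l) (ev \o id)) => t.
have Fl : F (\val l) by exact: set_valP.
by have [_ cl] := dual_subspace_dual Fsub Fl; exact: cl.
Qed.

(** The norm topology refines [w(F)]. Norm lower semicontinuity is what [jensen] uses, since it
    compares [v] with a vector close to it in norm. *)
Lemma convex_wlsc_open (g : S -> R) : convex_wlsc F g -> forall a, open [set s | a < g s].
Proof.
move=> [_ /lower_semicontinuousP lg] a.
move/continuousP : weak_continuous_id => /(_ _ (lg a)).
by congr open; apply/seteqP; split=> s /=; rewrite lte_fin.
Qed.

End weak_lsc.

Lemma lsc_compact_lbound (R : realType) (X : topologicalType) (w : X -> R) :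
  compact [set: X] -> (forall a, open [set x | a < w x]) ->
  exists2 C, 0 <= C & forall x, - C <= w x.
Proof.
move=> /compact_near_coveringP cX ow.
have := cX _ (pinfty_nbhs R) (fun C x => - C <= w x) _.
case=> [x _|M [Mr hM]].
  have : nbhs x [set x' | w x - 1 < w x'].
    by apply: open_nbhs_nbhs; split; [exact: ow|rewrite /= gtrBl].
  move=> nx; exists ([set x' | w x - 1 < w x'], [set C | 1 - w x < C]) => /=.
    by split=> //; exists (1 - w x); split=> //; exact: num_real.
  by move=> [x' C] /= [h1 h2]; lra.
exists (`|M| + 1); first by rewrite addr_ge0.
move=> x; apply: (hM (`|M| + 1)) => //.
by apply: (le_lt_trans (ler_norm _)); rewrite ltrDl.
Qed.

Section barycenter_domination.
Context (R : realType) (X Y : pmetricType R) (S : normedModType R)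
  (F : set (S -> R^o)) (mu : svmeasure (borel X) S) (nu : svmeasure (borel Y) S).
Context (cX : compact [set: X]) (Fsub : dual_subspace F)
  (mu_continuous : continuous (density mu : X -> weak_topology F)).

(** The integrals may be [+oo], but [g] along the density of [mu] is lower semicontinuous on the
    compact [X], hence bounded below by some [- C]. Adding [C] reduces the integration against [Q]
    to nonnegative functions, and the constants cancel because [tv mu] and [tv nu] have the same
    mass. *)
Lemma barycenter_domination : kernel_barycenter mu nu -> convex_domination F mu nu.
Proof.
move=> [Q [Qn bar]] g cg; have og := convex_wlsc_open Fsub cg.
pose w x := g (density mu x).
have ow a : open ([set x | a < w x] : set X).
  have [_ /lower_semicontinuousP lg] := cg.
  move/continuousP : mu_continuous => /(_ _ (lg a)).
  by congr open; apply/seteqP; split=> s /=; rewrite lte_fin.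
have mw : measurable_fun setT (w : borel X -> R) by exact: lsc_borel_measurable.
have [C C0 wC] := lsc_compact_lbound cX ow.
have mwE : measurable_fun setT (EFin \o (w : borel X -> R)) by exact/measurable_EFinP.
have Q1 y : Q y setT = 1%E by exact: prob_kernel.
pose J y := (\int[Q y]_x (w x)%:E)%E.
have JC y : (J y + C%:E = \int[Q y]_x (w x + C)%:E)%E.
  by rewrite -(integral_shift_probability (Q1 y) C0 mwE (fun x => wC x)).
have JK y : (J y = \int[Q y]_x (w x + C)%:E - C%:E)%E by rewrite -JC addeK.
have wC0 x : (0 <= (w x + C)%:E)%E by rewrite lee_fin; have := wC x; lra.
have mwC : measurable_fun setT (fun x : borel X => (w x + C)%:E).
  by apply/measurable_EFinP/measurable_funD.
have mJ : measurable_fun setT J.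
  rewrite (funext JK); apply: emeasurable_funB => //.
  exact: measurable_kernel_integral.
have JgeC y : ((- C)%:E <= J y)%E.
  by rewrite JK EFinN leeBrDl// -EFinN -EFinD subrr integral_ge0.
have TT : tv nu setT = tv mu setT.
  rewrite -Qn// /kpush; under eq_integral do rewrite prob_kernel.
  by rewrite integral_cst// mul1e.
apply: (@le_trans _ _ (\int[tv nu]_y J y)%E).
  apply: ae_le_lower_integral; apply: filterS bar => y by_.
  exact: (jensen_probability (Q1 y) (C := C)) by_ cg.1 og mw C0 wC.
have s1 := integral_shift (tv nu) C0 mJ JgeC.
have s2 := integral_shift (tv mu) C0 mwE (fun x => wC x).
have E : (\int[tv nu]_y (J y + C%:E) = \int[tv mu]_x (w x + C)%:E)%E.
  under eq_integral do rewrite JC.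
  exact: kpush_integral.
have fC : (C%:E * tv mu setT)%E \is a fin_num by rewrite fin_numM// fin_num_measure.
rewrite -(leeD2rE _ _ fC); rewrite -[X in (_ <= X)%E]s2 -TT -s1 E.
exact: lexx.
Qed.

End barycenter_domination.

(** * The positivity condition *)

Lemma ae_imp d (T : measurableType d) (R : realType) (m : {measure set T -> \bar R})
    (A B : T -> Prop) :
  {ae m, forall x, A x} -> (forall x, A x -> B x) -> {ae m, forall x, B x}.
Proof. by move=> hA AB; apply: filterS hA. Qed.

Lemma ae_imp2 d (T : measurableType d) (R : realType) (m : {measure set T -> \bar R})
    (A B C : T -> Prop) : {ae m, forall x, A x} -> {ae m, forall x, B x} ->
  (forall x, A x -> B x -> C x) -> {ae m, forall x, C x}.
Proof. by move=> hA hB ABC; apply: filterS2 hA hB. Qed.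

Lemma ae_le_Rintegral d (T : measurableType d) (R : realType) (m : {measure set T -> \bar R})
    (f g : T -> R) : m.-integrable setT (EFin \o f) -> m.-integrable setT (EFin \o g) ->
  {ae m, forall x, f x <= g x} -> \int[m]_x f x <= \int[m]_x g x.
Proof.
move=> fi gi fg; apply: fine_le; [exact: integrable_fin_num..|].
by apply: ae_le_lower_integral; apply: (ae_imp fg) => x; rewrite lee_fin.
Qed.

Lemma Rintegral_sum d (T : measurableType d) (R : realType) (m : {measure set T -> \bar R})
    (I : Type) (r : seq I) (f : I -> T -> R) :
  (forall i, m.-integrable setT (EFin \o f i)) ->
  m.-integrable setT (EFin \o (fun x => \sum_(i <- r) f i x)) /\
  \int[m]_x (\sum_(i <- r) f i x) = \sum_(i <- r) \int[m]_x f i x.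
Proof.
move=> fi; have isum : m.-integrable setT (EFin \o (fun x => \sum_(i <- r) f i x)).
  rewrite (_ : _ \o _ = fun x => (\sum_(i <- r) (EFin \o f i) x)%E).
    by apply: integrable_sum => // i _; exact: fi.
  by apply/funext => x; rewrite /= sumEFin.
split=> //; apply: EFin_inj; rewrite -sumEFin /Rintegral fineK; last exact: integrable_fin_num.
under eq_integral do rewrite -sumEFin.
rewrite integral_sum//; apply: eq_bigr => i _.
by rewrite fineK//; apply: integrable_fin_num => //; exact: fi.
Qed.

Section svmeasure_dual.
Context d (T : measurableType d) (R : realType) (S : completeNormedModType R)
  (mu : svmeasure T S).

Lemma sv_integral_dual (c : T -> R) (C : R) (l : S -> R^o) : measurable_fun setT c ->
  (forall x, `|c x| <= C) -> topological_dual l ->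
  l (sv_integral mu c) = \int[tv mu]_x (c x * l (density mu x)).
Proof.
move=> mc cC dl.
have [v hv] := bochner_integral_exists (bochner_integrableZ mc cC (density_integrable mu)).
rewrite /sv_integral (bochner_integralE hv); have := is_bochner_integral_linear dl hv.
have [ll _] := dl.
pose L : {linear S -> R^o} := HB.pack l (GRing.isLinear.Build _ _ _ _ l ll).
have lZ a u : l (a *: u) = a * l u by rewrite -[l (a *: u)]/(L (a *: u)) linearZ.
rewrite /Rintegral => E; rewrite (_ : (\int[_]_x _)%E = (l v)%:E)//.
by rewrite -E; apply: eq_integral => x _; rewrite lZ.
Qed.

End svmeasure_dual.

Lemma sv_pairing_integrable (R : realType) (S : normedModType R) (F : set (S -> R^o))
    (X : pmetricType R) (mu : svmeasure (borel X) S) (psi : X -> S -> R^o) :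
  dual_subspace F -> compact [set: X] -> continuous_into F psi ->
  exists w : borel X -> R, [/\ (tv mu).-integrable setT (EFin \o w),
    {ae tv mu, forall x, psi x (density mu x) = w x} &
    sv_pairing mu psi = (\int[tv mu]_x w x)%:E].
Proof.
move=> Fsub cX cpsi.
have [w iw pw] := continuous_into_integrable Fsub cX (density_integrable mu) cpsi.
exists w; split=> //; rewrite /sv_pairing /Rintegral fineK; last exact: integrable_fin_num.
by apply: ae_eq_lower_integral; apply: ae_imp pw _ => x ->.
Qed.

Section pairing.
Context (R : realType) (S : normedModType R) (F : set (S -> R^o)) (X : pmetricType R)
  (mu : svmeasure (borel X) S).
Context (Fsub : dual_subspace F) (cX : compact [set: X]).
Implicit Types psi phi : X -> S -> R^o.

Lemma sv_pairing_fin_num psi : continuous_into F psi -> sv_pairing mu psi \is a fin_num.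
Proof. by move=> /(sv_pairing_integrable mu Fsub cX)[w [_ _ ->]]. Qed.

Lemma fine_sv_pairingD psi phi : continuous_into F psi -> continuous_into F phi ->
  fine (sv_pairing mu (fun x s => psi x s + phi x s)) =
  fine (sv_pairing mu psi) + fine (sv_pairing mu phi).
Proof.
move=> cpsi cphi; have [w [iw pw ->]] := sv_pairing_integrable mu Fsub cX cpsi.
have [v [iv pv ->]] := sv_pairing_integrable mu Fsub cX cphi.
rewrite /= -RintegralD//; congr fine; apply: ae_eq_lower_integral.
by apply: ae_imp2 pw pv _ => x -> ->.
Qed.

Lemma fine_sv_pairingZ (c : R) psi : continuous_into F psi ->
  fine (sv_pairing mu (fun x s => c * psi x s)) = c * fine (sv_pairing mu psi).
Proof.
move=> cpsi; have [w [iw pw ->]] := sv_pairing_integrable mu Fsub cX cpsi.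
rewrite /= -RintegralZl//; congr fine; apply: ae_eq_lower_integral.
by apply: ae_imp pw _ => x ->.
Qed.

End pairing.

Definition nonneg_pairing (R : realType) (X Y : pmetricType R) (S : normedModType R)
    (F : set (S -> R^o)) (mu : svmeasure (borel X) S) (nu : svmeasure (borel Y) S) :=
  forall (psi : X -> S -> R^o) (phi : Y -> S -> R^o),
    continuous_into F psi -> continuous_into F phi ->
    (forall x y, 0 <= psi x (density mu x) + phi y (density mu x)) ->
    0 <= fine (sv_pairing mu psi) + fine (sv_pairing nu phi).

Section to_nonneg_pairing.
Context (R : realType) (X Y : pmetricType R) (S : normedModType R)
  (F : set (S -> R^o)) (mu : svmeasure (borel X) S) (nu : svmeasure (borel Y) S).
Context (cX : compact [set: X]) (cY : compact [set: Y]) (Fsub : dual_subspace F).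

(** A supremum of linear [w(F)]-continuous functions; compactness of [Y] bounds it by a multiple of
    the norm, so that it is real valued. *)
Lemma sup_dual_convex_wlsc (phi : Y -> S -> R^o) : continuous_into F phi ->
  convex_wlsc F (fun s => sup [set - phi y s | y in [set: Y]]).
Proof.
move=> cphi; have [C C0 phiC] := continuous_into_bound Fsub cY cphi.
have hub s : has_ubound [set - phi y s | y in [set: Y]].
  exists (C * `|s|) => _ [y _ <-]; apply: le_trans (phiC y s).
  by rewrite -normrN ler_norm.
have le_g s y : - phi y s <= sup [set - phi y s | y in [set: Y]].
  by apply: ub_le_sup => //; exists y.
split.
  move=> t s r _ _; apply: ge_sup; first by exists (- phi point (conv t s r)); exists point.
  move=> _ [y _ <-]; have [ll _] := dual_subspace_dual Fsub (cphi.1 y).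
  pose L : {linear S -> R^o} := HB.pack (phi y) (GRing.isLinear.Build _ _ _ _ (phi y) ll).
  have -> : - phi y (conv t s r) = t%:num * - phi y s + (1 - t%:num) * - phi y r.
    rewrite -[phi y _]/(L (_ *: s + _ *: r)) linearD !linearZ opprD.
    by rewrite !mulrN.
  by rewrite lerD// ler_wpM2l// ?subr_ge0//; apply: le_g.
apply/lower_semicontinuousP => a.
have op y : open ([set s | a < - phi y s] : set (weak_topology F)).
  have Fy := cphi.1 y.
  have cw : continuous (phi y : weak_topology F -> R^o).
    apply: (@weak_continuous_dual R S F (weak_topology F) id) => // z A hA; exact: hA.
  rewrite (_ : [set _ | _] = phi y @^-1` [set r | r < - a]); last first.
    by apply/seteqP; split=> s /=; rewrite ltrNr.
  by move/continuousP : cw; apply; exact: open_lt.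
rewrite (_ : [set _ | _] = \bigcup_(y in [set: Y]) [set s | a < - phi y s]).
  by apply: bigcup_open => y _; exact: op.
apply/seteqP; split=> s /=; rewrite lte_fin.
  have hs : has_sup [set - phi y s | y in [set: Y]].
    by split=> //; exists (- phi point s); exists point.
  move=> /(sup_gt hs.1)[_ [y _ <-] ay]; by exists y.
by move=> [y _ /= ay]; exact: lt_le_trans ay (le_g s y).
Qed.

(** The integral of [- phi y (k y)] is at most that of [g (k y)], hence that of [g (h x)], hence
    that of [psi x (h x)]. The last step is the sign hypothesis, which bounds [- phi y (h x)] by
    [psi x (h x)] for every [y]. *)
Lemma convex_domination_nonneg_pairing : convex_domination F mu nu -> nonneg_pairing F mu nu.
Proof.
move=> dom psi phi cpsi cphi pos.
have cg := sup_dual_convex_wlsc cphi.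
have [C C0 phiC] := continuous_into_bound Fsub cY cphi.
have hub s : has_ubound [set - phi y s | y in [set: Y]].
  exists (C * `|s|) => _ [y _ <-]; apply: le_trans (phiC y s).
  by rewrite -normrN ler_norm.
have cphiN : continuous_into F (fun y s => -1 * phi y s).
  by apply: (continuous_intoM Fsub (c := cst (-1))) => // y; exact: cvg_cst.
have : (sv_pairing nu (fun y s => -1 * phi y s)%R <= sv_pairing mu psi)%E.
  apply: le_trans (le_trans (dom _ cg) _).
    apply: ae_le_lower_integral; apply: filterE => y; rewrite lee_fin mulN1r.
    by apply: ub_le_sup => //; exists y.
  apply: ae_le_lower_integral; apply: filterE => x; rewrite lee_fin.
  apply: ge_sup; first by exists (- phi point (density mu x)); exists point.
  by move=> _ [y _ <-]; have := pos x y; lra.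
rewrite -(fineK (sv_pairing_fin_num mu Fsub cX cpsi)).
rewrite -(fineK (sv_pairing_fin_num nu Fsub cY cphiN)) lee_fin.
by rewrite (fine_sv_pairingZ nu Fsub cY)// mulN1r; lra.
Qed.

Lemma plans_nonneg_pairing : plans F mu nu !=set0 -> nonneg_pairing F mu nu.
Proof.
move=> [pi hpi] psi phi cpsi cphi pos.
rewrite -fineD ?(sv_pairing_fin_num _ Fsub)// -(hpi _ _ cpsi cphi).
by apply/fine_ge0/integral_ge0 => z _; rewrite lee_fin.
Qed.

End to_nonneg_pairing.

(** A finite subcover by interiors is turned into a measurable choice of centres: the first set in
    the list that contains [y] decides. *)
Lemma compact_fin_meas_selection (R : realType) (Y : pmetricType R) (U : Y -> set Y) :
  compact [set: Y] -> (forall y, nbhs y (U y)) ->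
  exists2 j : borel Y -> Y, fin_meas j & forall y, U (j y) y.
Proof.
rewrite compact_cover => cY nU.
have [|y _|D _ cD] := cY Y setT (fun y => (U y)°).
- by move=> y _; exact: open_interior.
- by exists y => //; apply: nbhs_singleton; exact: nbhs_interior.
suff [j fj hj] : exists2 j : borel Y -> Y, fin_meas j &
    forall y, (exists2 i, i \in enum_fset D & (U i)° y) -> (U (j y))° y.
  exists j => // y; apply: interior_subset; apply: hj.
  by have [i iD Uiy] := cD y Logic.I; exists i.
elim: (enum_fset D) => [|a s [j fj hj]].
  by exists (cst point); [exact: fin_meas_cst|move=> y []].
pose O : set Y := (U a)°.
exists (fun y : Y => if y \in O then a else j y).
  apply: fin_meas_if => //; last exact: fin_meas_cst.
  apply: (measurable_fun_bool true); rewrite setTI (_ : _ @^-1` _ = O).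
    by apply: sub_sigma_algebra; exact: open_interior.
  by apply/seteqP; split=> y /=; [exact: set_mem|exact: mem_set].
move=> y [i]; rewrite inE; case: ifPn => [/set_mem//|yUa] /orP[/eqP ->|is_ Uiy].
  by move/mem_set; rewrite (negbTE yUa).
by apply: hj; exists i.
Qed.

Section kernel_fine.
Context d d' (X : measurableType d) (Y : measurableType d') (R : realType).
Context (P : R.-pker X ~> Y).

Lemma kernel_le1 B x : measurable B -> (P x B <= 1)%E.
Proof.
move=> mB.
have := @le_measure _ _ _ (P x) B setT (mem_set mB) (mem_set measurableT) (@subsetT _ _).
by move=> /le_trans; apply; rewrite le_eqVlt; apply/orP; left; apply/eqP; exact: prob_kernel.
Qed.

Lemma kernel_fin_num B x : measurable B -> P x B \is a fin_num.
Proof. by move=> mB; rewrite ge0_fin_numE//; exact: le_lt_trans (kernel_le1 x mB) (ltry _). Qed.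

Lemma kernel_fine_bound B x : measurable B -> 0 <= fine (P x B) <= 1.
Proof.
by move=> mB; rewrite fine_ge0//= -lee_fin fineK ?kernel_fin_num//; exact: kernel_le1.
Qed.

Lemma kernel_fine_norm B : measurable B -> forall x, `|fine (P x B)| <= 1.
Proof. by move=> mB x; have /andP[p0 p1] := kernel_fine_bound x mB; rewrite ger0_norm. Qed.

Lemma measurable_kernel_fine B : measurable B -> measurable_fun setT (fun x => fine (P x B)).
Proof.
by move=> mB; apply: (measurableT_comp (@fine_measurable R setT measurableT));
  exact: measurable_kernel.
Qed.

Lemma kernel_fin_meas_sum (W : choiceType) (j : Y -> W) (x : X) : fin_meas j ->
  \sum_(c <- fset_set (range j)) fine (P x (j @^-1` [set c])) = 1.
Proof.
move=> fj; have P1 : P x setT = 1%E by exact: prob_kernel.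
have [|q qE] := @finite_measure_copy _ _ _ (P x); first by rewrite P1 ltry.
rewrite -qE; have := Rintegral_fin_meas q (fun=> 1) fj.
have -> : \int[q]_x (cst 1 x) = 1 * fine (q setT) by exact: Rintegral_cst.
have -> : q setT = 1%E by rewrite -P1 -qE.
rewrite /= mulr1 => ->; apply: eq_bigr => c _; by rewrite mulr1.
Qed.

End kernel_fine.

Lemma indic_norm (R : numDomainType) (T : Type) (A : set T) x : `|\1_A x : R| <= 1.
Proof. by rewrite ger0_norm ?indicE ?lern1 ?ler0n ?leq_b1. Qed.

Section transport_nonneg_pairing.
Context (R : realType) (X Y : pmetricType R) (S : completeNormedModType R)
  (F : set (S -> R^o)) (mu : svmeasure (borel X) S) (nu : svmeasure (borel Y) S).
Context (P : R.-pker (borel X) ~> (borel Y)).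

Lemma kernel_transport_dual (l : S -> R^o) (B : set (borel Y)) : measurable B ->
  topological_dual l -> sv_kpush P mu B = sv_eval nu B ->
  \int[tv mu]_x (fine (P x B) * l (density mu x)) =
  \int[tv nu]_y (\1_B y * l (density nu y)).
Proof.
move=> mB dl; rewrite /sv_kpush /sv_eval => /(congr1 l).
by rewrite (sv_integral_dual mu (measurable_kernel_fine P mB) (kernel_fine_norm P mB) dl)
  (sv_integral_dual nu (measurable_indic mB) (indic_norm R B) dl).
Qed.

(** [P mu = nu] can be tested only against one functional on one Borel set, so [phi y] is frozen to
    [phi (j y)]. On the fibre [A c] of [j], the pairing with [nu] becomes the integral over [X] of
    [P x (A c) * phi c (h x)]. *)
Lemma kernel_transport_nonneg_pairing :
  compact [set: X] -> compact [set: Y] -> dual_subspace F ->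
  [bounded density mu x | x in [set: X]] ->
  continuous (density mu : X -> weak_topology F) ->
  (forall B, measurable B -> sv_kpush P mu B = sv_eval nu B) -> nonneg_pairing F mu nu.
Proof.
move=> cX cY Fsub hb hc kt psi phi cpsi cphi pos.
pose h := density mu; pose k := density nu.
have [M hM] : exists M, forall x, `|h x| <= M.
  by have [M [_ /(_ (M + 1))]] := hb; rewrite ltrDl ltr01 => /(_ isT) hM; exists (M + 1) => x; exact: hM.
have ceval (f : X -> S -> R^o) : continuous_into F f -> continuous (fun x => f x (h x) : R^o).
  move=> cf; apply: (continuous_into_eval Fsub cf _ hM (weak_continuous_dual hc)).
  by move=> x A hA; exact: hA.
have mk : strongly_measurable (tv nu) k by have [] := density_integrable nu.
have [k' sk' kk'] := (strongly_measurableP (tv nu) k).1 mk.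
have kint : (norm_int (tv nu) k' < +oo)%E.
  by rewrite -(eq_norm_int kk'); have [] := (bochner_integrableP (tv nu) k).1 (density_integrable nu).
have ink : (tv nu).-integrable setT (EFin \o (fun y => `|k' y|)).
  apply/integrableP; split; first exact/measurable_EFinP/simple_limit_norm.
  by under eq_integral do rewrite /= normr_id.
have ibound (w : borel Y -> R) (C : R) : measurable_fun setT w -> (forall y, `|w y| <= C * `|k' y|) ->
    (tv nu).-integrable setT (EFin \o w).
  move=> mw wC; apply: (@le_integrable _ _ _ _ _ measurableT _ (EFin \o (fun y => C * `|k' y|))).
  - exact/measurable_EFinP.
  - by move=> y _; rewrite lee_fin; apply: le_trans (wC _) _; rewrite ler_norm.
  - rewrite (_ : EFin \o _ = fun x => (C%:E * (EFin \o (fun x => `|k' x|)%R) x)%E).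
      exact: integrableZl.
    by apply/funext => x; rewrite /= EFinM.
have [w [iw pw ->]] := sv_pairing_integrable nu Fsub cY cphi.
rewrite /=.
apply/ler_addgt0Pr => e e0; rewrite addrC.
have K0 : 0 <= fine (norm_int (tv nu) k') by apply/fine_ge0/norm_int_ge0.
(* Freezing [phi] within [e'] costs at most [e'] times the L1 norm of the density of [nu], hence at
   most [e]. *)
pose e' := e / (1 + fine (norm_int (tv nu) k')).
have e'0 : 0 < e' by rewrite divr_gt0// ltr_pwDl.
have [j fj hj] : exists2 j : borel Y -> Y, fin_meas j &
    forall y s, `|phi y s - phi (j y) s| <= e' * `|s|.
  have /(continuous_intoP Fsub)[_ near_phi] := cphi.
  exact: (compact_fin_meas_selection (U := fun y => [set y' | forall s, `|phi y' s - phi y s| <= e' * `|s|])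
    cY (fun y => near_phi y _ e'0)).
pose A c := j @^-1` [set c].
have mA c : measurable (A c) by exact: fj.2.
pose r := fset_set (range j).
have dphi c : topological_dual (phi c) := dual_subspace_dual Fsub (cphi.1 c).
pose g c y := \1_(A c) y * phi c (k' y).
have mphik c : measurable_fun setT (fun y => phi c (k' y)).
  by have [_ cl] := dphi c; exact: (simple_limit_measurable (phi := phi c) cl sk').
have [C C0 phiC] := continuous_into_bound Fsub cY cphi.
have ig c : (tv nu).-integrable setT (EFin \o g c).
  apply: (ibound _ C); first by apply: measurable_funM => //; exact: measurable_indic.
  move=> y; rewrite /g normrM; apply: le_trans (phiC c (k' y)).
  by rewrite ler_piMl// indic_norm.
have gE y : phi (j y) (k' y) = \sum_(c <- r) g c y.
  have yr : j y \in r.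
    by rewrite /r in_fset_set//; [apply: mem_set; exists y|exact: fj.1].
  rewrite (big_fsetD1 (j y))//= [X in _ + X]big1_fset ?addr0.
    by rewrite /g indicE mem_set// mul1r.
  move=> c; rewrite !inE => /andP[cj _] _; rewrite /g indicE memNset ?mul0r//.
  by rewrite /A /= => E; move: cj; rewrite E eqxx.
pose G c := \int[tv nu]_y g c y.
have [ij sumG] := Rintegral_sum r ig.
rewrite -(funext gE) in ij sumG.
pose N := fine (norm_int (tv nu) k').
have ieN : (tv nu).-integrable setT (EFin \o (fun y => e' * `|k' y|)).
  apply: (ibound _ e') => [|y]; first by apply: measurable_funM => //; exact: simple_limit_norm.
  by rewrite ger0_norm// mulr_ge0// ltW.
have low : \sum_(c <- r) G c - e' * N <= \int[tv nu]_y w y.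
  rewrite -sumG -[N]/(\int[tv nu]_y `|k' y|) -RintegralZl// -RintegralB//.
  apply: ae_le_Rintegral => //.
    rewrite (_ : _ \o _ = (EFin \o (fun y => phi (j y) (k' y))) \-
      (EFin \o (fun y => e' * `|k' y|)%R))%E; first exact: integrableB.
    by apply/funext => y; rewrite /= EFinB.
  apply: (ae_imp2 pw kk') => y <- kE; rewrite -/k kE.
  by have := hj y (k' y); rewrite ler_norml => /andP[]; lra.
pose p c x := fine (P x (A c)).
have mp c : measurable_fun setT (p c) by exact: measurable_kernel_fine.
pose q c x := p c x * phi c (h x).
have GE c : G c = \int[tv mu]_x q c x.
  rewrite /q (kernel_transport_dual (mA c) (dphi c) (kt _ (mA c))).
  congr fine; apply: ae_eq_lower_integral.
  by apply: (ae_imp kk') => y; rewrite -/k /g => ->.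
have bmu (f : X -> R^o) : continuous f -> (tv mu).-integrable setT (EFin \o (f : borel X -> R)).
  move=> cf; apply: norm_bounded_integrable; first exact: continuous_borel_measurable.
  exact: compact_norm_bounded.
have ipsi := bmu _ (ceval _ cpsi).
have iq c : (tv mu).-integrable setT (EFin \o (q c)).
  have cpc := ceval _ (@continuous_into_cst _ _ _ Fsub X _ (cphi.1 c)).
  have [B hB] := compact_norm_bounded cX cpc.
  apply: norm_bounded_integrable.
    by apply: measurable_funM => //; exact: (continuous_borel_measurable cpc).
  exists B => x; have /andP[p0 p1] := kernel_fine_bound P x (mA c).
  rewrite normrM; apply: le_trans (hB x); rewrite ler_piMl// ger0_norm//.
have [isum Esum] := Rintegral_sum r iq.
have sumq : \sum_(c <- r) G c = \int[tv mu]_x (\sum_(c <- r) q c x).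
  by rewrite Esum; apply: eq_bigr => c _; exact: GE.
have pos' : 0 <= fine (sv_pairing mu psi) + \sum_(c <- r) G c.
  rewrite sumq -[fine _]/(\int[tv mu]_x psi x (h x)) -RintegralD//.
  apply: Rintegral_ge0 => x _.
  (* The weights [P x (A c)] add up to 1. Distributing [psi x (h x)] over them leaves a sum of
     weights times [psi x (h x) + phi c (h x)], each term being nonnegative. *)
  have -> : psi x (h x) = \sum_(c <- r) p c x * psi x (h x).
    by rewrite -mulr_suml (kernel_fin_meas_sum P x fj) mul1r.
  rewrite -big_split sumr_ge0// => c _ /=; rewrite /q -mulrDr mulr_ge0//; last exact: pos.
  by have /andP[] := kernel_fine_bound P x (mA c).
have e'N : e' * N <= e.
  rewrite /e' mulrAC ler_pdivrMr ?ltr_pwDl//; apply: ler_wpM2l; first exact: ltW.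
  by rewrite lerDr.
by lra.
Qed.

Lemma kernel_transport_separated : separates_points F -> dual_subspace F ->
  (forall l B, F l -> measurable B ->
    \int[tv mu]_x (fine (P x B) * l (density mu x)) =
    \int[tv nu]_y (\1_B y * l (density nu y))) ->
  forall B, measurable B -> sv_kpush P mu B = sv_eval nu B.
Proof.
move=> Fsep Fsub h B mB; apply: contrapT => /Fsep[l Fl]; apply.
have dl := dual_subspace_dual Fsub Fl.
rewrite /sv_kpush /sv_eval.
rewrite (sv_integral_dual mu (measurable_kernel_fine P mB) (kernel_fine_norm P mB) dl)
  (sv_integral_dual nu (measurable_indic mB) (indic_norm R B) dl).
exact: h.
Qed.

End transport_nonneg_pairing.

(** * The coupling *)

Lemma pushforward_finite_measure d1 d2 (T1 : measurableType d1) (T2 : measurableType d2)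
    (R : realType) (M : {finite_measure set T1 -> \bar R}) (f : T1 -> T2) :
  measurable_fun setT f ->
  exists N : {finite_measure set T2 -> \bar R}, (forall A, N A = M (f @^-1` A)) /\
    forall g : T2 -> R, measurable_fun setT g -> M.-integrable setT (EFin \o (g \o f)) ->
    \int[N]_y g y = \int[M]_x g (f x).
Proof.
move=> mf; pose push : {measure set T2 -> \bar R} :=
  measure_function_pushforward__canonical__measure_function_Measure M mf.
have [|N NE] := @finite_measure_of _ _ R push.
  rewrite -[X in (X < _)%E]/(M (f @^-1` setT)) preimage_setT.
  by rewrite -ge0_fin_numE// fin_num_measure.
exists N; split=> [A|g mg ig]; first by rewrite NE.
rewrite /Rintegral; congr fine.
rewrite (eq_measure_integral push) => [|A _ _]; last exact: NE.
by rewrite integral_pushforward//; exact/measurable_EFinP.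
Qed.

Section bounded_weights.
Context d1 d2 d (T1 : measurableType d1) (T2 : measurableType d2) (Z : measurableType d)
  (R : realType).
Context (m1 : {measure set T1 -> \bar R}) (m2 : {measure set T2 -> \bar R}).
Context (b1 : T1 -> Z) (b2 : T2 -> Z) (w1 : T1 -> R) (w2 : T2 -> R).
Context (mb1 : measurable_fun setT b1) (mb2 : measurable_fun setT b2).
Context (iw1 : m1.-integrable setT (EFin \o w1)) (iw2 : m2.-integrable setT (EFin \o w2)).

(** Simple functions by linearity, then dominated convergence. It will serve with the weight [P x B]
    on [X] and the indicator of [B] at [b k] on the Cantor space, to pass from rectangles to the
    test function [l \o h]. *)
Lemma Rintegral_bounded_weights :
  (forall A, measurable A ->
    \int[m1]_x (\1_A (b1 x) * w1 x) = \int[m2]_x (\1_A (b2 x) * w2 x)) ->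
  forall (g : Z -> R) (C : R), measurable_fun setT g -> (forall z, `|g z| <= C) ->
    \int[m1]_x (g (b1 x) * w1 x) = \int[m2]_x (g (b2 x) * w2 x).
Proof.
move=> hA g C mg gC.
have simple (t : Z -> R) : fin_meas t ->
    \int[m1]_x (t (b1 x) * w1 x) = \int[m2]_x (t (b2 x) * w2 x).
  move=> ft; pose r := fset_set (range t); pose A c := t @^-1` [set c].
  have mA c : measurable (A c) by exact: ft.2.
  have tE z : t z = \sum_(c <- r) c * \1_(A c) z.
    have zr : t z \in r by rewrite in_fset_set//; [apply: mem_set; exists z|exact: ft.1].
    rewrite (big_fsetD1 (t z))//= big1_fset ?addr0; first by rewrite indicE mem_set// mulr1.
    move=> c; rewrite !inE => /andP[ct _] _; rewrite indicE memNset ?mulr0// /A /= => E.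
    by rewrite E eqxx in ct.
  have int_simple d' (T' : measurableType d') (m : {measure set T' -> \bar R}) (b : T' -> Z) (w : T' -> R) :
      measurable_fun setT b -> m.-integrable setT (EFin \o w) ->
      \int[m]_x (t (b x) * w x) = \sum_(c <- r) c * \int[m]_x (\1_(A c) (b x) * w x).
    move=> mb iw.
    have i1 c : m.-integrable setT (EFin \o (fun x => \1_(A c) (b x) * w x)).
      apply: (weighted_integrable mb iw (C := 1)); first exact: measurable_indic.
      by move=> z; exact: indic_norm.
    under eq_Rintegral do rewrite tE mulr_suml.
    have i2 c : m.-integrable setT (EFin \o (fun x => c * \1_(A c) (b x) * w x)).
      rewrite (_ : _ \o _ = fun x => (c%:E * (EFin \o (fun x => \1_(A c) (b x) * w x)%R) x)%E).
        exact: integrableZl.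
      by apply/funext => x; rewrite /= -EFinM mulrA.
    rewrite (Rintegral_sum r i2).2; apply: eq_bigr => c _.
    by rewrite -RintegralZl//; apply: eq_Rintegral => x _; rewrite mulrA.
  rewrite (int_simple _ _ _ _ _ mb1 iw1) (int_simple _ _ _ _ _ mb2 iw2).
  by apply: eq_bigr => c _; rewrite hA.
have [s fs sg] := measurable_simple_limit mg.
have C0 : 0 <= C by apply: le_trans (gC point).
(* Clipping at the bound of [g] leaves the limit unchanged and gives all approximations the same
   bound. *)
pose t n z := Num.max (- C) (Num.min C (s n z)).
have ft n : fin_meas (t n) by exact: (fin_meas_comp (fun c : R => Num.max (- C) (Num.min C c)) (fs n)).
have tC n z : `|t n z| <= C.
  by rewrite ler_norml /t le_max lexx ge_max ge_min lexx /= andbT; lra.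
have tg z : t n z @[n --> \oo] --> g z.
  have -> : g z = Num.max (- C) (Num.min C (g z)).
    have := gC z; rewrite ler_norml => /andP[h1 h2].
    by rewrite (min_r h2) (max_r h1).
  apply: (@cvg_comp _ _ _ (s ^~ z) (fun c : R^o => Num.max (- C) (Num.min C c) : R^o)); first exact: sg.
  apply: (@continuous_max _ _ (cst (- C)) (fun c : R => Num.min C c)); first exact: cvg_cst.
  by apply: (@continuous_min _ _ (cst C) id); [exact: cvg_cst|exact: cvg_id].
have mt n : measurable_fun setT (t n).
  by move=> _ B mB; rewrite setTI; exact: (fin_meas_preimage B (ft n)).
have h1 := weighted_Rintegral_cvg mb1 iw1 mt tC tg.
have h2 := weighted_Rintegral_cvg mb2 iw2 mt tC tg.
have E : (fun n => \int[m1]_x (t n (b1 x) * w1 x)) = (fun n => \int[m2]_x (t n (b2 x) * w2 x)).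
  by apply/funext => n; exact: simple.
by rewrite E in h1; exact: cvg_unique h1 h2.
Qed.

End bounded_weights.

Section product_cover.
Context (R : realType) (X Y : pmetricType R).

Lemma metric_prod_hausdorff : hausdorff_space (X * Y)%type.
Proof.
move=> [p1 p2] [q1 q2] clpq; congr pair; apply: metric_hausdorff => A B hA hB.
  have nA : nbhs (p1, p2) (fst @^-1` A : set (X * Y)) by exact: (@cvg_fst _ _ (nbhs p1) (nbhs p2)).
  have nB : nbhs (q1, q2) (fst @^-1` B : set (X * Y)) by exact: (@cvg_fst _ _ (nbhs q1) (nbhs q2)).
  by have [z [zA zB]] := clpq _ _ nA nB; exists z.1.
have nA : nbhs (p1, p2) (snd @^-1` A : set (X * Y)) by exact: (@cvg_snd _ _ (nbhs p1) (nbhs p2)).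
have nB : nbhs (q1, q2) (snd @^-1` B : set (X * Y)) by exact: (@cvg_snd _ _ (nbhs q1) (nbhs q2)).
by have [z [zA zB]] := clpq _ _ nA nB; exists z.2.
Qed.

HB.saturate prod.

(** The Alexandroff-Hausdorff theorem for the product itself, so that one map provides both
    coordinates. *)
Lemma cantor_surj_prod : compact [set: X] -> compact [set: Y] ->
  exists p : cantor_space -> X * Y, continuous p /\ forall z, exists k, p k = z.
Proof.
move=> cX cY.
have cXY : compact [set: X * Y] by rewrite -setXTT; exact: compact_setX.
have [p cp] := @cantor_surj R (X * Y)%type cXY metric_prod_hausdorff.
exists p; split=> // z; have [k _ kz] := @surj _ _ _ _ p z Logic.I.
by exists k.
Qed.

End product_cover.

Section coupling.
Context (R : realType) (X Y : pmetricType R) (S : completeNormedModType R)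
  (F : set (S -> R^o)) (mu : svmeasure (borel X) S) (nu : svmeasure (borel Y) S).
Context (cX : compact [set: X]) (cY : compact [set: Y])
  (Fsub : dual_subspace F) (Fsep : separates_points F)
  (mu_bounded : [bounded density mu x | x in [set: X]])
  (mu_continuous : continuous (density mu : X -> weak_topology F)).
Context (f : X -> S -> R^o) (cf : continuous_into F f)
  (f1 : forall x, f x (density mu x) = 1).
Context (pos : nonneg_pairing F mu nu).

Let h : X -> S := density mu.

Let continuous_eval (Z Z' : topologicalType) (a : Z -> X) (b : Z -> Z') (phi : Z' -> S -> R^o) :
  continuous a -> continuous b -> continuous_into F phi ->
  continuous (fun z => phi (b z) (h (a z)) : R^o).
Proof.
move=> ca cb cphi.
have [C hC] : exists C, forall x, `|h x| <= C.
  have [C [_ /(_ (C + 1))]] := mu_bounded; rewrite ltrDl ltr01 => /(_ isT) hC.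
  by exists (C + 1) => x; exact: hC.
apply: (continuous_into_eval Fsub cphi cb (fun z => hC (a z))) => l Fl.
have cl := weak_continuous_dual mu_continuous Fl.
by move=> z; apply: (@continuous_comp _ _ _ a (l \o h)); [exact: ca|exact: cl].
Qed.

Let zero_into (Z : topologicalType) : continuous_into F (fun _ : Z => (fun=> 0) : S -> R^o).
Proof. by apply: continuous_into_cst => //; have [_ F0 _] := Fsub. Qed.

(** [G] is a relation: one function on the Cantor space may come from many pairs of [psi] and [phi].
    That these give the same value is a consequence of positivity and needs no separate argument. *)
Lemma coupling_exists : exists (p : cantor_space -> X * Y)
    (M : {finite_measure set (borel cantor_space) -> \bar R}), continuous p /\
  forall (psi : X -> S -> R^o) (phi : Y -> S -> R^o),
    continuous_into F psi -> continuous_into F phi ->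
    \int[M]_k (psi (p k).1 (h (p k).1) + phi (p k).2 (h (p k).1)) =
      fine (sv_pairing mu psi) + fine (sv_pairing nu phi).
Proof.
have [p [cp sp]] := cantor_surj_prod cX cY.
have c1 : continuous (fst \o p) by move=> k; apply: continuous_comp; [exact: cp|exact: cvg_fst].
have c2 : continuous (snd \o p) by move=> k; apply: continuous_comp; [exact: cp|exact: cvg_snd].
pose G : set ((cantor_space -> R^o) * R) := [set fa | exists psi phi,
  [/\ continuous_into F psi, continuous_into F phi,
    fa.1 = (fun k => psi (p k).1 (h (p k).1) + phi (p k).2 (h (p k).1)) &
    fa.2 = fine (sv_pairing mu psi) + fine (sv_pairing nu phi)]].
have [g a [psi [phi [cpsi cphi /= -> _]]]|g a g' a' [psi [phi [cpsi cphi /= -> ->]]] [psi' [phi' [cpsi' cphi' /= -> ->]]]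
  |c g a [psi [phi [cpsi cphi /= -> ->]]]|g a [psi [phi [cpsi cphi /= -> ->]]] g0| |M hM] := @cantor_riesz R G.
- by move=> k; apply: cvgD; [exact: (continuous_eval c1 c1 cpsi)|exact: (continuous_eval c1 c2 cphi)].
- exists (fun x s => psi x s + psi' x s), (fun y s => phi y s + phi' y s); split=> /=.
  + exact: continuous_intoD.
  + exact: continuous_intoD.
  + by apply/funext => k /=; rewrite addrACA.
  + by rewrite (fine_sv_pairingD mu Fsub cX)// (fine_sv_pairingD nu Fsub cY)// addrACA.
- exists (fun x s => c * psi x s), (fun y s => c * phi y s); split=> /=.
  + by apply: (continuous_intoM Fsub (c := cst c)) => // y; exact: cvg_cst.
  + by apply: (continuous_intoM Fsub (c := cst c)) => // y; exact: cvg_cst.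
  + by apply/funext => k /=; rewrite -[LHS]/(c * _) mulrDr.
  + by rewrite (fine_sv_pairingZ mu Fsub cX)// (fine_sv_pairingZ nu Fsub cY)// mulrDr.
(* Surjectivity of [p] turns a sign on the Cantor space into a sign at every pair of points. *)
- apply: pos => // x y; have [k pk] := sp (x, y).
  by have := g0 k; rewrite /= pk.
- exists (fine (sv_pairing mu f) + fine (sv_pairing nu (fun=> (fun=> 0)))).
  exists f, (fun=> (fun=> 0)); split=> //.
  by apply/funext => k /=; rewrite f1 addr0.
exists p, M; split=> // psi phi cpsi cphi.
by apply: hM; exists psi, phi.
Qed.

Section given_coupling.
Context (p : cantor_space -> X * Y) (M : {finite_measure set (borel cantor_space) -> \bar R}).
Context (cp : continuous p).
Context (hM : forall (psi : X -> S -> R^o) (phi : Y -> S -> R^o),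
    continuous_into F psi -> continuous_into F phi ->
    \int[M]_k (psi (p k).1 (h (p k).1) + phi (p k).2 (h (p k).1)) =
      fine (sv_pairing mu psi) + fine (sv_pairing nu phi)).

Let a : borel cantor_space -> borel X := fst \o p.
Let b : borel cantor_space -> borel Y := snd \o p.

Let ca : continuous (a : cantor_space -> X).
Proof. by move=> k; apply: continuous_comp; [exact: cp|exact: cvg_fst]. Qed.

Let cb : continuous (b : cantor_space -> Y).
Proof. by move=> k; apply: continuous_comp; [exact: cp|exact: cvg_snd]. Qed.

Let ma : measurable_fun setT a. Proof. exact: continuous_borel_measurable2. Qed.
Let mb : measurable_fun setT b. Proof. exact: continuous_borel_measurable2. Qed.

Let integrable_continuous (g : cantor_space -> R^o) : continuous g ->
  M.-integrable setT (EFin \o (g : borel cantor_space -> R)).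
Proof.
move=> cg; apply: norm_bounded_integrable; first exact: continuous_borel_measurable.
exact: (compact_norm_bounded (@cantor_space_compact)).
Qed.

Lemma sv_pairing0 (Z : pmetricType R) (ka : svmeasure (borel Z) S) :
  fine (sv_pairing ka (fun=> (fun=> 0))) = 0.
Proof. by rewrite /sv_pairing integral0. Qed.

(** Testing with [psi = c * f], where [f x (h x) = 1], gives equality of the integrals of every
    continuous [c]. *)
Lemma coupling_fst (A : set (borel X)) : measurable A -> M (a @^-1` A) = tv mu A.
Proof.
move=> mA; have i1 : M.-integrable setT (EFin \o cst 1) by exact: finite_measure_integrable_cst.
have i2 : (tv mu).-integrable setT (EFin \o cst 1) by exact: finite_measure_integrable_cst.
have mid : measurable_fun setT (id : borel X -> borel X) by exact: measurable_id.
have := borel_Rintegral_unique ma mid i1 i2.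
have hc (c : X -> R) : continuous c -> (forall y, 0 <= c y <= 1) ->
    \int[M]_x (c (a x) * cst 1 x) = \int[tv mu]_x (c (id x) * cst 1 x).
  move=> cc _; have := hM (continuous_intoM Fsub cc cf) (zero_into Y).
  rewrite sv_pairing0 addr0; under eq_Rintegral do rewrite f1 addr0.
  move=> ->; congr fine; apply: eq_integral => x _.
  by rewrite f1.
move=> /(_ hc A mA).
have mpre : measurable (a @^-1` A) by rewrite -[_ @^-1` _]setTI; exact: ma.
rewrite /Rintegral => E.
have E1 : (\int[M]_x (\1_A (a x) * cst 1 x)%:E = M (a @^-1` A))%E.
  rewrite -[RHS]mul1e -(integral_cst M mpre) integral_mkcond; apply: eq_integral => x _.
  rewrite /patch mulr1 indicE.
  have [xA|xA] := boolP (a x \in A).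
    by rewrite mem_set//; exact: set_mem xA.
  by rewrite memNset//= => Ax; move/negP : xA; apply; exact: mem_set.
have E2 : (\int[tv mu]_x (\1_A (id x) * cst 1 x)%:E = tv mu A)%E.
  rewrite -[RHS]mul1e -(integral_cst (tv mu) mA) integral_mkcond; apply: eq_integral => x _.
  by rewrite /patch mulr1 indicE; case: ifPn.
move: E; rewrite E1 E2 => E.
by rewrite -[LHS]fineK ?fin_num_measure// E fineK// fin_num_measure.
Qed.

(** Testing with [phi = c * l] gives the second variable only under the weight [l (h x)]. This is
    the identity [P mu = nu] seen through [l], and not yet the second marginal. *)
Lemma coupling_snd (l : S -> R^o) (B : set (borel Y)) : F l -> measurable B ->
  \int[M]_k (\1_B (b k) * l (h (a k))) = \int[tv nu]_y (\1_B y * l (density nu y)).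
Proof.
move=> Fl mB; have cl : continuous_into F (fun _ : Y => l) by exact: continuous_into_cst.
have [w [iw pw _]] := sv_pairing_integrable nu Fsub cY cl.
have i1 : M.-integrable setT (EFin \o (fun k => l (h (a k)))).
  apply: integrable_continuous; exact: (continuous_eval ca cb cl).
have mid : measurable_fun setT (id : borel Y -> borel Y) by exact: measurable_id.
have := borel_Rintegral_unique mb mid i1 iw.
have kw (c : borel Y -> R) : \int[tv nu]_y (c y * l (density nu y)) = \int[tv nu]_y (c y * w y).
  by congr fine; apply: ae_eq_lower_integral; apply: (ae_imp pw) => y ->.
have hc (c : Y -> R) : continuous c -> (forall y, 0 <= c y <= 1) ->
    \int[M]_k (c (b k) * l (h (a k))) = \int[tv nu]_y (c (id y) * w y).
  move=> cc _; rewrite -kw; have := hM (zero_into X) (continuous_intoM Fsub cc cl).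
  by rewrite sv_pairing0 add0r; under eq_Rintegral do rewrite add0r.
by move=> /(_ hc B mB) ->; rewrite kw.
Qed.

Lemma coupling_plan : plans F mu nu !=set0.
Proof.
have mp : measurable_fun setT (p : borel cantor_space -> borel (X * Y)).
  exact: continuous_borel_measurable2.
have [pi [_ piE]] := pushforward_finite_measure M mp.
exists pi => psi phi cpsi cphi.
pose g (z : X * Y) : R^o := psi z.1 (h z.1) + phi z.2 (h z.1).
have cg : continuous g.
  have k1 : continuous (fst : X * Y -> X) by move=> z; exact: cvg_fst.
  have k2 : continuous (snd : X * Y -> Y) by move=> z; exact: cvg_snd.
  by move=> z; apply: cvgD; [exact: (continuous_eval k1 k1 cpsi)|exact: (continuous_eval k1 k2 cphi)].
have mg : measurable_fun setT (g : borel (X * Y) -> R) by exact: continuous_borel_measurable.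
have ig : M.-integrable setT (EFin \o (g \o p)).
  by apply: integrable_continuous => k; apply: continuous_comp; [exact: cp|exact: cg].
have := piE g mg ig; have := hM cpsi cphi; rewrite /g => -> E.
have gpi : pi.-integrable setT (EFin \o (g : borel (X * Y) -> R)).
  have [C hC] : exists C, forall z, `|g z| <= C.
    have cXY : compact [set: X * Y] by rewrite -setXTT; exact: compact_setX.
    exact: compact_norm_bounded.
  by apply: norm_bounded_integrable => //; exists C.
rewrite -(fineK (sv_pairing_fin_num mu Fsub cX cpsi)) -(fineK (sv_pairing_fin_num nu Fsub cY cphi)).
by rewrite -EFinD -E /Rintegral fineK//; exact: integrable_fin_num.
Qed.

End given_coupling.

End coupling.

(** * Conditional kernels of the coupling *)

Lemma cantor_conditional_kernel dX dY (X : measurableType dX) (Y : measurableType dY)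
    (R : realType) (m : {finite_measure set X -> \bar R})
    (M : {finite_measure set (borel cantor_space) -> \bar R})
    (a : borel cantor_space -> X) (b : borel cantor_space -> Y) :
  measurable_fun setT a -> measurable_fun setT b ->
  (forall A, measurable A -> M (a @^-1` A) = m A) ->
  exists P : R.-pker X ~> Y, forall A B, measurable A -> measurable B ->
    (\int[m]_(x in A) P x B)%E = M (a @^-1` A `&` b @^-1` B).
Proof.
move=> ma mb aM; have [P0 hP0] := cantor_disintegration ma aM.
have mpre B : measurable B -> measurable (b @^-1` B).
  by move=> mB; rewrite -[_ @^-1` _]setTI; exact: mb.
(* The conditional measures live on the Cantor space; their images under [b] form a kernel into
   [Y]. *)
pose push x : {measure set Y -> \bar R} :=
  measure_function_pushforward__canonical__measure_function_Measure (P0 x) mb.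
have [|x|P PE] := @prob_kernel_of _ _ X Y R push.
- by move=> U mU; exact: (measurable_kernel P0 _ (mpre _ mU)).
- by rewrite -[LHS]/(P0 x (b @^-1` setT)) preimage_setT; exact: prob_kernel.
exists P => A B mA mB; rewrite -hP0//; last exact: mpre.
by apply: eq_integral => x _; rewrite PE.
Qed.

Section kernel_indic.
Context d d' (X : measurableType d) (Y : measurableType d') (R : realType).
Context (m : {finite_measure set X -> \bar R}) (P : R.-pker X ~> Y).

Lemma kernel_indic_Rintegral A B : measurable A -> measurable B ->
  \int[m]_x (\1_A x * fine (P x B)) = fine (\int[m]_(x in A) P x B)%E.
Proof.
move=> mA mB; rewrite integral_mkcond; congr fine; apply: eq_integral => x _.
rewrite /patch indicE; case: ifPn => _; last by rewrite mul0r.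
by rewrite mul1r fineK// kernel_fin_num.
Qed.

End kernel_indic.

Lemma preimage_indic (T U : Type) (R : pzRingType) (f : T -> U) (A : set U) x :
  \1_A (f x) = \1_(f @^-1` A) x :> R.
Proof.
rewrite !indicE; have [Afx|nAfx] := pselect (A (f x)); first by rewrite !mem_set.
by rewrite !memNset.
Qed.

Lemma indic_Rintegral d (T : measurableType d) (R : realType)
    (m : {measure set T -> \bar R}) (A : set T) : measurable A ->
  \int[m]_x \1_A x = fine (m A).
Proof. by move=> mA; rewrite /Rintegral integral_indic// setIT. Qed.

Section bochner_dual.
Context d (T : measurableType d) (R : realType) (m : {finite_measure set T -> \bar R}).

Lemma bochner_integral_dual (S : completeNormedModType R) (l : S -> R^o) (f : T -> S) :
  topological_dual l -> bochner_integrable m f ->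
  l (bochner_integral m f) = \int[m]_x l (f x).
Proof.
move=> dl /bochner_integral_exists[v hv]; rewrite (bochner_integralE hv).
by rewrite /Rintegral (is_bochner_integral_linear dl hv).
Qed.

Lemma simple_approximation (S : normedModType R) (f : T -> S) (e : R) : 0 < e ->
  simple_limit f -> (norm_int m f < +oo)%E ->
  exists s, simple_fun s /\ (norm_int m (fun x => f x - s x)%R <= e%:E)%E.
Proof.
move=> e0 sf fin; have [s [fs sfx]] := simple_limit_approx sf fin.
have : norm_int m (fun x => f x - s n x) @[n --> \oo] --> 0%E by [].
move=> /fine_cvgP[fn /cvgrPdist_lt/(_ _ e0) h]; have [n [hn hn']] := filter_ex (filterI fn h).
exists (s n); split=> //; rewrite -(fineK hn) lee_fin ltW//.
by move: hn'; rewrite sub0r normrN ger0_norm// fine_ge0// norm_int_ge0.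
Qed.

(** The integrals are summable, so the sum of the [f i] is finite almost everywhere and its terms
    tend to 0. Convergence holds along the whole sequence, so two such limits can be combined. *)
Lemma summable_ae_cvg (f : nat -> T -> \bar R) (C : R) : 0 <= C ->
  (forall i, measurable_fun setT (f i)) -> (forall i x, 0 <= f i x)%E ->
  (forall i, (\int[m]_x f i x <= (C / (2 ^ i.+1)%:R)%:E)%E) ->
  {ae m, forall x, f i x @[i --> \oo] --> 0%E}.
Proof.
move=> C0 mf f0 fC; pose g x := (\sum_(0 <= i <oo) f i x)%E.
have mg : measurable_fun setT g.
  exact: (ge0_emeasurable_sum (P := xpredT) (fun i x _ _ => f0 i x) (fun i _ => mf i)).
have g0 x : (0 <= g x)%E by apply: nneseries_ge0 => i _ _; exact: f0.
have ig : m.-integrable setT g.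
  apply/integrableP; split=> //; under eq_integral do rewrite gee0_abs//.
  rewrite integral_nneseries//; apply: (@le_lt_trans _ _ C%:E); last exact: ltry.
  apply: le_trans (epsilon_trick0 xpredT C0).
  by apply: lee_nneseries => [i _ _|i _]; [exact: integral_ge0|exact: fC].
apply: (ae_imp (integrable_ae measurableT ig)) => x /(_ Logic.I) gx.
have gxoo : (g x < +oo)%E by rewrite -ge0_fin_numE.
apply: (@squeeze_cvge _ _ _ _ (fun=> 0%E) (f ^~ x) (fun N => \sum_(N <= i <oo) f i x)%E).
- apply: nearW => N; rewrite f0/=.
  have := @nneseries_lim_ge _ (f ^~ x) xpredT N N.+1 (fun i _ _ => f0 i x).
  by rewrite big_nat1.
- exact: cvg_cst.
- exact: (nneseries_tail_cvg gxoo (fun i _ => f0 i x)).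
Qed.

End bochner_dual.

(** * The barycenter under the adjoint kernel *)

Section contraction.
Context d d' (X : measurableType d) (Y : measurableType d') (R : realType)
  (S : completeNormedModType R).
Context (m : {finite_measure set X -> \bar R}) (n : {finite_measure set Y -> \bar R}).
Context (P : R.-pker X ~> Y).

(* Approximate [D] by a simple [t]. On the fibre [A] of [t] over [c], the integral of
   [D] is that of [P x A *: E x], and the norms of the latter sum to [norm_int m E]. *)
Lemma norm_int_contraction (D : Y -> S) (E : X -> S) :
  simple_limit D -> (norm_int n D < +oo)%E -> simple_limit E -> (norm_int m E < +oo)%E ->
  (forall B, measurable B -> bochner_integral n (fun y => \1_B y *: D y) =
    bochner_integral m (fun x => fine (P x B) *: E x)) ->
  (norm_int n D <= norm_int m E)%E.
Proof.
move=> sD finD sE finE eqB; apply/lee_addgt0Pr => e e0.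
have e20 : 0 < e / 2 by rewrite divr_gt0.
have [t [ft te]] := simple_approximation e20 sD finD.
have st := simple_fun_limit ft; have sDt := simple_limitB sD st.
pose A c := t @^-1` [set c]; have mA c : measurable (A c) by exact: ft.2.
pose r := fset_set (range t).
have bD : bochner_integrable n D.
  by apply/bochner_integrableP; split=> //; exact: simple_limit_strongly_measurable.
have bE : bochner_integrable m E.
  by apply/bochner_integrableP; split=> //; exact: simple_limit_strongly_measurable.
pose lam c := norm_int m (fun x => fine (P x (A c)) *: E x).
pose rho c := norm_int n (fun y => \1_(A c) y *: (D y - t y)).
have indicA c y : \1_(A c) y = (t y == c)%:R :> R.
  rewrite indicE; case: (eqVneq (t y) c) => tc; first by rewrite mem_set.
  by rewrite memNset// /A /= => E'; rewrite E' eqxx in tc.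
(* As [t] equals [c] on the fibre, the vector [n (A c) *: c] is within [rho c] of the integral [v]
   of [D] over it, and [v], rewritten as an integral over [X], has norm at most [lam c]. *)
have step c : c \in r -> ((fine (n (A c)) * `|c|)%:E <= lam c + rho c)%E.
  move=> cr; pose phi (w : S) : S := if w == c then w else 0.
  have fphi : simple_fun (phi \o t) by exact: fin_meas_comp.
  have phiE y : (phi \o t) y = \1_(A c) y *: t y.
    by rewrite /phi /= indicA; case: eqP => _; rewrite ?scale1r ?scale0r.
  have sphi : simple_integral n (phi \o t) = fine (n (A c)) *: c.
    rewrite (simple_integral_comp n phi ft) (big_fsetD1 c)//= big1_fset ?addr0.
      by rewrite /phi eqxx.
    by move=> w; rewrite !inE => /andP[/negbTE wc _] _; rewrite /phi wc scaler0.
  have [v hv] := bochner_integral_exists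
    (bochner_integrableZ (measurable_indic (mA c)) (indic_norm R (A c)) bD).
  have [w hw] := bochner_integral_exists
    (bochner_integrableZ (measurable_kernel_fine P (mA c)) (kernel_fine_norm P (mA c)) bE).
  have vw : v = w by rewrite -(bochner_integralE hv) -(bochner_integralE hw) eqB.
  have h1 := is_bochner_integral_dist hv fphi.
  have h2 := is_bochner_integral_norm hw.
  apply: (@le_trans _ _ ((`|v| + `|v - fine (n (A c)) *: c|)%:E)).
    rewrite lee_fin -[fine _ * _]/(fine (n (A c)) * `|c|).
    have -> : fine (n (A c)) * `|c| = `|fine (n (A c)) *: c|.
      by rewrite normrZ ger0_norm// fine_ge0.
    by have := ler_normB v (v - fine (n (A c)) *: c); rewrite subKr.
  rewrite EFinD leeD//; first by rewrite vw.
  rewrite -sphi; apply: le_trans h1 _; rewrite le_eqVlt; apply/orP; left; apply/eqP.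
  by apply: eq_norm_int; apply: filterE => y; rewrite phiE scalerBr.
have sumlam : (\sum_(c <- r) lam c = norm_int m E)%E.
  rewrite /lam /norm_int -ge0_integral_sum//; last first.
    move=> c; apply/measurable_EFinP; apply: simple_limit_norm.
    by apply: simple_limitZ => //; exact/measurable_simple_limit/measurable_kernel_fine.
  apply: eq_integral => x _; rewrite sumEFin.
  under eq_bigr do rewrite normrZ ger0_norm ?fine_ge0//.
  by rewrite -mulr_suml (kernel_fin_meas_sum P x ft) mul1r.
have sumrho : \sum_(c <- r) rho c = norm_int n (fun y => D y - t y).
  rewrite /rho /norm_int -ge0_integral_sum//; last first.
    move=> c; apply/measurable_EFinP; apply: simple_limit_norm.
    by apply: simple_limitZ => //; exact/measurable_simple_limit/measurable_indic.
  apply: eq_integral => y _; rewrite sumEFin.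
  have yr : t y \in r by rewrite in_fset_set//; [apply: mem_set; exists y|exact: ft.1].
  rewrite (big_fsetD1 (t y))//= big1_fset ?addr0; first by rewrite indicA eqxx scale1r.
  by move=> c; rewrite !inE => /andP[ct _] _; rewrite indicA eq_sym (negbTE ct) scale0r normr0.
(* The sum of [step] over the values of [t]. One error term is spent here and one in passing from
   [t] back to [D], hence the choice of [e / 2]. *)
have tE : (norm_int n t <= norm_int m E + norm_int n (fun y => D y - t y)%R)%E.
  rewrite (norm_int_simple n ft) (Rintegral_fin_meas n (fun w : S => `|w|) ft) -sumEFin.
  rewrite -sumlam -sumrho -big_split.
  by rewrite ![in leLHS]big_seq ![in leRHS]big_seq; apply: lee_sum => c cr; exact: step.
have DE : (norm_int n D <= norm_int n t + norm_int n (fun y => D y - t y)%R)%E.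
  apply: le_trans (norm_intD n st sDt); rewrite le_eqVlt; apply/orP; left; apply/eqP.
  by apply: eq_norm_int; apply: filterE => y; rewrite addrC subrK.
apply: le_trans DE _; apply: le_trans (leeD tE te) _.
have -> : e%:E = ((e / 2)%:E + (e / 2)%:E)%E by rewrite -EFinD -splitr.
by rewrite -addeA; apply: leeD2l; exact: leeD2r.
Qed.

End contraction.

Section adjoint_kernels.
Context (R : realType) (X Y : pmetricType R) (S : completeNormedModType R)
  (F : set (S -> R^o)) (mu : svmeasure (borel X) S) (nu : svmeasure (borel Y) S).
Context (Fsub : dual_subspace F) (Fsep : separates_points F).
Context (P : R.-pker (borel X) ~> (borel Y)) (Q : R.-pker (borel Y) ~> (borel X)).
Context (adj : forall A B, measurable A -> measurable B ->
  (\int[tv mu]_(x in A) P x B = \int[tv nu]_(y in B) Q y A)%E).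
Context (transport : forall B, measurable B -> sv_kpush P mu B = sv_eval nu B).

Let m := tv mu.
Let n := tv nu.
Let h : borel X -> S := density mu.
Let k : borel Y -> S := density nu.

Lemma adjoint_kpush A : measurable A -> kpush Q n A = m A.
Proof.
move=> mA; rewrite /kpush -adj//.
rewrite (eq_integral (cst 1%E)) ?integral_cst ?mul1e// => x _.
exact: prob_kernel.
Qed.

Lemma kernel_simple_integral (s : borel X -> S) y : simple_fun s ->
  simple_integral (Q y) s =
  \sum_(c <- fset_set (range s)) fine (Q y (s @^-1` [set c])) *: c.
Proof.
move=> fs; have Q1 : (Q y setT < +oo)%E.
  by apply: le_lt_trans (ltry 1); exact: kernel_le1.
have [q qE] := finite_measure_copy Q1.
by rewrite -qE -[s in LHS]/(idfun \o s) (simple_integral_comp q _ fs).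
Qed.

(** For an indicator this is the adjointness of [P] and [Q]; linearity over the finitely many values
    of [s] does the rest. *)
Lemma adjoint_simple_integral (s : borel X -> S) (l : S -> R^o) B : simple_fun s ->
  topological_dual l -> measurable B ->
  \int[n]_y (\1_B y * l (simple_integral (Q y) s)) = \int[m]_x (fine (P x B) * l (s x)).
Proof.
move=> fs [ll _] mB; pose L : {linear S -> R^o} := HB.pack l (GRing.isLinear.Build _ _ _ _ l ll).
have lZ a c : l (a *: c) = a * l c by rewrite -[l (a *: c)]/(L (a *: c)) linearZ.
pose A c := s @^-1` [set c]; have mA c : measurable (A c) by exact: fs.2.
pose r := fset_set (range s).
have E1 y : \1_B y * l (simple_integral (Q y) s) =
    \sum_(c <- r) l c * (\1_B y * fine (Q y (A c))).
  rewrite kernel_simple_integral// -[l (\sum_(c <- _) _)]/(L _) linear_sum mulr_sumr.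
  by apply: eq_bigr => c _; rewrite -[L _]/(l _) lZ mulrA mulrC.
have E2 x : fine (P x B) * l (s x) = \sum_(c <- r) l c * (\1_(A c) x * fine (P x B)).
  have xr : s x \in r by rewrite in_fset_set//; [apply: mem_set; exists x|exact: fs.1].
  rewrite (big_fsetD1 (s x))//= big1_fset ?addr0.
    by rewrite indicE mem_set// mul1r mulrC.
  move=> c; rewrite !inE => /andP[cs _] _; rewrite indicE memNset ?mul0r ?mulr0// /A /= => E.
  by rewrite E eqxx in cs.
have i1 c : n.-integrable setT (EFin \o (fun y => l c * (\1_B y * fine (Q y (A c))))).
  apply: norm_bounded_integrable.
    by do 2 apply: measurable_funM => //; exact: measurable_kernel_fine.
  exists `|l c| => y; rewrite !normrM ler_piMr// mulr_ile1// ?indic_norm//.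
  exact: (kernel_fine_norm Q (mA c)).
have i2 c : m.-integrable setT (EFin \o (fun x => l c * (\1_(A c) x * fine (P x B)))).
  apply: norm_bounded_integrable.
    by do 2 apply: measurable_funM => //; exact: measurable_kernel_fine.
  exists `|l c| => y; rewrite !normrM ler_piMr// mulr_ile1// ?indic_norm//.
  exact: (kernel_fine_norm P mB).
under eq_Rintegral do rewrite E1; under [RHS]eq_Rintegral do rewrite E2.
rewrite (Rintegral_sum r i1).2 (Rintegral_sum r i2).2; apply: eq_bigr => c _.
rewrite !RintegralZl//; last 2 first.
- apply: norm_bounded_integrable.
    by apply: measurable_funM => //; exact: measurable_kernel_fine.
  exists 1 => x; rewrite normrM mulr_ile1// ?indic_norm//.
  exact: (kernel_fine_norm P mB).
- apply: norm_bounded_integrable.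
    by apply: measurable_funM => //; exact: measurable_kernel_fine.
  exists 1 => y; rewrite normrM mulr_ile1// ?indic_norm//.
  exact: (kernel_fine_norm Q (mA c)).
by rewrite !kernel_indic_Rintegral// adj.
Qed.

Lemma simple_limit_kernel_integral (s : borel X -> S) : simple_fun s ->
  simple_limit (fun y => simple_integral (Q y) s) /\
  exists C, forall y, `|simple_integral (Q y) s| <= C.
Proof.
move=> fs; have mA c : measurable (s @^-1` [set c]) by exact: fs.2.
rewrite (funext (fun y => kernel_simple_integral y fs)); split.
  elim: (enum_fset _) => [|c r IH].
    rewrite (_ : (fun _ => _) = cst 0); first exact/simple_fun_limit/fin_meas_cst.
    by apply/funext => y; rewrite big_nil.
  rewrite (_ : (fun _ => _) = fun y => fine (Q y (s @^-1` [set c])) *: c +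
      \sum_(c <- r) fine (Q y (s @^-1` [set c])) *: c); last first.
    by apply/funext => y; rewrite big_cons.
  apply: simple_limitD => //; apply: simple_limitZ.
    exact/measurable_simple_limit/measurable_kernel_fine.
  exact/simple_fun_limit/fin_meas_cst.
exists (\sum_(c <- fset_set (range s)) `|c|) => y.
rewrite kernel_simple_integral//; apply: le_trans (ler_norm_sum _ _ _) _; apply: ler_sum => c _.
by rewrite normrZ ler_piMl// (kernel_fine_norm Q (mA c)).
Qed.

Lemma bounded_norm_int_lty d (T : measurableType d) (q : {finite_measure set T -> \bar R})
    (f : T -> S) (C : R) : simple_limit f -> (forall x, `|f x| <= C) -> (norm_int q f < +oo)%E.
Proof.
move=> sf fC; have i1 : q.-integrable setT (EFin \o (fun x => `|f x|)).
  apply: norm_bounded_integrable; first exact: simple_limit_norm.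
  by exists C => x; rewrite normr_id.
by rewrite /norm_int -ge0_fin_numE ?integral_ge0//; exact: integrable_fin_num.
Qed.

(** The contraction, applied to [D = int s dQ_y - k'] and [E = s - h']. Its hypothesis is an
    equality of two vectors for each [B], which [F] can decide: adjointness accounts for [s], and
    the transport identity for the densities. *)
Lemma adjoint_norm_int (s : borel X -> S) (h' : borel X -> S) (k' : borel Y -> S) :
  simple_fun s -> simple_limit h' -> {ae m, forall x, h x = h' x} ->
  simple_limit k' -> {ae n, forall y, k y = k' y} ->
  (norm_int n (fun y => simple_integral (Q y) s - k' y)%R <=
    norm_int m (fun x => h' x - s x)%R)%E.
Proof.
move=> fs sh' hh' sk' kk'.
have [su [C uC]] := simple_limit_kernel_integral fs.
have ss := simple_fun_limit fs.
have fu := bounded_norm_int_lty n su uC.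
have fk : (norm_int n k' < +oo)%E.
  by rewrite -(eq_norm_int kk'); have [] := (bochner_integrableP n k).1 (density_integrable nu).
have fh : (norm_int m h' < +oo)%E.
  by rewrite -(eq_norm_int hh'); have [] := (bochner_integrableP m h).1 (density_integrable mu).
have fs' : (norm_int m s < +oo)%E by rewrite (norm_int_simple m fs) ltry.
have fB d (T : measurableType d) (q : {finite_measure set T -> \bar R}) (f g : T -> S) :
    simple_limit f -> simple_limit g -> (norm_int q f < +oo)%E -> (norm_int q g < +oo)%E ->
    (norm_int q (fun x => f x - g x)%R < +oo)%E.
  move=> sf sg ff fg; have s0 : simple_limit (fun _ : T => 0 : S) by exact/simple_fun_limit/fin_meas_cst.
  apply: le_lt_trans (norm_int_sub q sf s0 sg) _; apply: lte_add_pinfty.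
    by apply: le_lt_trans ff; rewrite le_eqVlt; apply/orP; left; apply/eqP;
      apply: eq_norm_int; apply: filterE => x; rewrite subr0.
  apply: le_lt_trans fg; rewrite le_eqVlt; apply/orP; left; apply/eqP.
  by rewrite norm_int_subC; apply: eq_norm_int; apply: filterE => x; rewrite subr0.
rewrite [leRHS]norm_int_subC.
have sD := simple_limitB su sk'; have sE := simple_limitB ss sh'.
have fD := fB _ _ _ _ _ su sk' fu fk; have fE := fB _ _ _ _ _ ss sh' fs' fh.
apply: (norm_int_contraction (P := P)) => // B mB.
apply: contrapT => /Fsep[l Fl]; apply.
have dl := dual_subspace_dual Fsub Fl; have [ll _] := dl.
pose L : {linear S -> R^o} := HB.pack l (GRing.isLinear.Build _ _ _ _ l ll).
have lZB (a : R) u v : l (a *: (u - v)) = a * l u - a * l v.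
  by rewrite -[l (_ *: _)]/(L _) linearZ linearB -mulrBr.
have bint d (T : measurableType d) (q : {finite_measure set T -> \bar R}) (f : T -> S) :
    simple_limit f -> (norm_int q f < +oo)%E -> bochner_integrable q f.
  by move=> sf ff; apply/bochner_integrableP; split=> //; exact: simple_limit_strongly_measurable.
rewrite (bochner_integral_dual dl (bochner_integrableZ (measurable_indic mB) (indic_norm R B) (bint _ _ _ _ sD fD))).
rewrite (bochner_integral_dual dl (bochner_integrableZ (measurable_kernel_fine P mB)
  (kernel_fine_norm P mB) (bint _ _ _ _ sE fE))).
under eq_Rintegral do rewrite lZB; under [RHS]eq_Rintegral do rewrite lZB.
have wi d (T : measurableType d) (q : {finite_measure set T -> \bar R}) (f : T -> S) (c : T -> R) :
    simple_limit f -> (norm_int q f < +oo)%E -> measurable_fun setT c -> (forall x, `|c x| <= 1) ->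
    q.-integrable setT (EFin \o (fun x => c x * l (f x))).
  move=> sf ff mc c1; have := simple_limit_dual_integrable dl sf ff => il.
  exact: (weighted_integrable (measurable_id (D := setT)) il mc c1).
rewrite !RintegralB//; [|exact: wi (measurable_kernel_fine P mB) (kernel_fine_norm P mB)
  |exact: wi (measurable_kernel_fine P mB) (kernel_fine_norm P mB)
  |exact: wi (measurable_indic mB) (indic_norm R B)|exact: wi (measurable_indic mB) (indic_norm R B)].
rewrite adjoint_simple_integral//; congr (_ - _).
transitivity (\int[n]_y (\1_B y * l (k y))).
  by congr fine; apply: ae_eq_lower_integral; apply: (ae_imp kk') => y ->.
rewrite -(kernel_transport_dual mB dl (transport mB)).
by congr fine; apply: ae_eq_lower_integral; apply: (ae_imp hh') => x; rewrite -/h => ->.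
Qed.

(** For almost every [y], the same sequence [s i] converges to [h] in L1 of [Q y] and has integrals
    converging to [k y]; together these say that [k y] is the Bochner integral. The first
    convergence comes from [Q] pushing [tv nu] to [tv mu], the second from [adjoint_norm_int]. *)
Lemma adjoint_barycenter : kernel_barycenter mu nu.
Proof.
exists Q; split; first exact: adjoint_kpush.
have mh : strongly_measurable m h by have [] := density_integrable mu.
have mk : strongly_measurable n k by have [] := density_integrable nu.
have [h' sh' hh'] := (strongly_measurableP m h).1 mh.
have [k' sk' kk'] := (strongly_measurableP n k).1 mk.
have fh : (norm_int m h' < +oo)%E.
  by rewrite -(eq_norm_int hh'); have [] := (bochner_integrableP m h).1 (density_integrable mu).
(* Geometric errors make both sequences of L1 distances summable, as almost everywhere convergence
   requires. *)
have e0 (i : nat) : 0 < 1 / (2 ^ i.+1)%:R :> R by rewrite divr_gt0// ltr0n expn_gt0.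
have [s hs] := choice (fun i => simple_approximation (e0 i) sh' fh).
have fs i : simple_fun (s i) by have [] := hs i.
have sls i := simple_limitB sh' (simple_fun_limit (fs i)).
have mhs i : measurable_fun setT (fun x => (`|h' x - s i x|)%:E).
  by apply/measurable_EFinP; exact: simple_limit_norm.
pose e i y := (\int[Q y]_x (`|h' x - s i x|)%:E)%E.
have cvg_e : {ae n, forall y, e i y @[i --> \oo] --> 0%E}.
  apply: (summable_ae_cvg (C := 1)) => //.
  - by move=> i; exact: measurable_kernel_integral.
  - by move=> i y; exact: integral_ge0.
  - move=> i; rewrite (kpush_integral adjoint_kpush)//.
    by have [] := hs i.
pose u i y := simple_integral (Q y) (s i).
have su i : simple_limit (fun y => u i y - k' y).
  by apply: simple_limitB => //; have [] := simple_limit_kernel_integral (fs i).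
have cvg_u : {ae n, forall y, (`|u i y - k' y|)%:E @[i --> \oo] --> 0%E}.
  apply: (summable_ae_cvg (C := 1)) => //.
  - by move=> i; apply/measurable_EFinP; exact: simple_limit_norm.
  - move=> i; apply: le_trans (adjoint_norm_int (fs i) sh' hh' sk' kk') _.
    by have [] := hs i.
(* The null set [N] of [m] satisfies [Q y N = 0] for almost every [y], because [Q y N] integrates to
   [m N = 0]. The convergence criterion is applied to a constant sequence. *)
have aeQ : {ae n, forall y, {ae Q y, forall x, h' x = h x}}.
  have [N [mN N0 subN]] := hh'.
  have : {ae n, forall y, Q y N @[i --> \oo] --> 0%E}.
    apply: (summable_ae_cvg (f := fun _ y => Q y N) (C := 1)) => //.
    - by move=> i; exact: measurable_kernel.
    - by move=> i; rewrite -[X in (X <= _)%E]/(kpush Q n N) adjoint_kpush// N0 lee_fin ltW.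
  move=> hN; apply: (ae_imp hN) => y /cvg_lim; rewrite lim_cst// => QN.
  exists N; split=> //; first exact: QN.
  by apply: subset_trans subN => x /= hx hx'; apply: hx; rewrite hx'.
have all := ae_imp2 (ae_imp2 cvg_e cvg_u (fun y => @conj _ _)) (ae_imp2 aeQ kk' (fun y => @conj _ _)) (fun y => @conj _ _).
apply: (ae_imp all) => y [[ey uy] [hy ky]].
split.
  by apply/strongly_measurableP; exists h' => //; apply: (ae_imp hy) => x ->.
exists s; last first.
  rewrite -/k ky; apply/cvgrPdist_lt => d d0.
  have /fine_cvgP[_ /cvgrPdist_lt/(_ _ d0)] := uy.
  by apply: filterS => i /=; rewrite sub0r normrN normr_id distrC.
split=> //; apply: cvg_trans ey; apply: near_eq_cvg; apply: nearW => i.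
by apply: ae_eq_lower_integral; apply: (ae_imp hy) => x ->.
Qed.

End adjoint_kernels.

(** * From the positivity condition to plans and kernels *)

Section coupling_kernels.
Context (R : realType) (X Y : pmetricType R) (S : completeNormedModType R)
  (F : set (S -> R^o)) (mu : svmeasure (borel X) S) (nu : svmeasure (borel Y) S).
Context (cX : compact [set: X]) (cY : compact [set: Y])
  (Fsub : dual_subspace F) (Fsep : separates_points F)
  (mu_bounded : [bounded density mu x | x in [set: X]])
  (mu_continuous : continuous (density mu : X -> weak_topology F)).

Let h : X -> S := density mu.

(** The kernel is known on rectangles. Approximating [l \o h] by simple functions of [x] turns the
    rectangle identity into the transport identity tested against [l], and [F] separates the
    resulting vectors. *)
Lemma coupling_transport (a : borel cantor_space -> borel X) (b : borel cantor_space -> borel Y)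
    (M : {finite_measure set (borel cantor_space) -> \bar R}) (P : R.-pker (borel X) ~> (borel Y)) :
  measurable_fun setT a -> measurable_fun setT b ->
  (forall A B, measurable A -> measurable B ->
    (\int[tv mu]_(x in A) P x B)%E = M (a @^-1` A `&` b @^-1` B)) ->
  (forall l B, F l -> measurable B ->
    \int[M]_k (\1_B (b k) * l (h (a k))) = \int[tv nu]_y (\1_B y * l (density nu y))) ->
  forall B, measurable B -> sv_kpush P mu B = sv_eval nu B.
Proof.
move=> ma mb PM hM; apply: (kernel_transport_separated Fsep Fsub) => l B Fl mB.
rewrite -(hM l B Fl mB).
have pre d d' (T : measurableType d) (U : measurableType d') (g : T -> U) A :
    measurable_fun setT g -> measurable A -> measurable (g @^-1` A).
  by move=> mg mA; rewrite -[_ @^-1` _]setTI; exact: mg.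
have clh := weak_continuous_dual mu_continuous Fl.
have mlh : measurable_fun setT (l \o h : borel X -> R) by exact: continuous_borel_measurable.
have [C hC] := compact_norm_bounded cX clh.
have iw1 : (tv mu).-integrable setT (EFin \o (fun x => fine (P x B))).
  apply: norm_bounded_integrable; first exact: measurable_kernel_fine.
  by exists 1; exact: kernel_fine_norm.
have iw2 : M.-integrable setT (EFin \o (fun k => \1_B (b k))).
  apply: norm_bounded_integrable; last by exists 1 => k; exact: indic_norm.
  by apply: measurableT_comp mb; exact: measurable_indic.
have mid : measurable_fun setT (id : borel X -> borel X) by exact: measurable_id.
have := @Rintegral_bounded_weights _ _ _ _ _ _ _ _ _ id a _ _ mid ma iw1 iw2 _ (l \o h) C mlh hC.
rewrite /= => /(_ _)/=; under eq_Rintegral do rewrite mulrC.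
under [X in _ -> _ = X]eq_Rintegral do rewrite mulrC.
apply=> A mA; rewrite kernel_indic_Rintegral// PM// -indic_Rintegral.
  by apply: eq_Rintegral => k _; rewrite indicI /= !preimage_indic.
by apply: measurableI; exact: pre.
Qed.

(* [l0] only serves to show that [h] does not vanish. Over a finite cover by the sets
   [0 < l_i (h x)], take [sum_i max(0, l_i (h x)) l_i] and normalise. *)
Lemma normalizing_section (l0 : S -> R^o) : topological_dual l0 ->
  (forall x, l0 (h x) = 1) ->
  exists2 f : X -> S -> R^o, continuous_into F f & forall x, f x (h x) = 1.
Proof.
move=> [ll0 _] l1.
have l00 : l0 0 = 0.
  pose L : {linear S -> R^o} := HB.pack l0 (GRing.isLinear.Build _ _ _ _ l0 ll0).
  exact: (linear0 L).
have /choice[lam hlam] : forall x, exists l, F l /\ 0 < l (h x).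
  move=> x; have hx0 : h x <> 0.
    by move=> hx; have := l1 x; rewrite hx l00 => /eqP; rewrite eq_sym oner_eq0.
  have [l Fl lx] := Fsep hx0; have [ll _] := dual_subspace_dual Fsub Fl.
  pose L : {linear S -> R^o} := HB.pack l (GRing.isLinear.Build _ _ _ _ l ll).
  have l0' : l 0 = 0 by exact: (linear0 L).
  have [lp|ln] := ltP 0 (l (h x)); first by exists l.
  exists (fun s => -1 * l s); split; first exact: dual_subspaceZ.
  rewrite mulN1r oppr_gt0 lt_neqAle ln andbT; apply/eqP => lx0.
  by apply: lx; rewrite lx0 l0'.
have clam x := weak_continuous_dual mu_continuous (hlam x).1.
have cc : cover_compact [set: X] by rewrite -compact_cover.
have [x _|x _|D _ cD] := cc X setT (fun x => [set x' | 0 < lam x (h x')]).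
- by move/continuousP : (clam x) => /(_ [set r | 0 < r] (@open_gt _ 0)).
- by exists x => //; have [] := hlam x.
pose c i x : R^o := Num.max 0 (lam i (h x)).
have cc' i : continuous (c i).
  move=> x; apply: (@continuous_max _ _ (cst 0) (fun x => lam i (h x))); first exact: cvg_cst.
  exact: clam.
pose f0 (x : X) (s : S) : R^o := \sum_(i <- enum_fset D) c i x * lam i s.
have cf0 : continuous_into F f0.
  rewrite /f0; elim: (enum_fset D) => [|i r IH].
    rewrite (_ : (fun x : X => _) = fun=> (fun=> 0)); last first.
      by apply/funext => x; apply/funext => s; rewrite big_nil.
    by apply: continuous_into_cst => //; have [_ F0 _] := Fsub.
  rewrite (_ : (fun x : X => _) = fun x s => c i x * lam i s + \sum_(i <- r) c i x * lam i s).
    apply: continuous_intoD => //; apply: continuous_intoM => //.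
    by apply: continuous_into_cst => //; have [] := hlam i.
  by apply/funext => x; apply/funext => s; rewrite big_cons.
have c_ge0 i x : 0 <= c i x * lam i (h x).
  rewrite /c; have [l_le0|l_gt0] := leP (lam i (h x)) 0; first by rewrite mul0r.
  by rewrite mulr_ge0// ltW.
have f0_gt0 x : 0 < f0 x (h x).
  have [i iD /= ix] := cD x Logic.I.
  rewrite /f0 (big_fsetD1 i)//= ltr_pwDl ?sumr_ge0//.
  by rewrite /c max_r ?mulr_gt0// ltW.
have [C hC] : exists C, forall x, `|h x| <= C.
  have [C [_ /(_ (C + 1))]] := mu_bounded; rewrite ltrDl ltr01 => /(_ isT) hC.
  by exists (C + 1) => x; exact: hC.
have cf0h : continuous (fun x => f0 x (h x) : R^o).
  have cid : continuous (id : X -> X) by move=> x A hA; exact: hA.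
  exact: (continuous_into_eval Fsub cf0 cid hC (weak_continuous_dual mu_continuous)).
exists (fun x s => (f0 x (h x))^-1 * f0 x s); last by move=> x; rewrite mulVf// gt_eqF.
apply: (continuous_intoM Fsub (c := fun x => (f0 x (h x))^-1)) => // x.
by apply: cvgV; [rewrite gt_eqF|exact: cf0h].
Qed.

Section equivalences.
Context (f : X -> S -> R^o) (cf : continuous_into F f)
  (f1 : forall x, f x (density mu x) = 1).

Lemma nonneg_pairing_plans : nonneg_pairing F mu nu -> plans F mu nu !=set0.
Proof.
move=> pos; have [p [M [cp hM]]] := coupling_exists cX cY Fsub mu_bounded mu_continuous cf f1 pos.
exact: (coupling_plan cX cY Fsub mu_bounded mu_continuous cp hM).
Qed.

(** The measure and the coordinate maps are returned along with [P], because [Q] must come from the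
    same measure for the two kernels to be adjoint. *)
Lemma nonneg_pairing_kernels : nonneg_pairing F mu nu ->
  exists (a : borel cantor_space -> borel X) (b : borel cantor_space -> borel Y)
    (M : {finite_measure set (borel cantor_space) -> \bar R}) (P : R.-pker (borel X) ~> (borel Y)),
    [/\ measurable_fun setT a, measurable_fun setT b,
      forall A B, measurable A -> measurable B ->
        (\int[tv mu]_(x in A) P x B)%E = M (a @^-1` A `&` b @^-1` B) &
      forall B, measurable B -> sv_kpush P mu B = sv_eval nu B].
Proof.
move=> pos; have [p [M [cp hM]]] := coupling_exists cX cY Fsub mu_bounded mu_continuous cf f1 pos.
pose a : borel cantor_space -> borel X := fst \o p.
pose b : borel cantor_space -> borel Y := snd \o p.
have ma : measurable_fun setT a.
  apply: continuous_borel_measurable2 => k.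
  by apply: continuous_comp; [exact: cp|exact: cvg_fst].
have mb : measurable_fun setT b.
  apply: continuous_borel_measurable2 => k.
  by apply: continuous_comp; [exact: cp|exact: cvg_snd].
have aM := coupling_fst Fsub cf f1 cp hM.
have [P PM] := cantor_conditional_kernel ma mb aM.
exists a, b, M, P; split=> //; apply: (coupling_transport ma mb PM) => l B.
exact: (coupling_snd cY Fsub mu_bounded mu_continuous cp hM).
Qed.

Lemma nonneg_pairing_transport : nonneg_pairing F mu nu -> kernel_transport mu nu.
Proof. by move=> /nonneg_pairing_kernels[a [b [M [P [_ _ _ hP]]]]]; exists P. Qed.

(* Applying [l0] to [P mu = nu] shows that the second marginal of the coupling is
   [tv nu], so that the coupling can also be disintegrated over [Y]. *)
Lemma nonneg_pairing_barycenter (l0 : S -> R^o) : topological_dual l0 ->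
  (forall x, l0 (density mu x) = 1) -> (forall y, l0 (density nu y) = 1) ->
  nonneg_pairing F mu nu -> kernel_barycenter mu nu.
Proof.
move=> dl0 l0h l0k /nonneg_pairing_kernels[a [b [M [P [ma mb PM hP]]]]].
have bM B : measurable B -> M (b @^-1` B) = tv nu B.
  move=> mB; have := kernel_transport_dual mB dl0 (hP B mB).
  under eq_Rintegral do rewrite l0h mulr1; under [RHS]eq_Rintegral do rewrite l0k mulr1.
  rewrite indic_Rintegral// => E.
  have := kernel_indic_Rintegral (tv mu) P measurableT mB.
  rewrite PM// preimage_setT setTI; under eq_Rintegral do rewrite indicT mul1r.
  rewrite E => E'; have mpre : measurable (b @^-1` B) by rewrite -[_ @^-1` _]setTI; exact: mb.
  by rewrite -[LHS]fineK ?fin_num_measure// -E' fineK// fin_num_measure.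
have [Q QM] := cantor_conditional_kernel mb ma bM.
apply: (adjoint_barycenter Fsub Fsep (P := P) (Q := Q)) => // A B mA mB.
by rewrite PM// QM// setIC.
Qed.

End equivalences.

End coupling_kernels.

Theorem theorem3p46 (R : realType) (X Y : pmetricType R)
  (S : completeNormedModType R) (F : set (S -> R^o))
  (mu : svmeasure (borel X) S) (nu : svmeasure (borel Y) S)
  (cX : compact [set: X]) (cY : compact [set: Y])
  (Fsub : dual_subspace F) (Fsep : separates_points F)
  (mu_bounded : [bounded density mu x | x in [set: X]])
  (mu_continuous : continuous (density mu : X -> weak_topology F)) :
  let s1 := kernel_barycenter mu nu in
  let s2 := convex_domination F mu nu in
  let s3 := plans F mu nu !=set0 in
  let s4 := kernel_transport mu nu in
  ((exists2 l : S -> R^o, topological_dual l &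
      (forall x, l (density mu x) = 1) /\ (forall y, l (density nu y) = 1)) ->
    [/\ s1 <-> s2, s2 <-> s3 & s3 <-> s4]) /\
  ((exists2 f : X -> S -> R^o, continuous_into F f &
      forall x, f x (density mu x) = 1) ->
    [/\ s1 -> s2, s2 -> s3 & s3 <-> s4]).
Proof.
move=> s1 s2 s3 s4.
have s12 : s1 -> s2 := barycenter_domination cX Fsub mu_continuous.
have s2p : s2 -> nonneg_pairing F mu nu := convex_domination_nonneg_pairing cX cY Fsub.
have s3p : s3 -> nonneg_pairing F mu nu := plans_nonneg_pairing cX cY Fsub.
have s4p : s4 -> nonneg_pairing F mu nu.
  by move=> [P hP]; exact: (kernel_transport_nonneg_pairing cX cY Fsub mu_bounded mu_continuous hP).
(* Shared by both parts: in (b) the section [f] is given, in (a) it is constructed from [l]. *)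
have p34 (f : X -> S -> R^o) : continuous_into F f -> (forall x, f x (density mu x) = 1) ->
    nonneg_pairing F mu nu -> s3 /\ s4.
  move=> cf f1 pos; split.
    exact: (nonneg_pairing_plans cX cY Fsub mu_bounded mu_continuous cf f1).
  exact: (nonneg_pairing_transport cX cY Fsub Fsep mu_bounded mu_continuous cf f1).
split=> [[l dl [lh lk]]|[f cf f1]].
  have [f cf f1] := normalizing_section cX Fsub Fsep mu_bounded mu_continuous dl lh.
  have p1 : nonneg_pairing F mu nu -> s1.
    exact: (nonneg_pairing_barycenter cX cY Fsub Fsep mu_bounded mu_continuous cf f1 dl lh lk).
  have {}p34 := p34 f cf f1.
  split; split=> //.
  - by move=> /s2p/p1.
  - by move=> /s2p/p34[].
  - by move=> /s3p/p1/s12.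
  - by move=> /s3p/p34[].
  - by move=> /s4p/p34[].
have {}p34 := p34 f cf f1.
split=> //; first by move=> /s2p/p34[].
by split=> [/s3p/p34[]|/s4p/p34[]].
Qed.
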